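(* Let $\gamma_a,\gamma_s,\kappa_a,\kappa_s,\sigma_B>0$, $\lambda\ge 0$, $\varepsilon_a\in(0,2)$, $r_0>0$. Let $\beta_s\in W^{1,\infty}(\mathbb R)$ be nondecreasing with $\beta_s>0$, and let $q\in C^{\theta_0}(I)\cap L^\infty(I)$ for some $\theta_0\in(0,1)$, $q\ge 0$. Let $\overline{\mathbf E}^{\max}\in\mathbb R^2$ be the warmest equilibrium of the ODE system given in the context with $\bar q=r_0\sup_I q$, let $\mathbf T^{q,\max}$ be the solution of $\mathbf T'=\mathbf A\mathbf T+\mathbf G_0(\mathbf T)$ with the constant initial condition $\overline{\mathbf E}^{\max}$, and let $\mathbf T^{q,\max}_\infty=\lim_{t\to+\infty}\mathbf T^{q,\max}(t,\cdot)$ (limit uniform on $\bar I$). Then $\mathbf T^{q,\max}_\infty$ is the warmest equilibrium of $\mathbf T'=\mathbf A\mathbf T+\mathbf G_0(\mathbf T)$, that is, any other stationary solution $\mathbf T^q$ of this equation satisfies $$\mathbf T^q(x)\le\mathbf T^{q,\max}_\infty(x)\qquad\forall\,x\in\bar I .$$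
   Context: Let $I=(-1,1)$, $\rho(x)=1-x^2$, $H=L^2(I)$, $V=\{u\in H: u \text{ locally absolutely continuous in } I,\ \sqrt{\rho}\,u'\in L^2(I)\}$ with norm $\|u\|_V^2=\|u\|_{L^2(I)}^2+\|\sqrt\rho\,u'\|_{L^2(I)}^2$, and $D(A)=\{u\in H: u\text{ locally absolutely continuous in } I,\ \rho u'\in H^1_0(I)\}$, $Au=(\rho u')'$; $D(A)$ is continuously embedded in $C(\bar I)$. The operator $A$ is self-adjoint and dissipative on $H$ and generates an analytic semigroup of contractions. Set $\mathbf H=H\times H$, $\mathbf V=V\times V$, $\mathbf D(\mathbf A)=D(A)\times D(A)$, $\mathbf A(u_a,u_s)=(\kappa_aAu_a,\kappa_sAu_s)$. Inequalities between vectors are component-wise. The map $\mathbf G_0:\mathbf V\to\mathbf H$ is $$\mathbf G_0(u_a,u_s)=\begin{pmatrix}\frac1{\gamma_a}\left[-\lambda(u_a-u_s)+\varepsilon_a\sigma_B|u_s|^3u_s-2\varepsilon_a\sigma_B|u_a|^3u_a\right]\\ \frac1{\gamma_s}\left[-\lambda(u_s-u_a)-\sigma_B|u_s|^3u_s+\varepsilon_a\sigma_B|u_a|^3u_a+r_0\,q\,\beta_s(u_s)\right]\end{pmatrix}.$$ Solutions of $\mathbf T'=\mathbf A\mathbf T+\mathbf G_0(\mathbf T)$ with $\mathbf T(0)=\mathbf T^0\in\mathbf V$ are mild: $\mathbf T(t)=e^{t\mathbf A}\mathbf T^0+\int_0^te^{(t-s)\mathbf A}\mathbf G_0(\mathbf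 T(s))\,ds$, $\mathbf T$ continuous with values in $\mathbf V$. An equilibrium (stationary solution) is an $\mathbf E\in\mathbf D(\mathbf A)$ with $\mathbf A\mathbf E+\mathbf G_0(\mathbf E)=\mathbf 0$. The ODE system is $$\gamma_aT_a'=-\lambda(T_a-T_s)+\varepsilon_a\sigma_B|T_s|^3T_s-2\varepsilon_a\sigma_B|T_a|^3T_a,\qquad \gamma_sT_s'=-\lambda(T_s-T_a)-\sigma_B|T_s|^3T_s+\varepsilon_a\sigma_B|T_a|^3T_a+\bar q\,\beta_s(T_s).$$ Its warmest equilibrium is the (existing) equilibrium point which is component-wise greater than or equal to every equilibrium point. It is known that $\mathbf T^{q,\max}$ is globally defined and that $\mathbf T^{q,\max}(t,\cdot)$ converges, uniformly on $\bar I$, as $t\to+\infty$ to an equilibrium of $\mathbf T'=\mathbf A\mathbf T+\mathbf G_0(\mathbf T)$. *)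

(* Defs.v *)
From HB Require Import structures.
From mathcomp Require Import all_boot all_order all_algebra.
From mathcomp Require Import all_classical all_reals all_analysis.

Set Implicit Arguments.
Unset Strict Implicit.
Unset Printing Implicit Defensive.
Import Order.TTheory GRing.Theory Num.Theory.
Import numFieldNormedType.Exports.

Local Open Scope classical_set_scope.
Local Open Scope ring_scope.

(** A function on [J] is represented by a total function [R -> R] of which only
    the values on [J] are used. An element of an L^p space is represented by a
    function, two functions being identified when they agree almost everywhere
    on [J]. *)

Definition Lp (R : realType) (p : \bar R) (J : set R) (f : R -> R) : Prop :=
  (f \_ J) \in Lfun (@lebesgue_measure R) p.

Definition abs_cont (R : realType) (a b : R) (f : R -> R) : Prop :=
  forall e : R, 0 < e -> exists2 d : R, 0 < d &
    forall (n : nat) (x y : nat -> R),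
      (forall i, (i < n)%N -> [/\ a <= x i, x i <= y i & y i <= b]) ->
      (forall i j, (i < j)%N -> (j < n)%N -> y i <= x j) ->
      \sum_(i < n) (y i - x i) < d ->
      \sum_(i < n) `|f (y i) - f (x i)| < e.

Definition loc_abs_cont (R : realType) (J : set R) (f : R -> R) : Prop :=
  forall a b : R, a <= b -> `[a, b] `<=` J -> abs_cont a b f.

(** The Sobolev space W^{1,p}(J) for an open interval [J]. A locally absolutely
    continuous function is derivable almost everywhere; where it is not, [f^`()]
    takes a default value, which is irrelevant here. *)
Definition W1 (R : realType) (p : \bar R) (J : set R) (f : R -> R) : Prop :=
  [/\ Lp p J f, loc_abs_cont J f & Lp p J f^`()%classic].

Definition I1 (R : realType) : set R := `]-1, 1[.
Definition I1bar (R : realType) : set R := `[-1, 1].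

Definition rho (R : realType) (x : R) : R := 1 - x ^+ 2.

Definition H1_0 (R : realType) (w : R -> R) : Prop :=
  [/\ W1 2%:E (@I1 R) w,
      w x @[x --> (-1)^'+] --> (0 : R) & w x @[x --> 1^'-] --> (0 : R)].

Definition normH (R : realType) (u : R -> R) : R :=
  fine ('N[@lebesgue_measure R]_2%:E[EFin \o (u \_ (@I1 R))])%E.

Definition sqrt_rho_deriv (R : realType) (u : R -> R) : R -> R :=
  fun x => Num.sqrt (rho x) * u^`()%classic x.

Definition inV (R : realType) (u : R -> R) : Prop :=
  [/\ Lp 2%:E (@I1 R) u, loc_abs_cont (@I1 R) u
    & Lp 2%:E (@I1 R) (sqrt_rho_deriv u)].

Definition normV (R : realType) (u : R -> R) : R :=
  Num.sqrt (normH u ^+ 2 + normH (sqrt_rho_deriv u) ^+ 2).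

Definition rho_deriv (R : realType) (u : R -> R) : R -> R :=
  fun x => rho x * u^`()%classic x.

Definition domA (R : realType) (u : R -> R) : Prop :=
  [/\ Lp 2%:E (@I1 R) u, loc_abs_cont (@I1 R) u & H1_0 (rho_deriv u)].

Definition opA (R : realType) (u : R -> R) : R -> R := (rho_deriv u)^`()%classic.

Notation fun2 R := ((R -> R) * (R -> R))%type.

Definition inHH (R : realType) (u : fun2 R) : Prop :=
  Lp 2%:E (@I1 R) u.1 /\ Lp 2%:E (@I1 R) u.2.

Definition eqHH (R : realType) (u v : fun2 R) : Prop :=
  ae_eq (@lebesgue_measure R) (@I1 R) u.1 v.1 /\
  ae_eq (@lebesgue_measure R) (@I1 R) u.2 v.2.

Definition normHH (R : realType) (u : fun2 R) : R :=
  Num.sqrt (normH u.1 ^+ 2 + normH u.2 ^+ 2).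

Definition inVV (R : realType) (u : fun2 R) : Prop := inV u.1 /\ inV u.2.

Definition normVV (R : realType) (u : fun2 R) : R :=
  Num.sqrt (normV u.1 ^+ 2 + normV u.2 ^+ 2).

Definition domAA (R : realType) (u : fun2 R) : Prop := domA u.1 /\ domA u.2.

Definition opAA (R : realType) (kappa_a kappa_s : R) (u : fun2 R) : fun2 R :=
  (kappa_a *: opA u.1, kappa_s *: opA u.2).

Definition continuous2_bar (R : realType) (u : fun2 R) : Prop :=
  {within @I1bar R, continuous u.1} /\ {within @I1bar R, continuous u.2}.

(** Boundedness and linearity make [S t] compatible with [eqHH]. *)
Definition C0_semigroup (R : realType) (S : R -> fun2 R -> fun2 R) : Prop :=
  [/\ forall t u, 0 <= t -> inHH u -> inHH (S t u),
      forall t (c : R) u v, 0 <= t -> inHH u -> inHH v ->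
        eqHH (S t (c *: u + v)) (c *: S t u + S t v),
      forall t, 0 <= t -> exists M : R,
        forall u, inHH u -> normHH (S t u) <= M * normHH u,
      (forall u, inHH u -> eqHH (S 0 u) u) /\
      (forall t s u, 0 <= t -> 0 <= s -> inHH u ->
        eqHH (S (t + s) u) (S t (S s u)))
    & forall u, inHH u -> normHH (S t u - u) @[t --> 0^'+] --> (0 : R)].

(** [S] is the C0-semigroup whose infinitesimal generator is the operator [A]
    with domain [D]. [D] consists of locally absolutely continuous functions,
    hence the representative [w] of the class of [u]. *)
Definition semigroup_generated_by (R : realType)
    (D : fun2 R -> Prop) (A : fun2 R -> fun2 R)
    (S : R -> fun2 R -> fun2 R) : Prop :=
  C0_semigroup S /\
  forall u v, inHH u -> inHH v ->
    ((normHH (h^-1 *: (S h u - u) - v) @[h --> 0^'+] --> (0 : R)) <->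
     (exists w, [/\ D w, eqHH u w & eqHH v (A w)])).

Definition tagged_partition (R : realType) (a b d : R) (n : nat)
    (p c : nat -> R) : Prop :=
  [/\ p 0%N = a, p n = b &
      forall i, (i < n)%N ->
        [/\ p i <= c i, c i <= p i.+1 & p i.+1 - p i < d]].

(** The integral of an [H x H]-valued function over [[a, b]], as the limit in
    norm of its Riemann sums; for a continuous integrand it is the Bochner
    integral. *)
Definition is_integralHH (R : realType) (f : R -> fun2 R) (a b : R)
    (v : fun2 R) : Prop :=
  [/\ forall s, a <= s <= b -> inHH (f s), inHH v &
      forall e : R, 0 < e -> exists2 d : R, 0 < d &
        forall (n : nat) (p c : nat -> R), tagged_partition a b d n p c ->
          normHH (\sum_(i < n) (p i.+1 - p i) *: f (c i) - v) < e].

(** [T] is a mild solution on [[0, +oo[] of T' = A T + G(T), T(0) = T0, where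
    [S] is the semigroup generated by [A]. *)
Definition mild_solution (R : realType) (S : R -> fun2 R -> fun2 R)
    (G : fun2 R -> fun2 R) (T0 : fun2 R) (T : R -> fun2 R) : Prop :=
  [/\ forall t, 0 <= t -> inVV (T t),
      forall t, 0 <= t ->
        normVV (T s - T t) @[s --> within `[0, +oo[ (nbhs t)] --> (0 : R),
      eqHH (T 0) T0
    & forall t, 0 <= t -> exists2 v,
        is_integralHH (fun s => S (t - s) (G (T s))) 0 t v &
        eqHH (T t) (S t T0 + v)].

Definition react_a (R : realType) (lambda eps_a sigma_B a s : R) : R :=
  - lambda * (a - s) + eps_a * sigma_B * `|s| ^+ 3 * s
  - 2 * eps_a * sigma_B * `|a| ^+ 3 * a.

Definition react_s (R : realType) (lambda eps_a sigma_B : R) (beta_s : R -> R)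
    (Q a s : R) : R :=
  - lambda * (s - a) - sigma_B * `|s| ^+ 3 * s
  + eps_a * sigma_B * `|a| ^+ 3 * a + Q * beta_s s.

Definition G0 (R : realType)
    (gamma_a gamma_s lambda eps_a sigma_B r0 : R) (q beta_s : R -> R)
    (u : fun2 R) : fun2 R :=
  (fun x => gamma_a^-1 * react_a lambda eps_a sigma_B (u.1 x) (u.2 x),
   fun x => gamma_s^-1 *
     react_s lambda eps_a sigma_B beta_s (r0 * q x) (u.1 x) (u.2 x)).

Definition ode_equilibrium (R : realType) (lambda eps_a sigma_B : R)
    (beta_s : R -> R) (qbar : R) (E : R * R) : Prop :=
  react_a lambda eps_a sigma_B E.1 E.2 = 0 /\
  react_s lambda eps_a sigma_B beta_s qbar E.1 E.2 = 0.

Definition warmest_ode_equilibrium (R : realType) (lambda eps_a sigma_B : R)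
    (beta_s : R -> R) (qbar : R) (E : R * R) : Prop :=
  ode_equilibrium lambda eps_a sigma_B beta_s qbar E /\
  forall F : R * R, ode_equilibrium lambda eps_a sigma_B beta_s qbar F ->
    F.1 <= E.1 /\ F.2 <= E.2.

(** A stationary solution of T' = A T + G(T). As D(A) embeds into the continuous
    functions on [[-1, 1]], it is given by its continuous representative, so
    that its values at -1 and 1 are meaningful. *)
Definition stationary (R : realType) (kappa_a kappa_s : R)
    (G : fun2 R -> fun2 R) (E : fun2 R) : Prop :=
  [/\ continuous2_bar E, domAA E & eqHH (opAA kappa_a kappa_s E + G E) 0].

Definition warmest_stationary (R : realType) (kappa_a kappa_s : R)
    (G : fun2 R -> fun2 R) (E : fun2 R) : Prop :=
  stationary kappa_a kappa_s G E /\
  forall F : fun2 R, stationary kappa_a kappa_s G F ->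
    forall x : R, x \in @I1bar R -> F.1 x <= E.1 x /\ F.2 x <= E.2 x.

(** Convergence, uniform on [[-1, 1]], as t tends to +oo; [T t] is required to
    be given by its continuous representative on [[-1, 1]] for large [t]. *)
Definition cvg_uniform_bar (R : realType) (T : R -> fun2 R) (E : fun2 R) : Prop :=
  [/\ \forall t \near +oo, continuous2_bar (T t),
      {uniform @I1bar R, (fun t => (T t).1) @ +oo --> E.1}
    & {uniform @I1bar R, (fun t => (T t).2) @ +oo --> E.2}].

(** C^theta(I): Hoelder continuity on the compact subintervals of the open
    interval I (no uniformity up to the end points). *)
Definition hoelder_I (R : realType) (theta : R) (f : R -> R) : Prop :=
  forall a b : R, `[a, b] `<=` @I1 R -> exists C : R,
    forall x y, x \in `[a, b] -> y \in `[a, b] ->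
      `|f x - f y| <= C * `|x - y| `^ theta.

(* Main.v *)
Require Import Defs.
From HB Require Import structures.
From mathcomp Require Import all_boot all_order all_algebra.
From mathcomp Require Import all_classical all_reals all_analysis.
From mathcomp Require Import measurable_realfun ess_sup_inf.
From mathcomp Require Import ring lra ssrAC.
Import Order.TTheory GRing.Theory Num.Theory.
Import numFieldNormedType.Exports.
Local Open Scope classical_set_scope.
Local Open Scope ring_scope.

Set Implicit Arguments.
Unset Strict Implicit.
Unset Printing Implicit Defensive.

(** The limit Tinf is a stationary state because of the Duhamel formula on
    [[t, t + h]]: as t tends to infinity it becomes
    S h Tinf = Tinf - h G Tinf + o(h), which says that Tinf is in the domain of
    the generator and that A Tinf = - G Tinf (limit_stationary).

    That Tinf is the warmest one is a comparison argument in two steps. Let F be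
    a stationary state.

    First, F <= Emax. The operator A is dispersive: integrating A u against a
    nondecreasing function of u gives a non-positive number, because rho u'
    vanishes at the end points (domA_resolvent_posint). Hence it has a maximum
    principle, and since the reaction terms are cooperative and increase with
    the insolation, the pair of the maxima of F.1 and F.2 is a sub-equilibrium
    of the differential equation with the maximal insolation. The supremum of
    all sub-equilibria is an equilibrium, so that they lie below the warmest
    one (sub_equilibrium_le, stationary_le_warmest).

    Second, F <= Tmax t for all t >= 0. Measure the excess of F over Tmax t by
    the integrals of the positive parts of the two components, with weights
    gamma_a and 2 gamma_s. By dispersivity the semigroup does not increase it
    (excess_contraction); the reactions increase it at most at a rate
    proportional to itself, because with these weights the terms in |a|^3 a of
    the two equations cancel when both components are in excess, and those in
    |s|^3 s have a favourable sign as eps_a < 2 (react_one_sided,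
    excess_reaction). The excess vanishes at t = 0 by the first step, hence
    always (excess_vanishes). Letting t tend to infinity gives F <= Tinf.

    The analytic groundwork consists of: the fundamental theorem of calculus for
    absolutely continuous functions (abs_cont_FTC), by which A is integrated by
    parts and V is embedded in a weighted space of continuous functions
    (inV_bound), so that the quartic terms are continuous from V to H; the bound
    of a semigroup near time 0 (semigroup_bounded_near0); and the density of
    D(A) (domA_dense), by which estimates along orbits in D(A) extend to
    F - Tmax t. Differential inequalities for functions of time that are merely
    continuous are integrated by dini_nonincreasing. *)

(** * Absolutely continuous functions *)

Section absolute_continuity.
Context {R : realType}.
Implicit Types (f g : R -> R) (a b : R) (s : seq (R * R)).

(** The families of intervals in the definition of absolute continuity, as
    lists: in this form they can be concatenated and refined by induction. *)
Definition ordered_intervals a b s : bool :=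
  all (fun p => [&& a <= p.1, p.1 <= p.2 & p.2 <= b]) s &&
  pairwise (fun p q => p.2 <= q.1) s.

Definition total_length s : R := \sum_(p <- s) (p.2 - p.1).

Definition total_oscillation f s : R := \sum_(p <- s) `|f p.2 - f p.1|.

Lemma abs_contP a b f : abs_cont a b f <->
  forall e, 0 < e -> exists2 d, 0 < d & forall s, ordered_intervals a b s ->
    total_length s < d -> total_oscillation f s < e.
Proof.
split=> acf e e0; have [d d0 fd] := acf e e0; exists d => //.
  move=> s /andP[/allP sab /(pairwiseP (0, 0)) sp] sd.
  have := fd (size s) (fun i => (nth (0, 0) s i).1) (fun i => (nth (0, 0) s i).2).
  rewrite /total_oscillation (big_nth (0, 0)) big_mkord; apply.
  - by move=> i si; apply/and3P; exact: (sab _ (mem_nth _ si)).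
  - by move=> i j ij js; apply: sp => //; rewrite inE; exact: ltn_trans js.
  - by move: sd; rewrite /total_length (big_nth (0, 0)) big_mkord.
move=> n x y xy yx xyd.
have bigE (F : R * R -> R) : \sum_(p <- [seq (x i, y i) | i <- iota 0 n]) F p =
    \sum_(i < n) F (x i, y i).
  by rewrite big_map -{1}(subn0 n) -/(index_iota 0 n) big_mkord.
have := fd [seq (x i, y i) | i <- iota 0 n].
rewrite /total_oscillation /total_length !bigE /=; apply => //.
apply/andP; split.
  apply/allP => _ /mapP[i + ->]; rewrite mem_iota add0n /= => ni.
  by apply/and3P/xy.
apply/(pairwiseP (0, 0)) => i j; rewrite !inE size_map size_iota => ni nj ij.
rewrite !(nth_map 0%N) ?size_iota// !nth_iota// !add0n/=.
exact: yx.
Qed.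

Lemma abs_contW a b c d f : a <= c -> d <= b -> abs_cont a b f -> abs_cont c d f.
Proof.
move=> ac db acf e e0; have [r r0 fr] := acf e e0; exists r => // n x y xy yx.
by apply: fr => // i /xy[cx xyi yd]; split => //; [exact: le_trans cx|exact: le_trans yd db].
Qed.

Lemma abs_contD a b f g : abs_cont a b f -> abs_cont a b g ->
  abs_cont a b (f \+ g).
Proof.
move=> acf acg e e0; have e20 : 0 < e / 2 by rewrite divr_gt0.
have [r r0 fr] := acf _ e20; have [t t0 gt] := acg _ e20.
exists (Num.min r t); first by rewrite lt_min r0.
move=> n x y xy yx; rewrite lt_min => /andP[lr lt].
rewrite [ltRHS](splitr e); apply: le_lt_trans (ltrD (fr _ _ _ xy yx lr) (gt _ _ _ xy yx lt)).
rewrite -big_split/=; apply: ler_sum => i _.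
by apply: le_trans (ler_normD _ _); rewrite addrACA -opprD.
Qed.

Lemma abs_contN a b f : abs_cont a b f -> abs_cont a b (\- f).
Proof.
move=> acf e e0; have [r r0 fr] := acf _ e0; exists r => // n x y xy yx l.
apply: le_lt_trans (fr _ _ _ xy yx l).
by apply: ler_sum => i _; rewrite /= -opprD normrN.
Qed.

Lemma lipschitz_abs_cont a b f (k : R) :
  (forall x y, a <= x -> x <= y -> y <= b -> `|f y - f x| <= k * (y - x)) ->
  abs_cont a b f.
Proof.
move=> fk e e0; exists (e / (`|k| + 1)); first by rewrite divr_gt0// ltr_wpDl.
move=> n x y xy yx l.
have k1 : 0 < `|k| + 1 by rewrite ltr_wpDl.
apply: (@le_lt_trans _ _ ((`|k| + 1) * \sum_(i < n) (y i - x i))); last first.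
  by rewrite mulrC -ltr_pdivlMr.
rewrite mulr_sumr; apply: ler_sum => i _.
have [ax xyi yb] := xy _ (ltn_ord i).
apply: le_trans (fk _ _ ax xyi yb) _; apply: ler_wpM2r; first by rewrite subr_ge0.
by rewrite (le_trans (ler_norm _))// lerDl.
Qed.

Lemma abs_cont_dist a b f : abs_cont a b f ->
  forall e, 0 < e -> exists2 d, 0 < d & forall x y, a <= x <= b -> a <= y <= b ->
    `|x - y| < d -> `|f x - f y| < e.
Proof.
move=> acf e e0; have [d d0 fd] := acf e e0; exists d => // x y xab yab.
wlog xy : x y xab yab / x <= y.
  move=> H; have [xy|/ltW yx] := leP x y; first exact: H.
  by rewrite distrC (distrC (f x)); exact: H.
move: xab yab => /andP[ax xb] /andP[ay yb].
rewrite distrC ger0_norm ?subr_ge0// => xyd.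
have := fd 1%N (fun=> x) (fun=> y); rewrite !big_ord1 distrC; apply => //.
by case => [|i] [|j].
Qed.

Lemma abs_cont_continuous a b f : abs_cont a b f ->
  forall x, a < x < b -> {for x, continuous f}.
Proof.
move=> acf x /andP[ax xb]; apply/cvgrPdist_lt => /= e e0.
have [d d0 fd] := abs_cont_dist acf e0.
near=> z; apply: fd.
- by rewrite !ltW.
- have : z \in `]a, b[ by near: z; apply: near_in_itvoo; rewrite in_itv/= ax.
  by rewrite in_itv/= => /andP[/ltW-> /ltW->].
- by near: z; exact: cvgr_dist_lt.
Unshelve. all: by end_near. Qed.

Lemma abs_cont_continuous_within a b f : a < b -> abs_cont a b f ->
  {within `[a, b], continuous f}.
Proof.
move=> ab acf; apply/continuous_within_itvP => //; split.
- by move=> x; rewrite in_itv/= => /(abs_cont_continuous acf).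
- apply/cvgrPdist_lt => /= e e0; have [d d0 fd] := abs_cont_dist acf e0.
  near=> z; apply: fd.
  + by rewrite lexx ltW.
  + by apply/andP; split; [exact: ltW|near: z; apply: nbhs_right_le].
  + rewrite distrC ger0_norm ?subr_ge0; last by exact: ltW.
    by rewrite ltrBlDr; near: z; apply: nbhs_right_lt; rewrite ltrDr.
- apply/cvgrPdist_lt => /= e e0; have [d d0 fd] := abs_cont_dist acf e0.
  near=> z; apply: fd.
  + by rewrite lexx ltW.
  + by apply/andP; split; [near: z; apply: nbhs_left_ge|exact: ltW].
  + rewrite ger0_norm ?subr_ge0; last by exact: ltW.
    by rewrite ltrBlDr -ltrBlDl; near: z; apply: nbhs_left_gt; rewrite ltrBlDr ltrDl.
Unshelve. all: by end_near. Qed.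

Lemma abs_cont_bounded a b f : a <= b -> abs_cont a b f ->
  exists2 M, 0 < M & forall x, a <= x <= b -> `|f x| <= M.
Proof.
rewrite le_eqVlt => /predU1P[<- _|ab acf].
  exists (`|f a| + 1); first by rewrite ltr_wpDl.
  by move=> x; rewrite -eq_le => /eqP<-; rewrite lerDl.
have := abs_cont_continuous_within ab acf => cf.
have cnf : {within `[a, b], continuous (fun x => `|f x|)}.
  move=> x; apply: (@continuous_comp (subspace `[a, b]) _ _ f (@Num.norm _ _)); first exact: cf.
  exact: norm_continuous.
have [c _ fc] := EVT_max (ltW ab) cnf.
by exists (`|f c| + 1) => [|x xab]; [rewrite ltr_wpDl|rewrite ler_wpDr ?fc ?in_itv].
Qed.

Lemma abs_contM a b f g : a <= b -> abs_cont a b f -> abs_cont a b g ->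
  abs_cont a b (f \* g).
Proof.
move=> ab acf acg e e0.
have [M M0 fM] := abs_cont_bounded ab acf; have [N N0 gN] := abs_cont_bounded ab acg.
have [r r0 fr] := acf (e / 2 / N) ltac:(by rewrite !divr_gt0).
have [t t0 gt] := acg (e / 2 / M) ltac:(by rewrite !divr_gt0).
exists (Num.min r t); first by rewrite lt_min r0.
move=> n x y xy yx; rewrite lt_min => /andP[lr lt].
have {}fr := fr _ _ _ xy yx lr; have {}gt := gt _ _ _ xy yx lt.
move: fr gt; rewrite (ltr_pdivlMr _ (e / 2) N0) (ltr_pdivlMr _ (e / 2) M0) => fr gt.
rewrite [ltRHS](splitr e); apply: le_lt_trans (ltrD fr gt).
rewrite !mulr_suml -big_split/=; apply: ler_sum => i _.
have [ax xyi yb] := xy _ (ltn_ord i).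
have -> : f (y i) * g (y i) - f (x i) * g (x i) =
    (f (y i) - f (x i)) * g (y i) + (g (y i) - g (x i)) * f (x i) by ring.
apply: le_trans (ler_normD _ _) _; rewrite !normrM; apply: lerD; apply: ler_wpM2l => //.
- by apply: gN; rewrite yb (le_trans ax).
- by apply: fM; rewrite ax (le_trans xyi).
Qed.

End absolute_continuity.

(** * Total variation of absolutely continuous functions *)

Section variation_of_absolutely_continuous.
Context {R : realType}.
Implicit Types (f g : R -> R) (a b : R) (s t u : seq (R * R)) (l : seq R).

(** The consecutive intervals of the subdivision [a :: l]. *)
Definition steps a l : seq (R * R) := zip (a :: l) l.

Lemma variation_steps a b f l :
  variation a b f l = total_oscillation f (steps a l).
Proof.
rewrite /total_oscillation /steps (big_nth (b, b)) size_zip/= (minn_idPr _)//.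
rewrite /variation; apply: eq_big_nat => i /andP[_ il].
by rewrite nth_zip_cond/= size_zip/= (minn_idPr _)// il.
Qed.

Lemma ordered_steps a l : path <%R a l -> ordered_intervals a (last a l) (steps a l).
Proof.
elim: l a => [//|x l IH] a /= /andP[ax xl].
have := IH _ xl; rewrite /ordered_intervals/= => /andP[/allP h ->].
have xll : x <= last x l.
  have /allP h' := order_path_min lt_trans xl.
  by have := mem_last x l; rewrite inE => /predU1P[->//|/h' /ltW].
rewrite lexx (ltW ax) xll/= andbT; apply/andP; split; last first.
  by apply/allP => p /h /and3P[].
by apply/allP => p /h /and3P[? -> ->]; rewrite andbT (le_trans (ltW ax)).
Qed.

Lemma length_steps a l : total_length (steps a l) = last a l - a.
Proof.
rewrite /total_length; elim: l a => [|x l IH] a; first by rewrite /steps big_nil subrr.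
by rewrite /steps/= big_cons -/(steps x l) IH/= addrC subrKA.
Qed.

Lemma ordered_intervals_refine a b s t u p :
  ordered_intervals a b (t ++ p :: s) -> ordered_intervals p.1 p.2 u ->
  ordered_intervals a b ((t ++ u) ++ s).
Proof.
rewrite /ordered_intervals !all_cat/= !pairwise_cat/= allrel_consr.
move=> /andP[/and3P[-> /and3P[ap pp pb] ->] /and4P[/andP[tp ts] -> ps ->]].
move=> /andP[/allP up ->]; rewrite !andbT /= allrel_catl ts/=.
apply/andP; split; first by apply/allP => q /up /and3P[pq -> qp]; rewrite (le_trans ap) ?(le_trans qp).
apply/andP; split.
  by apply/allrelP => q r qu rs; have /and3P[_ _ qp] := up _ qu; apply: le_trans qp _; exact: (allP ps).
by apply/allrelP => q r qt ru; have /and3P[pr _ _] := up _ ru; apply: le_trans pr; exact: (allP tp).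
Qed.

Lemma total_length_cat s t : total_length (s ++ t) = total_length s + total_length t.
Proof. exact: big_cat. Qed.

Lemma total_oscillation_cat f s t :
  total_oscillation f (s ++ t) = total_oscillation f s + total_oscillation f t.
Proof. exact: big_cat. Qed.

(** Subdividing the intervals of a family does not change its total length, so
    the oscillation bound passes to the supremum over all subdivisions, one
    interval after the other; [t] collects the subdivisions that are already
    chosen. *)
Lemma total_variation_family a b f e d :
  (forall s, ordered_intervals a b s -> total_length s < d ->
    total_oscillation f s < e) ->
  forall s t, ordered_intervals a b (t ++ s) -> total_length (t ++ s) < d ->
  ((total_oscillation f t)%:E + \sum_(p <- s) total_variation p.1 p.2 f <= e%:E)%E.
Proof.
move=> fd; elim => [|p s IH] t.
  by rewrite cats0 big_nil adde0 lee_fin => ? ?; apply/ltW/fd.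
move=> ots lts; rewrite big_cons.
have pp : p.1 <= p.2.
  by move: ots; rewrite /ordered_intervals all_cat/= => /andP[/and3P[_ /and3P[]]].
have Y0 : (0 <= (total_oscillation f t)%:E + \sum_(q <- s) total_variation q.1 q.2 f)%E.
  rewrite adde_ge0 ?lee_fin ?sumr_ge0//; rewrite big_seq; apply: sume_ge0 => q qs.
  apply: total_variation_ge0.
  by move: ots; rewrite /ordered_intervals all_cat/= => /andP[/and3P[_ _ /allP/(_ _ qs)/and3P[]]].
have refined u : ordered_intervals p.1 p.2 u -> total_length u <= p.2 - p.1 ->
    ((total_oscillation f t)%:E + (total_oscillation f u)%:E +
     \sum_(q <- s) total_variation q.1 q.2 f <= e%:E)%E.
  move=> ou lu; rewrite -EFinD -total_oscillation_cat; apply: IH.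
    exact: ordered_intervals_refine ots ou.
  apply: le_lt_trans lts; rewrite !total_length_cat -addrA lerD2l.
  by rewrite [leRHS]/total_length big_cons lerD2r.
have Ye : ((total_oscillation f t)%:E + \sum_(q <- s) total_variation q.1 q.2 f <= e%:E)%E.
  have := refined [::] isT; rewrite /total_length big_nil subr_ge0 => /(_ pp).
  by rewrite [total_oscillation f [::]]/total_oscillation big_nil adde0.
have Yfin : ((total_oscillation f t)%:E + \sum_(q <- s) total_variation q.1 q.2 f)%E \is a fin_num.
  by rewrite ge0_fin_numE// (le_lt_trans Ye)// ltry.
rewrite addeCA -leeBrDr//; apply: ub_ereal_sup => _ [_ [l [pl ll] <-] <-].
rewrite leeBrDr// variation_steps addeA (addeC (_ f (steps _ _))%:E).
move/eqP : ll => ll; apply: refined; last by rewrite length_steps ll.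
by rewrite -ll; exact: ordered_steps.
Qed.

(** The [d] that answers e = 1 bounds the variation by 1 on every interval
    shorter than [d], and finitely many of these cover [[a, b]]. *)
Lemma abs_cont_bounded_variation a b f : a <= b -> abs_cont a b f ->
  bounded_variation a b f.
Proof.
move=> ab /abs_contP/(_ 1 ltr01)[d d0 fd].
have d20 : 0 < d / 2 by rewrite divr_gt0.
have short x y : a <= x -> x <= y -> y <= b -> y - x < d ->
    (total_variation x y f < +oo)%E.
  move=> ax xy yb xyd.
  have := total_variation_family fd (s := [:: (x, y)]) (t := [::]).
  rewrite /total_oscillation/= big_nil add0e /total_length !big_seq1/= /ordered_intervals/= ax xy yb.
  by move=> /(_ isT xyd) /le_lt_trans; apply; rewrite ltry.
suff H n x y : a <= x -> x <= y -> y <= b -> y - x <= n%:R * (d / 2) ->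
    (total_variation x y f < +oo)%E.
  apply/bounded_variationP => //; rewrite ge0_fin_numE ?total_variation_ge0//.
  apply: (H (Num.truncn ((b - a) / (d / 2))).+1) => //.
  by rewrite -ler_pdivrMr// ltW// truncnS_gt.
elim: n x y => [|n IH] x y ax xy yb.
  by rewrite mul0r => xy0; apply: short => //; exact: le_lt_trans xy0 d0.
move=> xyn; have [xyd|dxy] := ltP (y - x) d; first exact: short.
have xxd : x <= x + d / 2 by rewrite lerDl ltW.
have xdy : x + d / 2 <= y.
  rewrite -lerBrDl; apply: le_trans dxy.
  by rewrite ler_pdivrMr// ler_peMr ?ler1n// ltW.
rewrite (total_variationD _ xxd xdy) lte_add_pinfty//.
  apply: short => //; first exact: le_trans xdy yb.
  by rewrite addrAC subrr add0r gtr_pMr// invf_lt1// ltr1n.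
apply: IH => //; first exact: le_trans ax xxd.
by rewrite opprD addrA lerBlDr (le_trans xyn)// -natr1 mulrDl mul1r.
Qed.

(** The Jordan decomposition: [V x] is the total variation on [[a, x]], and
    total_variation_family makes it absolutely continuous. *)
Lemma abs_cont_monotone_decomposition a b f : a <= b -> abs_cont a b f ->
  exists V, [/\ abs_cont a b V, abs_cont a b (V \- f),
    forall x y, a <= x -> x <= y -> y <= b -> V x <= V y &
    forall x y, a <= x -> x <= y -> y <= b -> (V \- f) x <= (V \- f) y].
Proof.
move=> ab acf; pose V x := fine (total_variation a x f).
have fin x y : a <= x -> x <= y -> y <= b -> total_variation x y f \is a fin_num.
  move=> ax xy yb; apply/bounded_variationP => //; apply: abs_cont_bounded_variation => //.
  exact: abs_contW acf.
have VB x y : a <= x -> x <= y -> y <= b -> V y - V x = fine (total_variation x y f).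
  move=> ax xy yb; rewrite /V (total_variationD _ ax xy) fineD ?fin ?(le_trans xy)//.
  by rewrite addrAC subrr add0r.
have ndV x y : a <= x -> x <= y -> y <= b -> V x <= V y.
  move=> ax xy yb; rewrite -subr_ge0 VB// fine_ge0//; exact: total_variation_ge0.
have acV : abs_cont a b V.
  apply/abs_contP => e e0; have e20 : 0 < e / 2 by rewrite divr_gt0.
  have [d d0 fd] := (abs_contP a b f).1 acf _ e20.
  exists d => // s os ls; apply: (@le_lt_trans _ _ (e / 2)); last first.
    by rewrite gtr_pMr// invf_lt1// ltr1n.
  have := total_variation_family fd (s := s) (t := [::]) os ls.
  rewrite [total_oscillation f [::]]/total_oscillation big_nil add0e.
  rewrite -lee_fin; apply: le_trans.
  rewrite /total_oscillation (big_morph EFin EFinD (erefl 0%:E)) big_seq [leRHS]big_seq.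
  apply: lee_sum => p ps.
  have /andP[/allP/(_ _ ps)/and3P[ap pp pb] _] := os.
  by rewrite VB// ger0_norm ?fineK ?fin// fine_ge0// total_variation_ge0.
exists V; split => //; first exact: abs_contD acV (abs_contN acf).
move=> x y ax xy yb; rewrite -subr_ge0 /= (_ : _ - _ = V y - V x - (f y - f x)); last by ring.
rewrite VB// subr_ge0.
rewrite -lee_fin fineK ?fin//.
by apply: le_trans (total_variation_ge _ xy); rewrite lee_fin ler_norm.
Qed.

End variation_of_absolutely_continuous.

(** * The fundamental theorem of calculus *)

Section density_of_absolutely_continuous.
Context {R : realType}.
Notation mu := (@lebesgue_measure R).
Implicit Types (f g : R -> R) (a b : R).

(** Disjoint intervals become ordered when sorted by their midpoints. *)
Lemma unordered_oscillation a b f e d :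
  (forall s, ordered_intervals a b s -> total_length s < d ->
    total_oscillation f s < e) ->
  forall n (x y : nat -> R), (forall i, (i < n)%N -> [/\ a <= x i, x i <= y i & y i <= b]) ->
  (forall i j, (i < n)%N -> (j < n)%N -> i != j -> y i <= x j \/ y j <= x i) ->
  \sum_(i < n) (y i - x i) < d -> \sum_(i < n) `|f (y i) - f (x i)| < e.
Proof.
move=> fd n x y xy disj xyd.
pose key i := x i + y i.
pose s := sort (fun i j => key i <= key j) (iota 0 n).
have ps : perm_eq s (index_iota 0 n) by rewrite /index_iota subn0 perm_sort.
have bigE (F : R * R -> R) :
    \sum_(p <- [seq (x i, y i) | i <- s]) F p = \sum_(i < n) F (x i, y i).
  by rewrite big_map (perm_big _ ps) big_mkord.
have sn i : i \in s -> (i < n)%N by rewrite (perm_mem ps) mem_index_iota.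
have := fd [seq (x i, y i) | i <- s].
rewrite /total_oscillation /total_length !bigE /=; apply => //.
apply/andP; split; first by apply/allP => _ /mapP[i /sn ni ->]; apply/and3P/xy.
rewrite pairwise_map.
have us : uniq s by rewrite sort_uniq iota_uniq.
have : sorted (fun i j => key i <= key j) s by apply: sort_sorted => i j; exact: le_total.
rewrite sorted_pairwise; last by move=> i j k; exact: le_trans.
move=> /(pairwiseP 0%N) ks; apply/(pairwiseP 0%N) => i j si sj ij /=.
move: (si) (sj); rewrite !inE => si' sj'.
have ni := sn _ (mem_nth 0%N si'); have nj := sn _ (mem_nth 0%N sj').
have := ks _ _ si sj ij; rewrite /key.
have [//|yx] : y (nth 0%N s i) <= x (nth 0%N s j) \/ y (nth 0%N s j) <= x (nth 0%N s i).
  by apply: disj => //; rewrite nth_uniq// ltn_eqF.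
have [_ + _] := xy _ ni; have [_ + _] := xy _ nj; lra.
Qed.

(** The density is a Radon-Nikodym derivative of the Lebesgue-Stieltjes
    measure of [f]. A Lebesgue-null set lies in an open set of small measure,
    a disjoint union of open intervals; there absolute continuity makes the
    total increase of [f] small, so that the Stieltjes measure is dominated by
    the Lebesgue measure. *)
Lemma nondecreasing_abs_cont_density a b f : a < b ->
  (forall x y, a <= x -> x <= y -> y <= b -> f x <= f y) -> abs_cont a b f ->
  exists2 g, mu.-integrable [set: R] (EFin \o g) &
  forall x y, a <= x -> x <= y -> y <= b -> f y - f x = \int[mu]_(t in `[x, y]) g t.
Proof.
move=> ab ndf acf.
(* [f] is made constant outside of [[a, b]]. *)
pose clamp x := Num.max a (Num.min x b).
have clampP x : a <= clamp x <= b.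
  by rewrite le_max lexx ge_max (ltW ab)/= ge_min lexx orbT.
have clamp_id x : a <= x -> x <= b -> clamp x = x.
  by move=> ax xb; rewrite /clamp min_l// max_r.
have clamp_nd x y : x <= y -> clamp x <= clamp y.
  by move=> xy; rewrite /clamp ge_max !le_max lexx/= le_min !ge_min xy lexx !orbT.
have clamp_lip x y : x <= y -> clamp y - clamp x <= y - x.
  rewrite /clamp !minEle !maxEle => xy.
  by do !case: ifPn => // /negP; lra.
pose G := f \o clamp.
have ndG : nondecreasing G.
  move=> x y xy; have /andP[? ?] := clampP x; have /andP[? ?] := clampP y.
  by apply: ndf => //; exact: clamp_nd.
have rcG : right_continuous G.
  apply: right_continuousW => x; apply/cvgrPdist_lt => /= e e0.
  have [d d0 fd] := abs_cont_dist acf e0; near=> z; apply: fd; [exact: clampP..|].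
  have xz : `|x - z| < d by near: z; exact: cvgr_dist_lt.
  apply: le_lt_trans xz; have [xz|/ltW zx] := leP x z.
    rewrite distrC ger0_norm ?subr_ge0 ?clamp_nd//.
    by rewrite distrC ger0_norm ?subr_ge0 ?clamp_lip.
  by rewrite !ger0_norm ?subr_ge0 ?clamp_nd// clamp_lip.
pose Gc : cumulative R R := HB.pack_for (cumulative R R) G (isCumulative.Build _ _ _ G ndG rcG).
pose nu0 := lebesgue_stieltjes_measure Gc.
have nu0E x y : x <= y -> nu0 `]x, y]%classic = (G y - G x)%:E.
  move=> xy; rewrite /nu0 /lebesgue_stieltjes_measure /measure_extension.
  by rewrite measurable_mu_extE/= ?wlength_itv_bnd//; exact: is_ocitv.
have mab : measurable (`]a, b]%classic : set (measurableTypeR R)) by exact: measurable_itv.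
have nu0ab : (nu0 `]a, b]%classic < +oo)%E by rewrite nu0E ?ltry// ltW.
pose nu := mfrestr mab nu0ab.
have numu : null_dominates mu nu.
  apply/null_content_dominatesP => A mA A0.
  apply/eqP; rewrite eq_le measure_ge0 andbT; apply/lee_addgt0Pr => e e0; rewrite add0e.
  have [d d0 fd] := (abs_contP a b f).1 acf e e0.
  have [U [oU AU UAd]] : exists U : set R, [/\ open U, A `<=` U & (mu (U `\` A) < d%:E)%E].
    by apply: lebesgue_regularity_outer => //; rewrite A0 ltry.
  (* Bounded, so that the components of [W] have end points. *)
  pose W := U `&` `]a - 1, b + 1[%classic.
  have oW : open W by apply: openI => //; exact: itv_open.
  have mW : measurable (W : set (measurableTypeR R)) by exact: open_measurable.
  have muWd : (mu W < d%:E)%E.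
    have mU : measurable (U : set (measurableTypeR R)) by exact: open_measurable.
    apply: le_lt_trans UAd; apply: (@le_trans _ _ (mu (A `|` (U `\` A)))).
      apply: le_measure; rewrite ?inE//=.
        by apply: measurableU => //; exact: measurableD.
      by rewrite setDUK// => x [].
    rewrite -[leRHS]add0e -A0; apply: measureU2 => //; exact: measurableD.
  have [B [oB tB WB]] := OpenSetDisjointItvs.open_disjoint_itv oW.
  have mB i : measurable (B i : set (measurableTypeR R)).
    by apply: open_measurable; have [] := oB i.
  have BW i : B i `<=` W by rewrite WB => x Bx; exists i.
  have lbB i : has_lbound (B i).
    by exists (a - 1) => x /BW [_]; rewrite /= in_itv/= => /andP[/ltW].
  have ubB i : has_ubound (B i).
    by exists (b + 1) => x /BW [_]; rewrite /= in_itv/= => /andP[_ /ltW].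
  have BE i : B i = [set r | inf (B i) < r < sup (B i)].
    have [/interior_id oBi iBi] := oB i.
    by rewrite -[LHS]oBi; exact: interval_bounded_interior.
  (* An empty component is counted as the degenerate interval at [a]. *)
  pose x i := if pselect (B i = set0) is left _ then a else clamp (inf (B i)).
  pose y i := if pselect (B i = set0) is left _ then a else clamp (sup (B i)).
  have ne i : B i <> set0 -> inf (B i) < sup (B i).
    move=> /eqP/set0P[z Bz]; have /andP[] : [set r | inf (B i) < r < sup (B i)] z by rewrite -BE.
    exact: lt_trans.
  have xyab i : [/\ a <= x i, x i <= y i & y i <= b].
    rewrite /x /y; case: pselect => /= [_|/ne Bi]; first by rewrite lexx ltW.
    have /andP[? _] := clampP (inf (B i)); have /andP[_ ?] := clampP (sup (B i)).
    by split => //; apply/clamp_nd/ltW.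
  have disj i j : i != j -> y i <= x j \/ y j <= x i.
    move=> ij; have [axj _ _] := xyab j; have [axi _ _] := xyab i.
    have [Bi0|Bi0] := pselect (B i = set0).
      by left; rewrite /y; case: pselect.
    have [Bj0|Bj0] := pselect (B j = set0).
      by right; rewrite /y; case: pselect.
    have -> : x i = clamp (inf (B i)) by rewrite /x; case: pselect.
    have -> : x j = clamp (inf (B j)) by rewrite /x; case: pselect.
    have -> : y i = clamp (sup (B i)) by rewrite /y; case: pselect.
    have -> : y j = clamp (sup (B j)) by rewrite /y; case: pselect.
    have [ij'|ij'] := leP (sup (B i)) (inf (B j)); first by left; exact: clamp_nd.
    have [ji'|ji'] := leP (sup (B j)) (inf (B i)); first by right; exact: clamp_nd.
    exfalso; have /ne Bi := Bi0; have /ne Bj := Bj0.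
    pose m := (Num.max (inf (B i)) (inf (B j)) + Num.min (sup (B i)) (sup (B j))) / 2.
    have lm : Num.max (inf (B i)) (inf (B j)) < Num.min (sup (B i)) (sup (B j)).
      by rewrite gt_max !lt_min Bi ji' ij' Bj.
    have [lm1 lm2] : Num.max (inf (B i)) (inf (B j)) < m /\ m < Num.min (sup (B i)) (sup (B j)).
      by rewrite /m; split; move: lm; lra.
    move: lm1 lm2; rewrite gt_max lt_min => /andP[mi1 mj1] /andP[mi2 mj2].
    have : (B i `&` B j) m by split; rewrite BE /= ?mi1 ?mj1.
    by move/trivIsetP : tB => /(_ i j Logic.I Logic.I ij) ->.
  have mul i : ((y i - x i)%:E <= mu (B i))%E.
    rewrite /y /x; case: pselect => /= [_|/ne Bi]; first by rewrite subrr.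
    move: Bi (BE i); set l := inf (B i); set r := sup (B i) => lr ->.
    have -> : [set z | l < z < r] = `]l, r[%classic by apply/seteqP; split.
    by rewrite lebesgue_measure_itv/= lte_fin lr -EFinB lee_fin clamp_lip// ltW.
  have nul i : (nu0 (B i) <= (`|f (y i) - f (x i)|)%:E)%E.
    rewrite /y /x; case: pselect => /= [->|/ne Bi]; first by rewrite /nu0 measure0 lee_fin.
    apply: (@le_trans _ _ (nu0 `]inf (B i), sup (B i)]%classic)).
      apply: le_measure; [by rewrite inE; exact: mB|by rewrite inE; exact: measurable_itv|].
      move=> z Bz; have /andP[lz zr] : [set r | inf (B i) < r < sup (B i)] z by rewrite -BE.
      by rewrite /= in_itv/= lz ltW.
    by rewrite nu0E ?lee_fin ?ler_norm// ltW.
  apply: (@le_trans _ _ (nu0 W)).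
    rewrite /nu /mfrestr /mrestr; apply: le_measure; rewrite ?inE//.
      exact: measurableI.
    move=> z [/AU Uz]; rewrite /= in_itv/= => /andP[az zb]; split => //=.
    rewrite in_itv/=; apply/andP; split; lra.
  rewrite WB /nu0 measure_bigcup//.
  apply: lime_le; first by apply: is_cvg_nneseries => ? _ _; exact: measure_ge0.
  apply: nearW => n.
  under eq_bigl do rewrite mem_setT.
  apply: (@le_trans _ _ (\sum_(i < n) `|f (y i) - f (x i)|)%:E).
    by rewrite big_mkord -sumEFin; apply: lee_sum => i _; exact: nul.
  rewrite lee_fin; apply/ltW; apply: (unordered_oscillation fd) => [i _|i j _ _|//]; first exact: xyab.
    exact: disj.
  rewrite -lte_fin; apply: le_lt_trans muWd.
  rewrite WB measure_bigcup//.
  apply: (@le_trans _ _ (\sum_(0 <= i < n | i \in [set: nat]) mu (B i))%E); last first.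
    by apply: nneseries_lim_ge => ? _ _; exact: measure_ge0.
  under [leRHS]eq_bigl do rewrite mem_setT.
  by rewrite big_mkord -sumEFin; apply: lee_sum => i _; exact: mul.
pose h := Radon_Nikodym_SigmaFinite.f nu mu.
have gh : EFin \o (fine \o h) = h.
  by apply/funext => x /=; rewrite fineK//; exact: Radon_Nikodym_SigmaFinite.f_fin_num.
have ih : mu.-integrable [set: R] h by exact: Radon_Nikodym_SigmaFinite.f_integrable.
exists (fine \o h); first by rewrite gh.
move=> x y ax xy yb.
have nuxy : nu `]x, y]%classic = (f y - f x)%:E.
  rewrite /nu /mfrestr /mrestr setIidl.
    by rewrite nu0E// /G/= !clamp_id// ?(le_trans ax)// (le_trans xy).
  move=> z /=; rewrite !in_itv/= => /andP[xz zy].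
  by rewrite (le_lt_trans ax)//= (le_trans zy).
rewrite -Rintegral_itv_obnd_cbnd; last first.
  by rewrite gh; apply: integrableS ih => //; exact: measurable_itv.
have -> : \int[mu]_(t in `]x, y]) (fine \o h) t = fine (\int[mu]_(t in `]x, y]) h t)%E.
  by rewrite /Rintegral -[in RHS]gh.
have <- : nu `]x, y]%classic = (\int[mu]_(t in `]x, y]) h t)%E.
  by apply: Radon_Nikodym_SigmaFinite.f_integral => //; exact: measurable_itv.
by rewrite nuxy.
Unshelve. all: by end_near. Qed.

(** The density of [f] is the difference of the densities of its two monotone
    parts, and [f] is derivable at the Lebesgue points of this density. *)
Lemma abs_cont_FTC a b f : a < b -> abs_cont a b f ->
  exists g, [/\ mu.-integrable [set: R] (EFin \o g),
    forall x y, a <= x -> x <= y -> y <= b -> f y - f x = \int[mu]_(t in `[x, y]) g t &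
    {ae mu, forall x, a < x < b -> derivable f x 1 /\ f^`()%classic x = g x}].
Proof.
move=> ab acf.
have [V [acV acVf ndV ndVf]] := abs_cont_monotone_decomposition (ltW ab) acf.
have [g1 ig1 Vg] := nondecreasing_abs_cont_density ab ndV acV.
have [g2 ig2 Vfg] := nondecreasing_abs_cont_density ab ndVf acVf.
have iS g x y : mu.-integrable [set: R] (EFin \o g) ->
    mu.-integrable `[x, y]%classic (EFin \o g).
  by move=> ig; apply: integrableS ig => //; exact: measurable_itv.
have ig : mu.-integrable [set: R] (EFin \o (g1 \- g2)).
  exact: eq_integrable (integrableB measurableT ig1 ig2).
have fg x y : a <= x -> x <= y -> y <= b -> f y - f x = \int[mu]_(t in `[x, y]) (g1 \- g2) t.
  move=> ax xy yb; rewrite RintegralB//; [|exact: iS|exact: iS].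
  by rewrite -Vg// -Vfg//=; ring.
exists (g1 \- g2); split => //.
have locg : locally_integrable [set: R] (g1 \- g2).
  have := integrable_locally measurableT ig; congr locally_integrable.
  by apply/funext => x; rewrite patchE in_setT.
have := @FTC1 R (g1 \- g2) (BLeft a) (fun y => iS _ _ _ ig) locg.
apply: filterS; first exact: (ae_filter_ringOfSetsType mu).
move=> x + /andP[ax xb].
move=> /(_ ltac:(by rewrite lte_fin)); set F := fun x : R => _ => -[dF F'].
have nearF : \forall z \near x, f z = F z + f a.
  near=> z.
  have : z \in `]a, b[ by near: z; apply: near_in_itvoo; rewrite in_itv/= ax.
  rewrite in_itv/= => /andP[az zb].
  by rewrite /F -fg ?subrK// ltW.
have dfa : derivable (cst (f a) : R -> R) x 1 by exact: derivable_cst.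
have dFa := derivableD dF dfa.
have nearF' : \forall z \near x, F z + f a = f z by near do apply/esym.
split; first exact: (near_eq_derivable nearF' dFa).
rewrite -F' !derive1E (near_eq_derive _ nearF).
have -> : 'D_1 (fun z => F z + f a) x = 'D_1 F x + 'D_1 (cst (f a)) x := deriveD dF dfa.
by rewrite derive_cst addr0.
Unshelve. all: by end_near. Qed.

End density_of_absolutely_continuous.

(** * Square-integrable functions on I *)

Section square_integrable_functions.
Context {R : realType}.
Notation mu := (@lebesgue_measure R).
Notation I := (@I1 R).
Notation L2 := (Lp 2%:E I).
Implicit Types (f g u v : R -> R) (c : R).
Import HBNNSimple.

Lemma measurable_I1 : measurable (I : set (measurableTypeR R)).
Proof. exact: measurable_itv. Qed.
Hint Resolve measurable_I1 : core.

Lemma lebesgue_I1 : mu I = 2%:E.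
Proof.
rewrite /I1 lebesgue_measure_itv/= lte_fin.
have -> : -1 < 1 :> R by lra.
by rewrite -EFinD opprK.
Qed.

Lemma lebesgue_I1_lty : (mu I < +oo)%E.
Proof. by rewrite lebesgue_I1 ltry. Qed.

#[export] Instance ae_lebesgue_filter : Filter (almost_everywhere mu).
Proof. exact: (ae_filter_ringOfSetsType mu). Qed.

Lemma normHE f : normH f = Num.sqrt (\int[mu]_(x in I) f x ^+ 2).
Proof.
rewrite /normH unlock fine_poweR powR12_sqrt; last first.
  by apply/fine_ge0/integral_ge0 => x _; exact: poweR_ge0.
congr (Num.sqrt (fine _)); rewrite [RHS]integral_mkcond; apply: eq_integral => x _ /=.
rewrite powR_mulrn// real_normK ?num_real// !patchE; case: ifPn => // _.
by rewrite expr0n.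
Qed.

Lemma normH_ge0 f : 0 <= normH f.
Proof. by rewrite normHE sqrtr_ge0. Qed.

Lemma int_sqr_ge0 f : 0 <= \int[mu]_(x in I) f x ^+ 2.
Proof. by apply: Rintegral_ge0 => x _; exact: sqr_ge0. Qed.

Lemma normH_sqr f : normH f ^+ 2 = \int[mu]_(x in I) f x ^+ 2.
Proof. by rewrite normHE sqr_sqrtr// int_sqr_ge0. Qed.

Lemma L2P f : L2 f <-> measurable_fun I f /\
  mu.-integrable I (EFin \o (fun x => f x ^+ 2)).
Proof.
have sq_patch : EFin \o (fun x => (f \_ I) x ^+ 2) = (EFin \o (fun x => f x ^+ 2)) \_ I.
  by apply/funext => x /=; rewrite !patchE; case: ifPn => // _; rewrite expr0n.
split=> [L2f|[mf if2]].
  split.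
    apply/(measurable_restrictT _ measurable_I1).
    by have /andP[] := L2f; rewrite inE.
  apply/(integrable_mkcond _ measurable_I1); rewrite -sq_patch.
  exact: Lfun2_integrable_sqr.
rewrite /Lp /Lfun inE; apply/andP; split; first by rewrite inE; apply/(measurable_restrictT _ measurable_I1).
rewrite inE /= /finite_norm unlock; apply: poweR_lty.
move: if2 => /(integrable_mkcond _ measurable_I1).1; rewrite -sq_patch => /integrableP[_].
apply: le_lt_trans; rewrite le_eqVlt; apply/orP; left; apply/eqP.
apply: eq_integral => x _ /=.
by rewrite powR_mulrn// real_normK ?num_real// ger0_norm ?sqr_ge0.
Qed.

Lemma L2_measurable f : L2 f -> measurable_fun I f.
Proof. by case/L2P. Qed.

Lemma L2_integrable_sqr f : L2 f -> mu.-integrable I (EFin \o (fun x => f x ^+ 2)).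
Proof. by case/L2P. Qed.

Lemma L2D f g : L2 f -> L2 g -> L2 (f + g).
Proof.
rewrite /Lp => L2f L2g.
have -> : (f + g) \_ I = f \_ I + g \_ I.
  by apply/funext => x; rewrite !fctE !patchE; case: ifPn => // _; rewrite addr0.
by apply: (Lfun_addr_closed mu (lee1n 2)).2.
Qed.

Lemma L2Z c f : L2 f -> L2 (c *: f).
Proof.
move=> /L2P[mf if2]; apply/L2P; split; first exact: measurable_funM.
have := integrableZl measurable_I1 (c ^+ 2) if2; apply: eq_integrable => // x _ /=.
by rewrite -EFinM exprMn.
Qed.

Lemma L2N f : L2 f -> L2 (- f).
Proof. by rewrite -scaleN1r; exact: L2Z. Qed.

Lemma L2B f g : L2 f -> L2 g -> L2 (f - g).
Proof. by move=> L2f L2g; apply: L2D => //; exact: L2N. Qed.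

Lemma integrable_cst_I1 c : mu.-integrable I (EFin \o cst c).
Proof.
apply: measurable_bounded_integrable => //; first exact: lebesgue_I1_lty.
by exists `|c|; split; [exact: num_real|move=> M cM x _; exact: ltW].
Qed.

Lemma bounded_L2 c f : measurable_fun I f -> (forall x, I x -> `|f x| <= c) -> L2 f.
Proof.
move=> mf fc; apply/L2P; split => //.
apply: (le_integrable measurable_I1 _ _ (integrable_cst_I1 (c ^+ 2))).
  by apply/measurable_EFinP/measurable_funX.
move=> x Ix /=; rewrite lee_fin !ger0_norm ?sqr_ge0//.
by rewrite -[f x ^+ 2]real_normK ?num_real// lerXn2r ?nnegrE// ?fc// (le_trans _ (fc _ Ix)).
Qed.

Lemma L2_cst c : L2 (cst c).
Proof. exact: (@bounded_L2 `|c|). Qed.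

Lemma L2_mul_integrable f g : L2 f -> L2 g -> mu.-integrable I (EFin \o (f \* g)).
Proof.
move=> /[dup] L2f /L2P[mf if2] /[dup] L2g /L2P[mg ig2].
apply: (le_integrable measurable_I1 _ _ (integrableD measurable_I1 if2 ig2)).
  by apply/measurable_EFinP/measurable_funM.
move=> x _ /=; rewrite lee_fin [leRHS]ger0_norm ?addr_ge0 ?sqr_ge0//.
rewrite normrM -[f x ^+ 2]real_normK ?num_real// -[g x ^+ 2]real_normK ?num_real//.
by have := sqr_ge0 (`|f x| - `|g x|); have := sqr_ge0 (`|f x| + `|g x|); nra.
Qed.

Lemma L2_integrable f : L2 f -> mu.-integrable I (EFin \o f).
Proof.
move=> L2f; have := L2_mul_integrable L2f (L2_cst 1); apply: eq_integrable => // x _ /=.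
by rewrite mulr1.
Qed.

(** The square of the norm of [s *: f - t *: g] is a non-negative quadratic
    form in [s] and [t]. *)
Lemma cauchy_schwarz f g : L2 f -> L2 g ->
  \int[mu]_(x in I) (f x * g x) <= normH f * normH g.
Proof.
move=> L2f L2g; set B := \int[mu]_(x in I) _.
have quad t s : 0 <= s ^+ 2 * normH f ^+ 2 + t ^+ 2 * normH g ^+ 2 - (s * t * B) *+ 2.
  have L2c : L2 (s *: f - t *: g) by apply: L2B; exact: L2Z.
  rewrite !normH_sqr.
  have -> : s ^+ 2 * \int[mu]_(x in I) f x ^+ 2 + t ^+ 2 * \int[mu]_(x in I) g x ^+ 2 - s * t * B *+ 2 =
      \int[mu]_(x in I) ((s *: f - t *: g) x) ^+ 2.
    have i1 : mu.-integrable I (EFin \o (fun x => s ^+ 2 * f x ^+ 2)).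
      by have := L2_integrable_sqr (L2Z s L2f); apply: eq_integrable => // x _ /=; rewrite exprMn.
    have i2 : mu.-integrable I (EFin \o (fun x => t ^+ 2 * g x ^+ 2)).
      by have := L2_integrable_sqr (L2Z t L2g); apply: eq_integrable => // x _ /=; rewrite exprMn.
    have i3 : mu.-integrable I (EFin \o (fun x => (s * t *+ 2) * (f x * g x))).
      have := L2_mul_integrable (L2Z (s * t *+ 2) L2f) L2g; apply: eq_integrable => // x _ /=.
      by rewrite mulrA.
    rewrite -mulrnAl /B -!RintegralZl//;
      [|exact: L2_mul_integrable|exact: L2_integrable_sqr..].
    rewrite -RintegralD//.
    rewrite -RintegralB//; last first.
      by have := integrableD measurable_I1 i1 i2; apply: eq_integrable.
    apply: eq_Rintegral => x _.
    by rewrite (_ : (_ - _) x = s * f x - t * g x)//; ring.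
  exact: int_sqr_ge0.
have f0 := normH_ge0 f; have g0 := normH_ge0 g.
have [f00|fn0] := eqVneq (normH f) 0; last first.
  have [g00|gn0] := eqVneq (normH g) 0; last first.
    have := quad (normH f) (normH g).
    have fp : 0 < normH f by rewrite lt_neqAle eq_sym fn0.
    have gp : 0 < normH g by rewrite lt_neqAle eq_sym gn0.
    have fg : 0 < normH f * normH g by rewrite mulr_gt0.
    move=> q; rewrite -(ler_pM2l fg); move: q; rewrite !expr2; lra.
  rewrite g00 mulr0 leNgt; apply/negP => B0.
  have := quad (normH f ^+ 2 / B) 1; rewrite g00.
  have fp : 0 < normH f ^+ 2 by rewrite exprn_gt0// lt_neqAle eq_sym fn0.
  rewrite expr0n mulr0 addr0 mul1r expr1n mul1r divfK ?gt_eqF//; lra.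
rewrite f00 mul0r leNgt; apply/negP => B0.
have := quad 1 ((normH g ^+ 2 + 1)/ B / 2); rewrite f00 expr0n mulr0 add0r expr1n mul1r mulr1.
rewrite -mulrA [2^-1 * B]mulrC mulrA divfK ?gt_eqF// -mulr_natr divfK ?pnatr_eq0//.
lra.
Qed.

Lemma normHD f g : L2 f -> L2 g -> normH (f + g) <= normH f + normH g.
Proof.
move=> L2f L2g.
have fg0 : 0 <= normH f + normH g by rewrite addr_ge0 ?normH_ge0.
rewrite -(ler_pXn2r (n := 2))// ?nnegrE ?normH_ge0//.
have -> : normH (f + g) ^+ 2 = normH f ^+ 2 + normH g ^+ 2 + 2 * \int[mu]_(x in I) (f x * g x).
  rewrite !normH_sqr -RintegralZl//; last exact: L2_mul_integrable.
  have i1 : mu.-integrable I (EFin \o (fun x => f x ^+ 2 + g x ^+ 2)).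
    by have := integrableD measurable_I1 (L2_integrable_sqr L2f) (L2_integrable_sqr L2g); apply: eq_integrable.
  have i2 : mu.-integrable I (EFin \o (fun x => 2 * (f x * g x))).
    have := L2_mul_integrable (L2Z 2 L2f) L2g; apply: eq_integrable => // x _ /=.
    by rewrite (_ : (2 *: f) x = 2 * f x)// mulrA.
  rewrite -RintegralD//; [|exact: L2_integrable_sqr..].
  rewrite -RintegralD//; apply: eq_Rintegral => x _.
  by rewrite (_ : (f + g) x = f x + g x)//; ring.
by have := cauchy_schwarz L2f L2g; rewrite !expr2; lra.
Qed.

Lemma normHZ c f : L2 f -> normH (c *: f) = `|c| * normH f.
Proof.
move=> L2f; rewrite !normHE -sqrtr_sqr -sqrtrM ?sqr_ge0//; congr Num.sqrt.
rewrite -RintegralZl//; last exact: L2_integrable_sqr.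
by apply: eq_Rintegral => x _; rewrite -exprMn.
Qed.

Lemma ae_le_normH f g : L2 f -> L2 g ->
  {ae mu, forall x, I x -> `|f x| <= `|g x|} -> normH f <= normH g.
Proof.
move=> L2f L2g fg; rewrite !normHE ler_wsqrtr//; apply: fine_le.
- exact/integrable_fin_num/L2_integrable_sqr.
- exact/integrable_fin_num/L2_integrable_sqr.
apply: ae_ge0_le_integral => //.
- by move=> x _; rewrite lee_fin sqr_ge0.
- by apply/measurable_EFinP/measurable_funX; exact: L2_measurable.
- by move=> x _; rewrite lee_fin sqr_ge0.
- by apply/measurable_EFinP/measurable_funX; exact: L2_measurable.
apply: filterS fg.
move=> x /[apply] fg; rewrite lee_fin -[leLHS]real_normK ?num_real// -[leRHS]real_normK ?num_real//.
by rewrite lerXn2r ?nnegrE.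
Qed.

(** A simple function below one of the two functions is below the other one
    once it is set to 0 on a null set. *)
Lemma ae_eq_le_integral (D : set R) (f g : R -> \bar R) :
  (forall x, D x -> 0 <= f x)%E -> (forall x, D x -> 0 <= g x)%E ->
  {ae mu, forall x, D x -> f x = g x} ->
  (\int[mu]_(x in D) f x <= \int[mu]_(x in D) g x)%E.
Proof.
move=> f0 g0 [N [mN N0 fgN]].
rewrite (ge0_integralE mu f0) (ge0_integralE mu g0).
apply/ereal_supP => _ [h /= hf <-].
have mC : measurable (~` N) by exact: measurableC.
apply: (@le_trans _ _ (sintegral mu (proj_nnsfun h mC))); last first.
  apply: ereal_sup_ubound; exists (proj_nnsfun h mC) => //= x.
  rewrite /mindic indicE in_setC; case: (boolP (x \in N)) => [_|xN]; rewrite /= ?mulr1 ?mulr0; last first.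
    apply: (le_trans (hf x)); rewrite !patchE; case: ifPn => // /set_mem Dx.
    rewrite (_ : f x = g x)//; apply: contrapT => fgx; move/negP: xN; apply.
    by apply/mem_set/fgN => /(_ Dx).
  by rewrite patchE; case: ifPn => // /set_mem /g0.
rewrite -!integralT_nnsfun (ae_eq_integral (EFin \o proj_nnsfun h mC))//.
- by apply/measurable_EFinP.
- by apply/measurable_EFinP.
exists N; split => // x /= fgx; apply: contrapT => xN; apply: fgx => _ /=.
by rewrite /mindic indicE in_setC memNset// mulr1.
Qed.

(** Applied to derivatives that exist only almost everywhere, whose
    measurability is not at hand. *)
Lemma ae_eq_normH f g : ae_eq mu I f g -> normH f = normH g.
Proof.
move=> fg; rewrite !normHE; congr (Num.sqrt (fine _)); apply/eqP; rewrite eq_le.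
apply/andP; split; apply: ae_eq_le_integral;
  try (by move=> x _; rewrite lee_fin sqr_ge0).
- by apply: filterS fg => x h /h ->.
- by apply: filterS fg => x h /h ->.
Qed.

Lemma normH_cst c : normH (cst c : R -> R) <= 2 * `|c|.
Proof.
rewrite normHE (_ : \int[mu]_(x in I) _ = c ^+ 2 * 2); last first.
  transitivity (c ^+ 2 * fine (mu I)); last by rewrite lebesgue_I1.
  exact: (Rintegral_cst _ measurable_I1 (c ^+ 2)).
rewrite -[leRHS]ger0_norm ?mulr_ge0// -sqrtr_sqr ler_wsqrtr//.
by rewrite exprMn real_normK ?num_real//; have := sqr_ge0 c; lra.
Qed.

Lemma ae_bounded_normH c f : L2 f ->
  {ae mu, forall x, I x -> `|f x| <= c} -> normH f <= 2 * `|c|.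
Proof.
move=> L2f fc; apply: le_trans (normH_cst c); apply: ae_le_normH => //.
  exact: L2_cst.
apply: filterS fc.
by move=> x /[apply] /le_trans; apply; exact: ler_norm.
Qed.

Lemma normH_eq0 f : L2 f -> normH f = 0 -> ae_eq mu I f (cst 0).
Proof.
move=> L2f f0.
have i0 : (\int[mu]_(x in I) `|(f x ^+ 2)%:E| = 0)%E.
  rewrite -(@fineK _ (\int[mu]_(x in I) `|(f x ^+ 2)%:E|)%E); last first.
    apply: integrable_fin_num => //.
    by have := L2_integrable_sqr L2f => /integrable_abse.
  have := normH_sqr f; rewrite f0 expr0n/= => f20.
  congr EFin; rewrite [RHS]f20; congr fine.
  by apply: eq_integral => x _; rewrite /= ger0_norm// sqr_ge0.
have mf2 : measurable_fun I (EFin \o (fun x => f x ^+ 2)).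
  by apply/measurable_EFinP/measurable_funX; exact: L2_measurable.
have /(ae_eq_integral_abs mu measurable_I1 mf2) := i0.
apply: filterS.
by move=> x h /h[] /= fx0; apply/eqP; rewrite -sqrf_eq0 fx0.
Qed.

Definition posint u : R := \int[mu]_(x in I) Num.max (u x) 0.

Lemma L2_pos u : L2 u -> L2 (fun x => Num.max (u x) 0).
Proof.
move=> L2u; apply/L2P; split.
  by apply: measurable_maxr => //; exact: L2_measurable.
apply: (le_integrable measurable_I1 _ _ (L2_integrable_sqr L2u)).
  by apply/measurable_EFinP/measurable_funX/measurable_maxr => //; exact: L2_measurable.
move=> x _ /=; rewrite lee_fin !ger0_norm ?sqr_ge0//.
by have [] := leP (u x) 0 => // _; rewrite expr0n/= sqr_ge0.
Qed.

Lemma posint_ge0 u : 0 <= posint u.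
Proof. by apply: Rintegral_ge0 => x _; rewrite le_max lexx orbT. Qed.

Lemma ae_le_posint u v : L2 u -> L2 v ->
  {ae mu, forall x, I x -> Num.max (u x) 0 <= Num.max (v x) 0} -> posint u <= posint v.
Proof.
move=> /L2_pos L2u /L2_pos L2v uv; rewrite /posint; apply: fine_le.
- exact/integrable_fin_num/L2_integrable.
- exact/integrable_fin_num/L2_integrable.
apply: ae_ge0_le_integral => //.
- by move=> x _; rewrite lee_fin le_max lexx orbT.
- by apply/measurable_EFinP; exact: L2_measurable.
- by move=> x _; rewrite lee_fin le_max lexx orbT.
- by apply/measurable_EFinP; exact: L2_measurable.
Qed.

Lemma posint_norm u : L2 u -> posint u <= 2 * normH u.
Proof.
move=> L2u; have L2p := L2_pos L2u.
have -> : posint u = \int[mu]_(x in I) (Num.max (u x) 0 * cst 1 x).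
  by apply: eq_Rintegral => x _; rewrite mulr1.
apply: le_trans (cauchy_schwarz L2p (L2_cst 1)) _; rewrite mulrC.
apply: ler_pM; rewrite ?normH_ge0//.
  by have := normH_cst 1; rewrite normr1 mulr1.
apply: ae_le_normH => //; apply/aeW => x _.
by have [u0|//] := leP (u x) 0; rewrite normr0.
Qed.

Lemma posintD u v : L2 u -> L2 v -> posint (u + v) <= posint u + posint v.
Proof.
move=> L2u L2v; have L2pu := L2_pos L2u; have L2pv := L2_pos L2v.
rewrite /posint -RintegralD//; [|exact: L2_integrable..].
apply: le_Rintegral => //.
- exact/L2_integrable/L2_pos/L2D.
- exact/L2_integrable/(L2D L2pu L2pv).
move=> x _; rewrite (_ : (u + v) x = u x + v x)//.
by rewrite ge_max lerD ?le_max ?lexx// addr_ge0 ?le_max ?lexx ?orbT.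
Qed.

Lemma posint_le u v : L2 u -> L2 v -> posint u <= posint v + 2 * normH (u - v).
Proof.
move=> L2u L2v; have L2uv := L2B L2u L2v.
rewrite -[u in leLHS](subrKC v) (le_trans (posintD _ _))// lerD2l.
exact: posint_norm.
Qed.

Lemma posint_eq0 u : L2 u -> posint u = 0 -> {ae mu, forall x, I x -> u x <= 0}.
Proof.
move=> L2u u0; have L2p := L2_pos L2u.
have i0 : (\int[mu]_(x in I) `|(Num.max (u x) 0)%:E| = 0)%E.
  rewrite -(@fineK _ (\int[mu]_(x in I) `|(Num.max (u x) 0)%:E|)%E); last first.
    apply: integrable_fin_num => //.
    by have := L2_integrable L2p => /integrable_abse.
  congr EFin; rewrite -[RHS]u0; congr fine.
  by apply: eq_integral => x _; rewrite /= ger0_norm// le_max lexx orbT.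
have mf : measurable_fun I (EFin \o (fun x => Num.max (u x) 0)).
  by apply/measurable_EFinP; exact: L2_measurable.
have /(ae_eq_integral_abs mu measurable_I1 mf) := i0.
apply: filterS.
by move=> x h /h[] /= ux0; rewrite -ux0 le_max lexx.
Qed.

Lemma posint_eq0_le u : L2 u -> {ae mu, forall x, I x -> u x <= 0} -> posint u = 0.
Proof.
move=> L2u u0; apply/eqP; rewrite eq_le posint_ge0 andbT.
have -> : 0 = posint (cst 0).
  by rewrite /posint /= maxxx (Rintegral_cst _ measurable_I1 0) mul0r.
apply: ae_le_posint => //; first exact: L2_cst.
apply: filterS u0.
by move=> x /[apply] /max_idPr ->; rewrite /= maxxx.
Qed.

End square_integrable_functions.

(** * Series in L^2(I) *)

Section completeness_of_L2.
Context {R : realType}.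
Notation mu := (@lebesgue_measure R).
Notation I := (@I1 R).
Notation L2 := (Lp 2%:E I).
Implicit Types (f g u v : R -> R) (z : nat -> R -> R).

Let mI : measurable (I : set (measurableTypeR R)) := @measurable_I1 R.

Lemma L2_sum z n : (forall k, L2 (z k)) -> L2 (\sum_(k < n) z k).
Proof.
move=> L2z; elim: n => [|n IH]; first by rewrite big_ord0; exact: (L2_cst 0).
by rewrite big_ord_recr/=; exact: L2D.
Qed.

Lemma normH0 : normH (0 : R -> R) = 0.
Proof.
by apply/eqP; rewrite eq_le normH_ge0 andbT; have := normH_cst (0 : R); rewrite normr0 mulr0.
Qed.

Lemma normH_sum z n : (forall k, L2 (z k)) ->
  normH (\sum_(k < n) z k) <= \sum_(k < n) normH (z k).
Proof.
move=> L2z; elim: n => [|n IH]; first by rewrite !big_ord0 normH0.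
rewrite !big_ord_recr/= (le_trans (normHD _ _))//; first exact: L2_sum.
by rewrite lerD2r.
Qed.

Lemma sum_fctE z n x : (\sum_(k < n) z k) x = \sum_(k < n) z k x.
Proof. by elim: n => [|n IH]; rewrite ?big_ord0// !big_ord_recr /= -IH. Qed.

Lemma L2_norm f : L2 f -> L2 (fun x => `|f x|).
Proof.
move=> /L2P[mf if2]; apply/L2P; split; first exact: measurableT_comp.
by apply: eq_integrable if2 => // x _ /=; rewrite real_normK// num_real.
Qed.

Lemma normH_norm f : normH (fun x => `|f x|) = normH f.
Proof.
by rewrite !normHE; congr Num.sqrt; apply: eq_Rintegral => x _; rewrite real_normK// num_real.
Qed.

(** The sums of the absolute values from rank [K] on increase to a limit whose
    square [E K] has an integral at most [B K ^+ 2], by monotone convergence.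
    Hence the series converges almost everywhere, and [E K] bounds the square
    of its remainder. *)
Lemma L2_series_cvg z (b B : nat -> R) : (forall k, L2 (z k)) ->
  (forall k, normH (z k) <= b k) ->
  (forall K n, \sum_(i < n) b (K + i)%N <= B K) ->
  exists2 u, L2 u & forall K, normH (u - \sum_(k < K) z k) <= B K.
Proof.
move=> L2z zb bB.
pose h K n : R -> R := \sum_(i < n) (fun x => `|z (K + i)%N x|).
have L2h K n : L2 (h K n) by apply: (L2_sum (z := fun i x => `|z (K + i)%N x|)) => k; exact: L2_norm.
have hE K n x : h K n x = \sum_(i < n) `|z (K + i)%N x| by rewrite /h (sum_fctE (fun i x => `|z (K + i)%N x|)).
have h0 K n x : 0 <= h K n x by rewrite hE sumr_ge0.
have hnd K x m n : (m <= n)%N -> h K m x <= h K n x.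
  move=> mn; rewrite -(subnK mn) addnC !hE big_split_ord/= lerDl.
  by rewrite sumr_ge0.
have B0 K : 0 <= B K by have := bB K 0%N; rewrite big_ord0.
have hB K n : normH (h K n) <= B K.
  apply: le_trans (bB K n); apply: le_trans (normH_sum (z := fun i x => `|z (K + i)%N x|) _ _) _.
    by move=> k; exact: L2_norm.
  by apply: ler_sum => i _; rewrite normH_norm.
pose e K n x := ((h K n x) ^+ 2)%:E.
have me K n : measurable_fun I (e K n).
  by apply/measurable_EFinP/measurable_funX; exact: L2_measurable.
have e0 K n x : (0 <= e K n x)%E by rewrite lee_fin sqr_ge0.
have end_ K x : {homo (e K)^~ x : m n / (m <= n)%N >-> (m <= n)%E}.
  by move=> m n mn; rewrite lee_fin lerXn2r ?nnegrE// hnd.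
pose E K x := limn ((e K)^~ x).
have eE K n x : (e K n x <= E K x)%E.
  apply: lime_ge; first exact: ereal_nondecreasing_is_cvgn.
  by exists n => // m /= nm; exact: end_.
have E0 K x : (0 <= E K x)%E := le_trans (e0 K 0%N x) (eE K 0%N x).
have mE K : measurable_fun I (E K).
  apply: (emeasurable_fun_cvg (e K)) => // x _; exact: ereal_nondecreasing_is_cvgn.
have intE K : (\int[mu]_(x in I) E K x <= (B K ^+ 2)%:E)%E.
  rewrite /E (monotone_convergence mu mI) => [|n|n x _|x _]; [|exact: me|exact: e0|exact: end_].
  apply: lime_le.
    apply: ereal_nondecreasing_is_cvgn => m n mn; apply: ge0_le_integral => //.
    + exact: me.
    + exact: me.
    + by move=> x _; exact: end_.
  apply: nearW => n.
  rewrite -[leLHS]fineK; last exact/integrable_fin_num/L2_integrable_sqr.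
  by rewrite lee_fin -[leLHS]normH_sqr lerXn2r ?nnegrE// normH_ge0.
have fE : {ae mu, forall x, I x -> E 0%N x \is a fin_num}.
  apply: integrable_ae => //; apply/integrableP; split; first exact: mE.
  under eq_integral do rewrite gee0_abs//.
  by rewrite (le_lt_trans (intE 0%N))// ltry.
pose s n : R -> R := \sum_(k < n) z k.
(* The upper limit makes the sum measurable. *)
pose u x := fine (limn_esup (fun n => (s n x)%:E)).
have mu_ : measurable_fun I u.
  apply: measurableT_comp => //; apply: measurable_fun_limn_esup => n.
  apply/measurable_EFinP; apply: L2_measurable; exact: (L2_sum n L2z).
have su x : E 0%N x \is a fin_num -> s^~ x @ \oo --> u x.
  move=> Ex; suff cs : cvgn (s^~ x).
    have c : (fun n => (s n x)%:E) @ \oo --> (limn (s^~ x))%:E.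
      by apply: cvg_EFin; [exact: nearW|exact: cs].
    by rewrite /u (cvg_limn_einf_sup c).2.
  have -> : s^~ x = series (fun k => z k x).
    by apply/funext => n; rewrite /s sum_fctE /series/= big_mkord.
  apply: normed_cvg; apply: nondecreasing_is_cvgn.
    apply: nondecreasing_series => k _ _; exact: normr_ge0.
  exists (1 + fine (E 0%N x)) => _ [n _ <-].
  have -> : [normed series (fun k => z k x)] n = h 0%N n x.
    by rewrite hE -(big_mkord xpredT (fun i => `|z i x|)).
  have := eE 0%N n x; rewrite -(fineK Ex) lee_fin.
  by have := h0 0%N n x; nra.
have uE K : {ae mu, forall x, I x -> (((u x - s K x) ^+ 2)%:E <= E K x)%E}.
  apply: filterS fE => x /[apply] /su sux.
  have [->|EK] := eqVneq (E K x) +oo%E; first exact: leey.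
  have EKf : E K x \is a fin_num by rewrite ge0_fin_numE// ltey.
  rewrite -(fineK EKf) lee_fin.
  have : (fun n => (s n x - s K x) ^+ 2) @ \oo --> (u x - s K x) ^+ 2.
    rewrite expr2; under eq_fun do rewrite expr2.
    by apply: cvgM; apply: cvgB => //; exact: cvg_cst.
  move=> c; rewrite -(cvg_lim _ c)//; apply: limr_le; first by apply/cvg_ex; eexists; exact: c.
  exists K => // n /= Kn.
  rewrite -lee_fin (fineK EKf); apply: le_trans (eE K (n - K)%N x).
  rewrite lee_fin -[leLHS]real_normK ?num_real// lerXn2r ?nnegrE//.
  have -> : s n x - s K x = \sum_(i < n - K) z (K + i)%N x.
    have sn : \sum_(k < n) z k x = \sum_(k < K + (n - K)) z k x by rewrite subnKC.
    by rewrite /s !sum_fctE sn big_split_ord/= addrAC subrr add0r.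
  by rewrite hE; exact: ler_norm_sum.
have L2uK K : L2 (u - s K) /\ normH (u - s K) <= B K.
  have mus : measurable_fun I (u - s K).
    by apply: measurable_funB => //; apply: L2_measurable; exact: (L2_sum K L2z).
  have le_int : (\int[mu]_(x in I) (((u - s K) x) ^+ 2)%:E <= (B K ^+ 2)%:E)%E.
    apply: le_trans (intE K); apply: ae_ge0_le_integral => //.
    - by move=> x _; rewrite lee_fin sqr_ge0.
    - by apply/measurable_EFinP/measurable_funX.
    - exact: mE.
    - exact: uE.
  have L2us : L2 (u - s K).
    apply/L2P; split => //; apply/integrableP; split.
      by apply/measurable_EFinP/measurable_funX.
    under eq_integral do rewrite gee0_abs ?lee_fin ?sqr_ge0//.
    by rewrite (le_lt_trans le_int)// ltry.
  split => //; rewrite normHE -[leRHS]ger0_norm// -sqrtr_sqr ler_wsqrtr//.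
  rewrite -lee_fin fineK//; exact/integrable_fin_num/L2_integrable_sqr.
exists u => [|K]; last exact: (L2uK K).2.
have := (L2uK 0%N).1; rewrite /s big_ord0.
by rewrite subr0.
Qed.

End completeness_of_L2.

(** * Pairs of square-integrable functions *)

Section pairs.
Context {R : realType}.
Notation mu := (@lebesgue_measure R).
Notation I := (@I1 R).
Notation L2 := (Lp 2%:E I).
Implicit Types (u v w : fun2 R) (c : R).

(** An equivalent norm on H x H, better suited to componentwise arguments. *)
Definition normS u : R := normH u.1 + normH u.2.

Lemma normS_ge0 u : 0 <= normS u.
Proof. by rewrite addr_ge0 ?normH_ge0. Qed.

Lemma normS_le_normHH u : normS u <= 2 * normHH u.
Proof.
have le i : normH i ^+ 2 <= normH u.1 ^+ 2 + normH u.2 ^+ 2 -> normH i <= normHH u.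
  by move=> h; rewrite -(ger0_norm (normH_ge0 i)) -sqrtr_sqr ler_wsqrtr.
rewrite mulr_natl mulr2n lerD// le// ?lerDl ?lerDr ?sqr_ge0//.
Qed.

Lemma normHH_le_normS u : normHH u <= normS u.
Proof.
rewrite -[leRHS]ger0_norm ?normS_ge0// -sqrtr_sqr ler_wsqrtr// /normS.
by have := normH_ge0 u.1; have := normH_ge0 u.2; nra.
Qed.

Lemma inHHD u v : inHH u -> inHH v -> inHH (u + v).
Proof. by move=> [u1 u2] [v1 v2]; split; exact: L2D. Qed.

Lemma inHHZ c u : inHH u -> inHH (c *: u).
Proof. by move=> [u1 u2]; split; exact: L2Z. Qed.

Lemma inHHN u : inHH u -> inHH (- u).
Proof. by move=> [u1 u2]; split; exact: L2N. Qed.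

Lemma inHHB u v : inHH u -> inHH v -> inHH (u - v).
Proof. by move=> [u1 u2] [v1 v2]; split; exact: L2B. Qed.

Lemma inHH0 : inHH (0 : fun2 R).
Proof. by split; exact: (L2_cst 0). Qed.

Lemma normS0 : normS (0 : fun2 R) = 0.
Proof. by rewrite /normS /= !normH0 addr0. Qed.

Lemma normSD u v : inHH u -> inHH v -> normS (u + v) <= normS u + normS v.
Proof.
move=> [u1 u2] [v1 v2]; rewrite /normS addrACA lerD//; exact: normHD.
Qed.

Lemma normSZ c u : inHH u -> normS (c *: u) = `|c| * normS u.
Proof. by move=> [u1 u2]; rewrite /normS mulrDr -!normHZ. Qed.

Lemma normSN u : inHH u -> normS (- u) = normS u.
Proof. by move=> uH; rewrite -scaleN1r normSZ// normrN1 mul1r. Qed.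

Lemma normSB u v : inHH u -> inHH v -> normS (u - v) <= normS u + normS v.
Proof. by move=> uH vH; rewrite -(normSN vH) normSD//; exact: inHHN. Qed.

Lemma normS_dist u v : inHH u -> inHH v -> normS (u - v) = normS (v - u).
Proof. by move=> uH vH; rewrite -normSN ?opprB//; exact: inHHB. Qed.

Lemma normS_trans w u v : inHH u -> inHH v -> inHH w ->
  normS (u - v) <= normS (u - w) + normS (w - v).
Proof.
by move=> uH vH wH; rewrite -[u - v](subrKA w) normSD//; exact: inHHB.
Qed.

Lemma eqHH_refl u : eqHH u u.
Proof. by split; exact: ae_eq_refl. Qed.

Lemma eqHH_sym u v : eqHH u v -> eqHH v u.
Proof. by case=> h1 h2; split; exact: ae_eq_sym. Qed.

Lemma eqHH_trans u v w : eqHH u v -> eqHH v w -> eqHH u w.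
Proof.
by case=> h1 h2 [k1 k2]; split; [apply: ae_eq_trans h1 k1|apply: ae_eq_trans h2 k2].
Qed.

Lemma ae_eqB (f1 f2 g1 g2 : R -> R) : ae_eq mu I f1 g1 -> ae_eq mu I f2 g2 ->
  ae_eq mu I (f1 - f2) (g1 - g2).
Proof.
move=> h1 h2; apply: filterS2 h1 h2 => x e1 e2 Ix.
by rewrite (_ : (_ - f2) x = f1 x - f2 x)// e1// e2.
Qed.

Lemma ae_eqD (f1 f2 g1 g2 : R -> R) : ae_eq mu I f1 g1 -> ae_eq mu I f2 g2 ->
  ae_eq mu I (f1 + f2) (g1 + g2).
Proof.
move=> h1 h2; apply: filterS2 h1 h2 => x e1 e2 Ix.
by rewrite (_ : (_ + f2) x = f1 x + f2 x)// e1// e2.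
Qed.

Lemma ae_eqZ c (f g : R -> R) : ae_eq mu I f g -> ae_eq mu I (c *: f) (c *: g).
Proof.
move=> h; apply: filterS h => x e Ix.
by rewrite (_ : (_ *: f) x = c * f x)// e.
Qed.

Lemma eqHHB u1 u2 v1 v2 : eqHH u1 v1 -> eqHH u2 v2 -> eqHH (u1 - u2) (v1 - v2).
Proof. by case=> a b [c d]; split; exact: ae_eqB. Qed.

Lemma eqHHD u1 u2 v1 v2 : eqHH u1 v1 -> eqHH u2 v2 -> eqHH (u1 + u2) (v1 + v2).
Proof. by case=> a b [c d]; split; exact: ae_eqD. Qed.

Lemma eqHHZ c u v : eqHH u v -> eqHH (c *: u) (c *: v).
Proof. by case=> a b; split; exact: ae_eqZ. Qed.

Lemma eqHH_normS u v : inHH u -> inHH v -> eqHH u v -> normS u = normS v.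
Proof. by move=> [u1 u2] [v1 v2] [e1 e2]; congr (_ + _); exact: ae_eq_normH. Qed.

Lemma normS_eq0 u : inHH u -> normS u = 0 -> eqHH u 0.
Proof.
move=> [u1 u2] /eqP; rewrite paddr_eq0 ?normH_ge0// => /andP[/eqP h1 /eqP h2].
by split; exact: normH_eq0.
Qed.

Lemma subr0_eqHH u v : eqHH (u - v) 0 -> eqHH u v.
Proof.
case=> h1 h2; split; [apply: filterS h1|apply: filterS h2] => x + Ix => /(_ Ix) h;
  by apply/eqP; rewrite -subr_eq0; apply/eqP.
Qed.

Lemma normS_eqHH u v : inHH u -> inHH v -> normS (u - v) = 0 -> eqHH u v.
Proof. by move=> uH vH /normS_eq0 h; apply/subr0_eqHH/h; exact: inHHB. Qed.

Lemma HH_series_cvg (z : nat -> fun2 R) (b B : nat -> R) : (forall k, inHH (z k)) ->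
  (forall k, normS (z k) <= b k) ->
  (forall K n, \sum_(i < n) b (K + i)%N <= B K) ->
  exists2 u, inHH u & forall K, normS (u - \sum_(k < K) z k) <= 2 * B K.
Proof.
move=> zH zb bB.
have sum_fst n : (\sum_(k < n) z k).1 = \sum_(k < n) (z k).1.
  by elim: n => [|n IH]; rewrite ?big_ord0// !big_ord_recr/= -IH.
have sum_snd n : (\sum_(k < n) z k).2 = \sum_(k < n) (z k).2.
  by elim: n => [|n IH]; rewrite ?big_ord0// !big_ord_recr/= -IH.
have [k|k|u1 u1L u1B] := L2_series_cvg (z := fun k => (z k).1) (b := b) _ _ bB.
- exact: (zH k).1.
- by apply: le_trans (zb k); rewrite lerDl normH_ge0.
have [k|k|u2 u2L u2B] := L2_series_cvg (z := fun k => (z k).2) (b := b) _ _ bB.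
- exact: (zH k).2.
- by apply: le_trans (zb k); rewrite lerDr normH_ge0.
exists (u1, u2) => // K.
by rewrite /normS /= sum_fst sum_snd mulr_natl mulr2n lerD.
Qed.

End pairs.

(** * Strongly continuous semigroups *)

Section C0_semigroup_facts.
Context {R : realType} (S : R -> fun2 R -> fun2 R).
Hypothesis CS : C0_semigroup S.
Implicit Types (u v w : fun2 R) (t h e : R).

Lemma semigroup_inHH t u : 0 <= t -> inHH u -> inHH (S t u).
Proof. by case: CS => + _ _ _ _; exact. Qed.

Lemma semigroup_lin t c u v : 0 <= t -> inHH u -> inHH v ->
  eqHH (S t (c *: u + v)) (c *: S t u + S t v).
Proof. by case: CS => _ + _ _ _; exact. Qed.

Lemma semigroup_bound t : 0 <= t ->
  exists2 M, 0 <= M & forall u, inHH u -> normS (S t u) <= M * normS u.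
Proof.
move=> t0; have [M uM] : exists M, forall u, inHH u -> normHH (S t u) <= M * normHH u.
  by case: CS => _ _ + _ _; exact.
exists (2 * `|M|) => [|u uH]; first by rewrite mulr_ge0.
apply: le_trans (normS_le_normHH _) _; rewrite -mulrA ler_pM2l//.
apply: le_trans (uM u uH) _; apply: le_trans (ler_wpM2l (normr_ge0 M) (normHH_le_normS u)).
by rewrite ler_wpM2r ?sqrtr_ge0// ler_norm.
Qed.

Lemma semigroupB t u v : 0 <= t -> inHH u -> inHH v ->
  eqHH (S t (u - v)) (S t u - S t v).
Proof.
move=> t0 uH vH; have := semigroup_lin (-1) t0 vH uH.
by rewrite scaleN1r addrC scaleN1r [X in eqHH _ X]addrC.
Qed.

Lemma semigroup_normSB t u v : 0 <= t -> inHH u -> inHH v ->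
  normS (S t u - S t v) = normS (S t (u - v)).
Proof.
move=> t0 uH vH; apply: eqHH_normS.
- by apply: inHHB; exact: semigroup_inHH.
- by apply: semigroup_inHH => //; exact: inHHB.
- by apply/eqHH_sym/semigroupB.
Qed.

Lemma semigroup_eqHH t u v : 0 <= t -> inHH u -> inHH v -> eqHH u v ->
  eqHH (S t u) (S t v).
Proof.
move=> t0 uH vH uv; apply: normS_eqHH; try exact: semigroup_inHH.
rewrite semigroup_normSB//; have [M M0 SM] := semigroup_bound t0.
apply/eqP; rewrite eq_le normS_ge0 andbT (le_trans (SM _ _))//; first exact: inHHB.
rewrite (_ : normS (u - v) = 0) ?mulr0// -normS0; apply: eqHH_normS.
- exact: inHHB.
- exact: inHH0.
- by have := eqHHB uv (eqHH_refl v); rewrite subrr.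
Qed.

Lemma semigroup0 u : inHH u -> eqHH (S 0 u) u.
Proof. by case: CS => _ _ _ [+ _] _; exact. Qed.

Lemma semigroupD t s u : 0 <= t -> 0 <= s -> inHH u ->
  eqHH (S (t + s) u) (S t (S s u)).
Proof. by case: CS => _ _ _ [_ +] _; exact. Qed.

Lemma semigroup_continuous0 u e : inHH u -> 0 < e ->
  exists2 d, 0 < d & forall h, 0 <= h < d -> normS (S h u - u) < e.
Proof.
move=> uH e0; have : normHH (S t u - u) @[t --> 0^'+] --> (0 : R).
  by case: CS => _ _ _ _; exact.
move=> /cvgrPdist_lt /(_ (e / 2)) h; have {h} := h ltac:(by rewrite divr_gt0).
move=> [d /= d0 dS]; exists d => // h /andP[]; rewrite le_eqVlt => /predU1P[<- _|h0 hd].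
  rewrite (eqHH_normS (v := 0)) ?normS0//; last first.
  - by have := eqHHB (semigroup0 uH) (eqHH_refl u); rewrite subrr.
  - exact: inHH0.
  - by apply: inHHB => //; apply: semigroup_inHH.
apply: le_lt_trans (normS_le_normHH _) _; rewrite mulrC -ltr_pdivlMr//.
have := dS h; rewrite /ball_/= sub0r normrN gtr0_norm// => /(_ hd h0).
by rewrite sub0r normrN ger0_norm// sqrtr_ge0.
Qed.

Lemma semigroup_normSZ t c u : 0 <= t -> inHH u ->
  normS (S t (c *: u)) = `|c| * normS (S t u).
Proof.
move=> t0 uH; have uS := semigroup_inHH t0 uH.
have S0 : eqHH (S t 0) 0.
  have := semigroupB t0 uH uH; rewrite !subrr; exact.
rewrite -normSZ//; apply: eqHH_normS; [by apply: semigroup_inHH => //; exact: inHHZ|exact: inHHZ|].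
have := semigroup_lin c t0 uH (@inHH0 R); rewrite addr0 => /eqHH_trans; apply.
by have := eqHHD (eqHH_refl (c *: S t u)) S0; rewrite addr0.
Qed.

End C0_semigroup_facts.

(** * Uniform boundedness of a semigroup near time 0 *)

Section uniform_boundedness.
Context {R : realType} (S : R -> fun2 R -> fun2 R).
Hypothesis CS : C0_semigroup S.
Implicit Types (u v w x z : fun2 R) (t h e : R).

(** A gliding-hump argument needs nearly extremal unit vectors. The factor
    [7 / 8] exceeds [1 / 2] even after subtraction of [2 / 7], the bound on the
    contribution of the later humps. *)
Lemma operator_norm t : 0 <= t ->
  exists N, [/\ 0 <= N, forall u, inHH u -> normS (S t u) <= N * normS u &
    exists z, [/\ inHH z, normS z <= 1 & 7 / 8 * N <= normS (S t z)]].
Proof.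
move=> t0; have [M M0 SM] := semigroup_bound CS t0.
pose A := [set normS (S t z) | z in [set z | inHH z /\ normS z <= 1]].
have A0 : A (normS (S t 0)).
  by exists 0 => //; split; [exact: inHH0|rewrite normS0].
have hA : has_sup A.
  split; first by eexists; exact: A0.
  exists M => _ [z [zH z1] <-]; apply: le_trans (SM z zH) _.
  by rewrite -[leRHS]mulr1 ler_wpM2l.
have A_ub z : inHH z -> normS z <= 1 -> normS (S t z) <= sup A.
  by move=> zH z1; apply: ub_le_sup; [exact: hA.2|exists z].
have N0 : 0 <= sup A.
  by apply: le_trans (ub_le_sup hA.2 A0); exact: normS_ge0.
exists (sup A); split => // [u uH|].
  have [u0|u0] := eqVneq (normS u) 0.
    by rewrite u0 mulr0; have := SM u uH; rewrite u0 mulr0.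
  have up : 0 < normS u by rewrite lt_neqAle eq_sym u0 normS_ge0.
  have := A_ub ((normS u)^-1 *: u) (inHHZ _ uH).
  rewrite normSZ// (semigroup_normSZ CS)// gtr0_norm ?invr_gt0// mulVf// lexx => /(_ isT).
  by rewrite mulrC ler_pdivrMr.
have [N00|Np] := eqVneq (sup A) 0.
  exists 0; split; [exact: inHH0|by rewrite normS0|].
  by rewrite N00 mulr0 normS_ge0.
have {}Np : 0 < sup A by rewrite lt_neqAle eq_sym Np.
have [_ [z [zH z1] <-] zN] : exists2 r, A r & sup A - sup A / 8 < r.
  by apply: sup_adherent => //; rewrite divr_gt0.
exists z; split => //; apply: ltW; apply: le_lt_trans zN; lra.
Qed.

(** The uniform boundedness principle, by a gliding hump. If it failed, a
    series of humps, with signs chosen so that no cancellation occurs, would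
    define an element at which S is not continuous at time 0. *)
Lemma semigroup_bounded_near0 : exists K d, [/\ 0 <= K, 0 < d &
  forall h u, 0 <= h <= d -> inHH u -> normS (S h u) <= K * normS u].
Proof.
apply: contrapT => nb.
have H n : exists t, [/\ 0 <= t, t <= n.+1%:R^-1 & exists N,
    [/\ 16 ^+ n <= N, forall u, inHH u -> normS (S t u) <= N * normS u &
    exists z, [/\ inHH z, normS z <= 1 & 7 / 8 * N <= normS (S t z)]]].
  apply: contrapT => nH; apply: nb; exists (16 ^+ n), n.+1%:R^-1; split => //.
  move=> h u /andP[h0 hn] uH; rewrite leNgt; apply/negP => Shu; apply: nH.
  exists h; split => //; have [N [N0 SN zN]] := operator_norm h0.
  exists N; split => //; have {}SN := SN u uH.
  have : 16 ^+ n * normS u < N * normS u := lt_le_trans Shu SN.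
  have := normS_ge0 u; rewrite le_eqVlt => /predU1P[<-|u0]; first by rewrite !mulr0 ltxx.
  by rewrite ltr_pM2r// => /ltW.
(* Hump [n] has size 8^-n and S (t n) has norm at least 16^n, so that the
   orbit of the sum has size at least 2^n / 2 at the time [t n], which tends
   to 0. *)
have {H} [t tP] := choice H.
have t0 n : 0 <= t n by have [] := tP n.
have tn n : t n <= n.+1%:R^-1 by have [] := tP n.
have {tP} tP n : exists Nz : R * fun2 R, [/\ 16 ^+ n <= Nz.1,
    forall u, inHH u -> normS (S (t n) u) <= Nz.1 * normS u,
    inHH Nz.2, normS Nz.2 <= 1 & 7 / 8 * Nz.1 <= normS (S (t n) Nz.2)].
  by have [_ _ [N [N16 SN [z [zH z1 zN]]]]] := tP n; exists (N, z).
have {tP} [Nz NzP] := choice tP.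
pose N n := (Nz n).1; pose z n := (8^-1 ^+ n) *: (Nz n).2.
have r0 n : 0 <= 8^-1 ^+ n :> R by rewrite exprn_ge0.
have zH n : inHH (z n) by apply: inHHZ; have [] := NzP n.
have z1 n : normS (z n) <= 8^-1 ^+ n.
  have [_ _ H h1 _] := NzP n; rewrite /z normSZ// ger0_norm//.
  by rewrite -[leRHS]mulr1 ler_wpM2l.
have zS n : 7 / 8 * N n * 8^-1 ^+ n <= normS (S (t n) (z n)).
  have [_ _ H _ h] := NzP n; rewrite /z (semigroup_normSZ CS)// ger0_norm// mulrC.
  exact: ler_wpM2l.
pose step n x := if normS (S (t n) (z n)) <= normS (S (t n) (x + z n)) then x + z n else x - z n.
pose fix x n : fun2 R := if n is m.+1 then step m (x m) else 0.
have xH n : inHH (x n).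
  elim: n => [|n IH] /=; first exact: inHH0.
  by rewrite /step; case: ifP => _; [exact: inHHD|exact: inHHB].
have xS n : normS (S (t n) (z n)) <= normS (S (t n) (x n.+1)).
  rewrite /= /step; case: ifP => // /negbT; rewrite -ltNge => xz.
  have tri : normS (S (t n) (x n + z n) - S (t n) (x n - z n)) <=
      normS (S (t n) (x n + z n)) + normS (S (t n) (x n - z n)).
    by apply: normSB; apply: (semigroup_inHH CS) => //; [exact: inHHD|exact: inHHB].
  move: tri; rewrite (semigroup_normSB CS)//; [|exact: inHHD|exact: inHHB].
  have -> : x n + z n - (x n - z n) = 2 *: z n.
    by rewrite opprB addrC addrA subrK scaler_nat mulr2n.
  rewrite (semigroup_normSZ CS)// ger0_norm//; lra.
pose y n := x n.+1 - x n.
have yH n : inHH (y n) by exact: inHHB.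
have yz n : normS (y n) = normS (z n).
  rewrite /y /= /step; case: ifP => _; first by rewrite addrAC subrr add0r.
  by rewrite addrAC subrr add0r normSN.
have xE n : \sum_(k < n) y k = x n.
  elim: n => [|n IH]; first by rewrite big_ord0.
  by rewrite big_ord_recr IH; exact: subrKC.
pose B n : R := 8 / 7 * 8^-1 ^+ n.
have bB k n : \sum_(i < n) 8^-1 ^+ (k + i)%N <= B k.
  suff -> : \sum_(i < n) 8^-1 ^+ (k + i)%N = 8 / 7 * 8^-1 ^+ k * (1 - 8^-1 ^+ n) :> R.
    by rewrite /B -[leRHS]mulr1 ler_wpM2l ?mulr_ge0 ?divr_ge0// lerBlDr lerDl.
  elim: n => [|n IH]; first by rewrite big_ord0 subrr mulr0.
  by rewrite big_ord_recr/= IH exprD !exprS; field.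
have y1 n : normS (y n) <= 8^-1 ^+ n by rewrite yz.
have [u uH ux] := HH_series_cvg yH y1 bB.
have Su n : 2 ^+ n / 2 <= normS (S (t n) u).
  have [N16 SN _ _ _] := NzP n; rewrite -/(N n) in N16 SN.
  have := ux n.+1; rewrite xE => uxn.
  have d1 : normS (S (t n) u - S (t n) (x n.+1)) <= N n * (2 * B n.+1).
    rewrite (semigroup_normSB CS)//; apply: le_trans (SN _ _) _; first exact: inHHB.
    by rewrite ler_wpM2l// (le_trans _ N16)// exprn_ge0.
  have d2 : normS (S (t n) (x n.+1)) <= normS (S (t n) u) + normS (S (t n) u - S (t n) (x n.+1)).
    rewrite -[X in normS X <= _](subKr (S (t n) u)); apply: normSB; first exact: (semigroup_inHH CS).
    by apply: inHHB; exact: (semigroup_inHH CS).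
  have := le_trans (zS n) (le_trans (xS n) d2); move: d1; rewrite /B exprS.
  have : 2 ^+ n <= N n * 8^-1 ^+ n.
    have -> : 2 ^+ n = 16 ^+ n * 8^-1 ^+ n :> R by rewrite -exprMn; congr (_ ^+ n); field.
    by rewrite ler_wpM2r.
  have : 0 <= N n * 8^-1 ^+ n by rewrite mulr_ge0// (le_trans _ N16)// exprn_ge0.
  lra.
have [d d0 Sd] := semigroup_continuous0 CS uH ltr01.
pose n := maxn (Num.truncn d^-1) (Num.truncn (2 * (normS u + 1))).
have td : t n < d.
  apply: le_lt_trans (tn n) _; rewrite invf_plt ?posrE ?ltr0n//.
  apply: lt_le_trans (truncnS_gt _) _; rewrite ler_nat ltnS; exact: leq_maxl.
have : normS (S (t n) u) <= normS u + 1.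
  have := Sd (t n); rewrite t0 td => /(_ isT) /ltW h.
  rewrite -[X in normS X <= _](subrK u) addrC (le_trans (normSD _ _))// ?lerD2l//.
  by apply: inHHB => //; apply: (semigroup_inHH CS).
apply/negP; rewrite -ltNge; apply: lt_le_trans (Su n).
rewrite ltr_pdivlMr// mulrC; apply: lt_le_trans (truncnS_gt _) _.
apply: (@le_trans _ _ n.+1%:R); first by rewrite ler_nat ltnS; exact: leq_maxr.
by rewrite -natrX ler_nat ltn_expl.
Qed.

(** Continuity at time 0 gives continuity on both sides, since S t v - S s v =
    S s (S (t - s) v - v) and S s is bounded uniformly in s. *)
Lemma semigroup_orbit_continuous K d v e : 0 <= K ->
  (forall h u, 0 <= h <= d -> inHH u -> normS (S h u) <= K * normS u) ->
  inHH v -> 0 < e ->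
  exists2 r, 0 < r & forall s t, 0 <= s <= d -> 0 <= t <= d -> `|s - t| < r ->
    normS (S s v - S t v) < e.
Proof.
move=> K0 SK vH e0.
have [r r0 Sr] := semigroup_continuous0 CS vH (divr_gt0 e0 (ltr_wpDl K0 ltr01)).
exists r => // s t.
wlog st : s t / s <= t.
  move=> hw sd td str; have [st|/ltW ts] := leP s t; first exact: hw.
  have [s0 _] := andP sd; have [t0 _] := andP td.
  rewrite normS_dist; try exact: (semigroup_inHH CS).
  by apply: hw => //; rewrite distrC.
move=> sd td; rewrite distrC ger0_norm ?subr_ge0// => str.
have [s0 t0] : 0 <= s /\ 0 <= t by case/andP: sd; case/andP: td.
have ts0 : 0 <= t - s by rewrite subr_ge0.
have SvH := semigroup_inHH CS ts0 vH.
have -> : normS (S s v - S t v) = normS (S s (S (t - s) v - v)).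
  rewrite -(semigroup_normSB CS)// normS_dist; try exact: (semigroup_inHH CS).
  apply: eqHH_normS; try by apply: inHHB; apply: (semigroup_inHH CS).
  apply: eqHHB; last exact: eqHH_refl.
  by have := semigroupD CS s0 ts0 vH; rewrite subrKC.
apply: le_lt_trans (SK _ _ sd _) _; first exact: inHHB.
have := Sr (t - s); rewrite ts0 str => /(_ isT) h.
apply: (@le_lt_trans _ _ (K * (e / (K + 1)))); first by rewrite ler_wpM2l// ltW.
by rewrite mulrCA -[ltRHS]mulr1 ltr_pM2l// ltr_pdivrMr ?mul1r ?ltrDl ?ltr01// ltr_wpDl.
Qed.

End uniform_boundedness.

(** * Functions with non-positive Dini derivatives *)

Section dini.
Context {R : realType}.

(** Let [c] be the supremum of the times [t] with [f t <= f 0 + e * t]. By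
    continuity [c] has this property; if [c < b], so has a time larger than
    [c]. *)
Lemma dini_nonincreasing (f : R -> R) (b : R) : 0 <= b ->
  (forall t, 0 <= t <= b -> forall e, 0 < e -> exists2 r, 0 < r &
    forall s, 0 <= s <= b -> `|s - t| < r -> `|f s - f t| < e) ->
  (forall t, 0 <= t < b -> forall e, 0 < e ->
    exists h, [/\ 0 < h, t + h <= b & f (t + h) <= f t + e * h]) ->
  f b <= f 0.
Proof.
move=> b0 cf df; apply/ler_addgt0Pr => e' e'0.
pose e := e' / (b + 1); have b1 : 0 < b + 1 by rewrite ltr_wpDl.
have e0 : 0 < e by rewrite divr_gt0.
suff fb : f b <= f 0 + e * b.
  apply: (le_trans fb); rewrite lerD2l /e mulrAC ler_pdivrMr// ler_pM2l// lerDl//.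
pose A := [set t | 0 <= t <= b /\ f t <= f 0 + e * t].
have A0 : A 0 by split; rewrite ?lexx ?b0// mulr0 addr0.
have ubA : has_ubound A by exists b => t [/andP[]].
have hA : has_sup A by split => //; exists 0.
pose c := sup A.
have c0 : 0 <= c := ub_le_sup ubA A0.
have cb : c <= b by apply: ge_sup; [exists 0|move=> t [/andP[]]].
have fc : f c <= f 0 + e * c.
  rewrite leNgt; apply/negP => fcgt.
  have [r r0 fr] := cf c ltac:(by rewrite c0) (f c - (f 0 + e * c)) ltac:(by rewrite subr_gt0).
  have [t [/andP[t0 tb] ft] ct] := sup_adherent r0 hA; rewrite -/c in ct.
  have tc : t <= c by apply: ub_le_sup => //; split; rewrite ?t0.
  have := fr t; rewrite t0 tb => /(_ isT).
  rewrite distrC ger0_norm ?subr_ge0// ltrBlDr -ltrBlDl => /(_ ct).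
  rewrite distrC => /(le_lt_trans (ler_norm _)).
  have : e * t <= e * c by rewrite ler_pM2l.
  lra.
have [<-//|cltb] : c = b \/ c < b by move: cb; rewrite le_eqVlt => /predU1P.
exfalso; have [h [h0 chb fch]] := df c ltac:(by rewrite c0) e e0.
have : c + h <= c.
  apply: ub_le_sup => //; split; first by rewrite chb addr_ge0// ltW.
  by rewrite mulrDr; lra.
lra.
Qed.

End dini.

Lemma resolvent_step_rearrangement (R : realType) (V : lmodType R) (h : R) (a b c d f : V) :
  a - b - h *: c + h *: (d - f) = a - h *: (c - d + f) - b.
Proof.
rewrite -[LHS]addrA addrAC; congr (_ + _ - b).
by rewrite scalerBr scalerDr scalerBr !opprD !opprK addrA.
Qed.

(** * Orbits in the domain of the generator *)

Section generator.
Context {R : realType} (D : fun2 R -> Prop) (A : fun2 R -> fun2 R).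
Context (S : R -> fun2 R -> fun2 R).
Hypothesis gen : semigroup_generated_by D A S.
Hypothesis D_inHH : forall w, D w -> inHH w /\ inHH (A w).
Implicit Types (u v w z : fun2 R) (t h e : R).

Let CS : C0_semigroup S := gen.1.

Lemma quotient_normS u z h : inHH u -> inHH z -> 0 < h ->
  normS (S h u - u - h *: z) = h * normS (h^-1 *: (S h u - u) - z).
Proof.
move=> uH zH h0.
have dH : inHH (S h u - u) by apply: inHHB => //; apply: (semigroup_inHH CS) => //; exact: ltW.
rewrite -[X in X * _]ger0_norm ?ltW// -normSZ; last by apply: inHHB => //; exact: inHHZ.
by rewrite scalerBr scalerA divff ?gt_eqF// scale1r.
Qed.

Lemma generator_derivative v e : D v -> 0 < e ->
  exists2 d, 0 < d & forall h, 0 < h < d -> normS (S h v - v - h *: A v) <= e * h.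
Proof.
move=> Dv e0; have [vH AvH] := D_inHH Dv.
have /(gen.2 v (A v) vH AvH).2 : exists w, [/\ D w, eqHH v w & eqHH (A v) (A w)].
  by exists v; split => //; exact: eqHH_refl.
move=> /cvgrPdist_lt /(_ (e / 2) ltac:(by rewrite divr_gt0)) [d /= d0 dS].
exists d => // h /andP[h0 hd]; rewrite quotient_normS// mulrC ler_pM2r//.
apply: le_trans (normS_le_normHH _) _; rewrite mulrC -ler_pdivlMr//.
have := dS h; rewrite /ball_/= sub0r normrN gtr0_norm// => /(_ hd h0).
by rewrite sub0r normrN ger0_norm ?sqrtr_ge0// => /ltW.
Qed.

Lemma generator_domain u z : inHH u -> inHH z ->
  (forall e, 0 < e -> exists2 d, 0 < d & forall h, 0 < h < d ->
    normS (S h u - u - h *: z) <= e * h) ->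
  exists w, [/\ D w, eqHH u w & eqHH z (A w)].
Proof.
move=> uH zH uz; apply/(gen.2 u z uH zH); apply/cvgrPdist_le => /= e e0.
have [d d0 du] := uz e e0; exists d => // h /=.
rewrite sub0r normrN => hd h0; rewrite gtr0_norm// in hd.
rewrite sub0r normrN ger0_norm ?sqrtr_ge0//.
apply: le_trans (normHH_le_normS _) _.
by have := du h; rewrite h0 hd quotient_normS// mulrC ler_pM2r//; exact.
Qed.

(** S t is bounded and commutes with the difference quotients of the orbit at
    time 0. *)
Lemma generator_invariant v t : D v -> 0 <= t ->
  exists w, [/\ D w, eqHH (S t v) w & eqHH (S t (A v)) (A w)].
Proof.
move=> Dv t0; have [vH AvH] := D_inHH Dv.
have SvH := semigroup_inHH CS t0 vH; have SAvH := semigroup_inHH CS t0 AvH.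
apply: generator_domain => // e e0.
have [M M0 SM] := semigroup_bound CS t0.
have [d d0 dS] := generator_derivative Dv (divr_gt0 e0 (ltr_wpDl M0 ltr01)).
exists d => // h hd; have h0 : 0 < h by case/andP: hd.
have ShH := semigroup_inHH CS (ltW h0) vH.
have dH : inHH (S h v - v) by exact: inHHB.
have -> : normS (S h (S t v) - S t v - h *: S t (A v)) =
    normS (S t (S h v - v - h *: A v)).
  apply: eqHH_normS.
  - apply: inHHB; last exact: inHHZ.
    by apply: inHHB => //; apply: (semigroup_inHH CS) => //; exact: ltW.
  - by apply: (semigroup_inHH CS) => //; apply: inHHB => //; exact: inHHZ.
  apply: eqHH_sym; apply: eqHH_trans (semigroupB CS t0 dH (inHHZ h AvH)) _.
  apply: eqHHB; last first.
    by have := semigroup_lin CS h t0 AvH (inHHB AvH AvH); rewrite subrr addr0 => /eqHH_trans; apply;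
      have := eqHHD (eqHH_refl (h *: S t (A v))) (semigroupB CS t0 AvH AvH); rewrite !subrr addr0.
  apply: eqHH_trans (semigroupB CS t0 ShH vH) _; apply: eqHHB; last exact: eqHH_refl.
  apply: eqHH_trans (eqHH_sym (semigroupD CS t0 (ltW h0) vH)) _.
  by rewrite addrC; apply: semigroupD => //; exact: ltW.
apply: le_trans (SM _ _) _; first by apply: inHHB => //; exact: inHHZ.
apply: (@le_trans _ _ (M * (e / (M + 1) * h))); first by rewrite ler_wpM2l// dS.
rewrite mulrA ler_pM2r// mulrCA -[leRHS]mulr1 ler_pM2l// ler_pdivrMr ?ltr_wpDl//.
by rewrite mul1r lerDl.
Qed.

(** The resolvent step of size [h] from S (t + h) v leads to S t v up to o(h),
    so that no lower right Dini derivative of P (S t v) is positive. *)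
Lemma accretive_contraction (P : fun2 R -> R) (C K d : R) : 0 <= C -> 0 <= K ->
  (forall u v, inHH u -> inHH v -> P u <= P v + C * normS (u - v)) ->
  (forall w h, D w -> 0 <= h -> P w <= P (w - h *: A w)) ->
  (forall h u, 0 <= h <= d -> inHH u -> normS (S h u) <= K * normS u) ->
  forall v t, D v -> 0 <= t <= d -> P (S t v) <= P v.
Proof.
move=> C0 K0 P_lip P_acc SK v b Dv /andP[b0 bd].
have [vH AvH] := D_inHH Dv.
have C1 : 0 < C + 1 by rewrite ltr_wpDl.
have P_eq u w : inHH u -> inHH w -> eqHH u w -> P u <= P w.
  move=> uH wH uw; apply: le_trans (P_lip u w uH wH) _.
  rewrite (eqHH_normS (v := 0)) ?normS0 ?mulr0 ?addr0//; first exact: inHHB.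
    exact: inHH0.
  by have := eqHHB uw (eqHH_refl w); rewrite subrr.
have SvH t : 0 <= t -> inHH (S t v) by move=> t0; exact: (semigroup_inHH CS).
have SAvH t : 0 <= t -> inHH (S t (A v)) by move=> t0; exact: (semigroup_inHH CS).
apply: (@le_trans _ _ (P (S 0 v))); last first.
  by apply: P_eq => //; [exact: SvH|exact: semigroup0].
apply: (@dini_nonincreasing _ (fun t => P (S t v))) => // [t /andP[t0 tb] e e0|t /andP[t0 tb] e e0].
  have [r r0 Sr] := semigroup_orbit_continuous CS K0 SK vH (divr_gt0 e0 C1).
  exists r => // s /andP[s0 sb] st.
  have sd : 0 <= s <= d by rewrite s0 (le_trans sb).
  have td : 0 <= t <= d by rewrite t0 (le_trans tb).
  have bnd s' t' : 0 <= s' <= d -> 0 <= t' <= d -> `|s' - t'| < r -> P (S s' v) - P (S t' v) < e.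
    move=> sd' td' st'; rewrite ltrBlDl.
    have [s0' t0'] : 0 <= s' /\ 0 <= t' by case/andP: sd'; case/andP: td'.
    apply: le_lt_trans (P_lip _ _ (SvH _ s0') (SvH _ t0')) _; rewrite ltrD2l.
    apply: (@le_lt_trans _ _ (C * (e / (C + 1)))); first by rewrite ler_wpM2l// ltW// Sr.
    by rewrite mulrCA -[ltRHS]mulr1 ltr_pM2l// ltr_pdivrMr ?mul1r ?ltrDl.
  by rewrite ltr_norml bnd// andbT ltrNl opprB bnd// distrC.
have e20 : 0 < e / (C + 1) / 2 by rewrite !divr_gt0.
have [w [Dw vw Avw]] := generator_invariant Dv t0.
have [wH AwH] := D_inHH Dw.
have [d1 d10 dS1] := generator_derivative Dw e20.
have [d2 d20 dS2] := semigroup_continuous0 CS (SAvH t t0) e20.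
pose h := Num.min (b - t) (Num.min d1 d2) / 2.
have m0 : 0 < Num.min (b - t) (Num.min d1 d2) by rewrite !lt_min subr_gt0 tb d10.
have h0 : 0 < h by rewrite divr_gt0.
have : h < Num.min (b - t) (Num.min d1 d2) by rewrite /h ltr_pdivrMr// ltr_pMr// ltr1n.
rewrite !lt_min => /and3P[hbt hd1 hd2].
exists h; split => //; first by rewrite -lerBrDl ltW.
have th0 : 0 <= t + h by rewrite addr_ge0// ltW.
have [w' [Dw' vw' Avw']] := generator_invariant Dv th0.
have [wH' AwH'] := D_inHH Dw'.
apply: (@le_trans _ _ (P w')); first by apply: P_eq => //; exact: SvH.
apply: le_trans (P_acc w' h Dw' (ltW h0)) _.
apply: le_trans (P_lip _ w _ wH) _; first by apply: inHHB => //; exact: inHHZ.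
apply: lerD; first by apply: P_eq => //; [exact: SvH|exact: eqHH_sym].
suff : normS (w' - h *: A w' - w) <= e / (C + 1) * h.
  move=> H; apply: (@le_trans _ _ (C * (e / (C + 1) * h))); first by rewrite ler_wpM2l.
  rewrite mulrA ler_pM2r// mulrCA -[leRHS]mulr1 ler_pM2l// ler_pdivrMr//.
  by rewrite mul1r lerDl.
have ShwH : inHH (S h w) by apply: (semigroup_inHH CS) => //; exact: ltW.
have -> : normS (w' - h *: A w' - w) =
    normS ((S h w - w - h *: A w) + h *: (S t (A v) - S h (S t (A v)))).
  apply: eqHH_normS.
  - by apply: inHHB => //; apply: inHHB => //; exact: inHHZ.
  - apply: inHHD; first by apply: inHHB; [exact: inHHB|exact: inHHZ].
    apply: inHHZ; apply: inHHB; first exact: SAvH.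
    by apply: (semigroup_inHH CS); [exact: ltW|exact: SAvH].
  have w'E : eqHH w' (S h w).
    apply: eqHH_trans (eqHH_sym vw') _; rewrite addrC.
    apply: eqHH_trans (semigroupD CS (ltW h0) t0 vH) _.
    by apply: (semigroup_eqHH CS) => //; [exact: ltW|exact: SvH].
  have Aw'E : eqHH (A w') (S h (S t (A v))).
    by apply: eqHH_trans (eqHH_sym Avw') _; rewrite addrC; apply: semigroupD => //; exact: ltW.
  rewrite resolvent_step_rearrangement.
  apply: eqHHB; last exact: eqHH_refl.
  apply: eqHHB => //; apply: eqHHZ; apply: eqHH_trans Aw'E _.
  have := eqHHD (eqHHB (eqHH_sym Avw) (eqHH_refl (S t (A v)))) (eqHH_refl (S h (S t (A v)))).
  by rewrite subrr add0r => /eqHH_sym.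
apply: le_trans (normSD _ _) _.
- by apply: inHHB; [exact: inHHB|exact: inHHZ].
- apply: inHHZ; apply: inHHB; first exact: SAvH.
  by apply: (semigroup_inHH CS); [exact: ltW|exact: SAvH].
rewrite normSZ; last first.
  apply: inHHB; first exact: SAvH.
  by apply: (semigroup_inHH CS); [exact: ltW|exact: SAvH].
rewrite gtr0_norm// [e / _](splitr) mulrDl lerD//; first by apply: dS1; rewrite h0.
rewrite mulrC ler_pM2r// normS_dist; [|exact: SAvH|]; last first.
  by apply: (semigroup_inHH CS); [exact: ltW|exact: SAvH].
by apply/ltW/dS2; rewrite ltW.
Qed.

End generator.

(** * Integrals and local absolute continuity on I *)

Section integrals.
Context {R : realType}.
Notation mu := (@lebesgue_measure R).
Notation I := (@I1 R).
Implicit Types (f g u v w : R -> R) (a b x y h c e : R).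

Lemma ae_neq c : {ae mu, forall x, x != c}.
Proof.
exists [set c]; split; [exact: measurable_set1|exact: lebesgue_measure_set1|].
by move=> x /=; case: eqP.
Qed.

Lemma ae_eq_Rintegral (D : set R) f g :
  measurable (D : set (measurableTypeR R)) -> measurable_fun D f -> measurable_fun D g ->
  {ae mu, forall x, D x -> f x = g x} ->
  \int[mu]_(x in D) f x = \int[mu]_(x in D) g x.
Proof.
move=> mD mf mg fg; congr fine; apply: ae_eq_integral => //.
- exact/measurable_EFinP.
- exact/measurable_EFinP.
- by apply: filterS fg => x h /h ->.
Qed.

Lemma ae_le_Rintegral (D : set R) f g :
  measurable (D : set (measurableTypeR R)) ->
  mu.-integrable D (EFin \o f) -> mu.-integrable D (EFin \o g) ->
  {ae mu, forall x, D x -> f x <= g x} ->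
  \int[mu]_(x in D) f x <= \int[mu]_(x in D) g x.
Proof.
move=> mD fi gi fg.
have mf : measurable_fun D f by apply/measurable_EFinP; case/integrableP: fi.
have mg : measurable_fun D g by apply/measurable_EFinP; case/integrableP: gi.
have mm : measurable_fun D (fun x => Num.max (f x) (g x)) by exact: measurable_maxr.
have im : mu.-integrable D (EFin \o (fun x => Num.max (f x) (g x))).
  have := integrableD mD (integrable_norm fi) (integrable_norm gi).
  apply: le_integrable => //; first exact/measurable_EFinP.
  move=> x _ /=; rewrite lee_fin [leRHS]ger0_norm ?addr_ge0//.
  by have [_|_] := leP (f x) (g x); rewrite ?lerDl ?lerDr.
rewrite [leRHS](@ae_eq_Rintegral _ _ (fun x => Num.max (f x) (g x)))//; last first.
  by apply: filterS fg => x h /h fgx; rewrite (max_idPr fgx).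
by apply: le_Rintegral => // x _; rewrite le_max lexx.
Qed.

Lemma continuous_integrable_itv a b f :
  {in `[a, b], forall x, {for x, continuous f}} ->
  mu.-integrable `[a, b]%classic (EFin \o f).
Proof.
move=> cf; apply: continuous_compact_integrable; first exact: segment_compact.
by apply: continuous_in_subspaceT => x; rewrite inE => /= xab; exact: cf.
Qed.

Lemma subset_itvcc_I1 a b : -1 < a -> b < 1 -> `[a, b]%classic `<=` I.
Proof.
move=> a1 b1 x; rewrite /I1 /= !in_itv/= => /andP[ax xb].
by rewrite (lt_le_trans a1 ax) (le_lt_trans xb b1).
Qed.

Lemma I1_inner x : I x -> exists a b, [/\ -1 < a, a < x, x < b & b < 1].
Proof.
rewrite /I1 /= in_itv/= => /andP[x1 x2]; exists ((x - 1) / 2), ((x + 1) / 2).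
by split; lra.
Qed.

Lemma I1_bounds x : I x -> -1 < x < 1.
Proof. by rewrite /I1 /= in_itv. Qed.

Lemma loc_abs_cont_I1 u a b : loc_abs_cont I u -> -1 < a -> a <= b -> b < 1 ->
  abs_cont a b u.
Proof. by move=> lu a1 ab b1; apply: lu => //; exact: subset_itvcc_I1. Qed.

Lemma loc_abs_cont_continuous u x : loc_abs_cont I u -> I x -> {for x, continuous u}.
Proof.
move=> lu /I1_inner[a [b [a1 ax xb b1]]].
apply: (abs_cont_continuous (a := a) (b := b)); last by rewrite ax.
by apply: loc_abs_cont_I1 => //; rewrite ltW// (lt_trans ax).
Qed.

Lemma continuous_measurable_I1 u : (forall x, I x -> {for x, continuous u}) ->
  measurable_fun I u.
Proof.
move=> cu; apply: subspace_continuous_measurable_fun; first exact: measurable_I1.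
by apply: continuous_in_subspaceT => x; rewrite inE; exact: cu.
Qed.

(** An exhaustion of I by compact intervals. *)
Definition inner_itv (n : nat) : set R := `[-1 + n.+2%:R^-1, 1 - n.+2%:R^-1]%classic.

Lemma inner_itv_bounds n : [/\ -1 < -1 + n.+2%:R^-1 :> R,
  -1 + n.+2%:R^-1 < 1 - n.+2%:R^-1 :> R & 1 - n.+2%:R^-1 < 1 :> R].
Proof.
have n0 : 0 < n.+2%:R^-1 :> R by rewrite invr_gt0 ltr0n.
have n2 : n.+2%:R^-1 <= 2^-1 :> R by rewrite lef_pV2 ?posrE ?ltr0n// ler_nat.
by move: (n.+2%:R^-1) n0 n2 => z z0 z2; split; lra.
Qed.

Lemma inner_itv_nd : {homo inner_itv : n m / (n <= m)%N >-> (n <= m)%O}.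
Proof.
move=> n m nm; apply/subsetPset => x; rewrite /inner_itv /= !in_itv/= => /andP[nx xn].
have : m.+2%:R^-1 <= n.+2%:R^-1 :> R by rewrite lef_pV2 ?posrE ?ltr0n// ler_nat.
by move: (n.+2%:R^-1) (m.+2%:R^-1) nx xn => r s nx xn sr; apply/andP; split; lra.
Qed.

Lemma inner_itv_sub n : inner_itv n `<=` I.
Proof. by have [? _ ?] := inner_itv_bounds n; exact: subset_itvcc_I1. Qed.

Lemma inner_itv_interior x : I x -> exists n, -1 + n.+2%:R^-1 < x < 1 - n.+2%:R^-1.
Proof.
move=> /I1_bounds/andP[x1 x2].
have m0 : 0 < Num.min (x + 1) (1 - x) by rewrite lt_min; apply/andP; split; lra.
exists (Num.truncn (Num.min (x + 1) (1 - x))^-1).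
set n := Num.truncn _.
have : n.+2%:R^-1 < Num.min (x + 1) (1 - x).
  rewrite invf_plt ?posrE ?ltr0n//; apply: lt_trans (truncnS_gt _) _.
  by rewrite ltr_nat.
by rewrite lt_min; move: (_^-1) => r /andP[h1 h2]; apply/andP; split; lra.
Qed.

Lemma bigcup_inner_itv : \bigcup_n inner_itv n = I.
Proof.
apply/seteqP; split => [x [n _ /inner_itv_sub]//|x /inner_itv_interior[n /andP[h1 h2]]].
by exists n => //; rewrite /inner_itv /= in_itv/= !ltW.
Qed.

(** Monotone convergence, for the positive and the negative part. *)
Lemma Rintegral_inner_cvg f : mu.-integrable I (EFin \o f) ->
  \int[mu]_(x in inner_itv n) f x @[n --> \oo] --> \int[mu]_(x in I) f x.
Proof.
move=> fi; have mf : measurable_fun I f by apply/measurable_EFinP; case/integrableP: fi.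
have mn n : measurable (inner_itv n : set (measurableTypeR R)) by exact: measurable_itv.
have pos g : (forall x, 0 <= g x) -> mu.-integrable I (EFin \o g) ->
    \int[mu]_(x in inner_itv n) g x @[n --> \oo] --> \int[mu]_(x in I) g x.
  move=> g0 gi; apply: fine_cvg.
  rewrite fineK; last by apply: integrable_fin_num => //; exact: measurable_I1.
  rewrite -[in X in _ --> X]bigcup_inner_itv.
  apply: ge0_nondecreasing_set_cvg_integral; [exact: inner_itv_nd|exact: mn| |].
  - move=> n; apply: (@measurable_funS _ _ _ _ I); [exact: measurable_I1|exact: inner_itv_sub|].
    by case/integrableP: gi.
  - by move=> n x _; rewrite lee_fin.
have maxi (k0 : R -> R) : (forall x, `|k0 x| <= `|f x|) -> measurable_fun I k0 -> mu.-integrable I (EFin \o k0).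
  move=> c0f mc; apply: (le_integrable (@measurable_I1 R) _ _ fi).
    exact/measurable_EFinP.
  by move=> x _ /=; rewrite lee_fin.
have ip : mu.-integrable I (EFin \o (fun x => Num.max (f x) 0)).
  apply: maxi; last exact: measurable_maxr.
  by move=> x; have [_|_] := leP (f x) 0; rewrite ?normr0.
have im : mu.-integrable I (EFin \o (fun x => Num.max (- f x) 0)).
  apply: maxi; last by apply: measurable_maxr => //; exact: measurableT_comp.
  by move=> x; have [_|_] := leP (- f x) 0; rewrite ?normr0 ?normrN.
have fE x : f x = Num.max (f x) 0 - Num.max (- f x) 0.
  by have [h|h] := leP (f x) 0; have [h'|h'] := leP (- f x) 0; lra.
have -> : (fun n => \int[mu]_(x in inner_itv n) f x) =
    (fun n => \int[mu]_(x in inner_itv n) Num.max (f x) 0 - \int[mu]_(x in inner_itv n) Num.max (- f x) 0).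
  apply/funext => n; rewrite -RintegralB//.
  - by apply: eq_Rintegral => x _; exact: fE.
  - by apply: integrableS ip => //; [exact: measurable_I1|exact: inner_itv_sub].
  - by apply: integrableS im => //; [exact: measurable_I1|exact: inner_itv_sub].
have -> : \int[mu]_(x in I) f x = \int[mu]_(x in I) Num.max (f x) 0 - \int[mu]_(x in I) Num.max (- f x) 0.
  by rewrite -RintegralB//; [apply: eq_Rintegral => x _; exact: fE|exact: measurable_I1].
by apply: cvgB; apply: pos => // x; rewrite le_max lexx orbT.
Qed.

Lemma loc_abs_cont_ae_derivable u : loc_abs_cont I u ->
  {ae mu, forall x, I x -> derivable u x 1}.
Proof.
move=> lu.
have H n : {ae mu, forall x, -1 + n.+2%:R^-1 < x < 1 - n.+2%:R^-1 -> derivable u x 1}.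
  have [a1 ab b1] := inner_itv_bounds n.
  have [g [_ _ gu]] := abs_cont_FTC ab (loc_abs_cont_I1 lu a1 (ltW ab) b1).
  by apply: filterS gu => x h /h[].
have := ae_foralln H; apply: filterS => x h /inner_itv_interior[n]; exact: h.
Qed.

Lemma abs_cont_derive_int a b u f : a < b -> abs_cont a b u ->
  measurable_fun `[a, b]%classic f ->
  {ae mu, forall x, a < x < b -> f x = u^`()%classic x} ->
  mu.-integrable `[a, b]%classic (EFin \o f) /\ u b - u a = \int[mu]_(x in `[a, b]) f x.
Proof.
move=> ab acu mf fu; have [g [gi gE gu]] := abs_cont_FTC ab acu.
have mab : measurable (`[a, b]%classic : set (measurableTypeR R)) by exact: measurable_itv.
have gi' : mu.-integrable `[a, b]%classic (EFin \o g) by exact: integrableS gi.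
have fg : {ae mu, forall x, `[a, b]%classic x -> f x = g x}.
  apply: filterS2 (filterI fu gu) (filterI (ae_neq a) (ae_neq b)) => x [h1 h2] [xa xb].
  rewrite /= in_itv/= => /andP[ax xb'].
  have axb : a < x < b by rewrite !lt_neqAle ax xb' eq_sym xa xb.
  by rewrite h1// (h2 axb).2.
split.
  apply/integrableP; split; first exact/measurable_EFinP.
  have -> : (\int[mu]_(x in `[a, b]) `|(EFin \o f) x|)%E = (\int[mu]_(x in `[a, b]) `|(EFin \o g) x|)%E.
    apply: ae_eq_integral => //.
    - by apply: measurableT_comp => //; exact/measurable_EFinP.
    - by apply: measurableT_comp => //; case/integrableP: gi'.
    - by apply: filterS fg => x h /h /= ->.
  by case/integrableP: gi'.
rewrite gE ?lexx ?ltW//; apply: ae_eq_Rintegral => //.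
- by apply/measurable_EFinP; case/integrableP: gi'.
- by apply: filterS fg => x h /h ->.
Qed.

(** By the fundamental theorem, [u] differs locally from a primitive of its
    derivative by a constant, and that primitive is continuously
    differentiable. *)
Lemma loc_abs_cont_C1 u : loc_abs_cont I u ->
  (forall x, I x -> {for x, continuous u^`()%classic}) ->
  forall x, I x -> derivable u x 1.
Proof.
move=> lu cu' x Ix; have [a [b [a1 ax xb b1]]] := I1_inner Ix.
have ab := lt_trans ax xb.
have ab_I z : a <= z -> z <= b -> I z.
  by move=> az zb; apply: (@subset_itvcc_I1 a b) => //=; rewrite in_itv/= az.
have int_u' c : mu.-integrable `[a, b]%classic (EFin \o u^`()%classic).
  by apply: continuous_integrable_itv => z; rewrite in_itv/= => /andP[az zb]; exact/cu'/ab_I.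
have [dF _] := continuous_FTC1_closed xb (int_u' 0) ax (cu' _ Ix).
have nearF : \forall z \near x, \int[mu]_(t in `[a, z]) u^`()%classic t + u a = u z.
  near=> z.
  have : z \in `]a, b[ by near: z; apply: near_in_itvoo; rewrite in_itv/= ax.
  rewrite in_itv/= => /andP[az zb].
  have [|//||_ <-] := @abs_cont_derive_int a z u u^`()%classic az.
  - by apply: loc_abs_cont_I1 => //; [exact: ltW|exact: lt_trans b1].
  - apply: (@measurable_funS _ _ _ _ `[a, b]%classic); first exact: measurable_itv.
      by move=> t /=; rewrite !in_itv/= => /andP[-> /le_trans]; apply; exact: ltW.
    by apply/measurable_EFinP; case/integrableP: (int_u' 0).
  - by apply/aeW.
  - by rewrite subrK.
apply: (near_eq_derivable nearF).
have dua : derivable (cst (u a) : R -> R) x 1 by exact: derivable_cst.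
exact: (derivableD dF dua).
Unshelve. all: by end_near. Qed.

Lemma rho_gt0 x : I x -> 0 < rho x.
Proof. by move=> /I1_bounds/andP[? ?]; rewrite /rho; nra. Qed.

(** The function rho u' is absolutely continuous, hence continuous, and rho
    does not vanish on I. *)
Lemma domA_C1 u : domA u -> forall x, I x -> derivable u x 1 /\ {for x, continuous u^`()%classic}.
Proof.
move=> [_ lu [[_ lv _] _ _]].
have cu' x : I x -> {for x, continuous u^`()%classic}.
  move=> Ix; have cv := loc_abs_cont_continuous lv Ix.
  have crho : {for x, continuous (@rho R)}.
    by rewrite /rho; apply: cvgB; [exact: cvg_cst|apply: (@exprn_continuous R 2)].
  have rx : rho x != 0 by rewrite gt_eqF// rho_gt0.
  have gE z : I z -> rho_deriv u z * (rho z)^-1 = u^`()%classic z.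
    by move=> Iz; rewrite /rho_deriv mulrAC divff ?mul1r// gt_eqF// rho_gt0.
  have c : {for x, continuous (fun z => rho_deriv u z * (rho z)^-1)}.
    by apply: continuousM => //; apply: continuousV.
  rewrite /prop_for /continuous_at -gE//; apply: cvg_trans c.
  apply: near_eq_cvg; near=> z; apply: gE.
  by near: z; apply: near_in_itvoo; exact: Ix.
move=> x Ix; split; last exact: cu'.
exact: loc_abs_cont_C1.
Unshelve. all: by end_near. Qed.

Lemma C1_abs_cont a b f : a <= b ->
  (forall x, a <= x <= b -> derivable f x 1) ->
  (forall x, a <= x <= b -> {for x, continuous f^`()%classic}) ->
  abs_cont a b f.
Proof.
move=> ab df cf'.
have cnf' : {within `[a, b], continuous (fun x => `|f^`()%classic x|)}.
  apply: continuous_in_subspaceT => x; rewrite inE /= in_itv/= => xab.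
  by apply: (@continuous_comp _ _ _ f^`()%classic); [exact: cf'|exact: norm_continuous].
have [c _ fc] := EVT_max ab cnf'.
apply: (@lipschitz_abs_cont _ _ _ _ `|f^`()%classic c|) => x y ax xy yb.
move: xy; rewrite le_eqVlt => /predU1P[<-|xy]; first by rewrite !subrr normr0 mulr0.
have inab z : x <= z -> z <= y -> a <= z <= b.
  by move=> xz zy; rewrite (le_trans ax xz) (le_trans zy yb).
have [z zxy ->] : exists2 z, z \in `]x, y[ & f y - f x = f^`()%classic z * (y - x).
  apply: MVT => // [z|].
    rewrite in_itv/= => /andP[xz zy]; rewrite derive1E.
    by apply: DeriveDef => //; apply: df; apply: inab; exact: ltW.
  apply: derivable_within_continuous => z; rewrite in_itv/= => /andP[xz zy].
  by apply: df; exact: inab.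
have yx0 : 0 < y - x by rewrite subr_gt0.
rewrite normrM (gtr0_norm yx0) (ler_pM2r yx0).
by apply: fc; move: zxy; rewrite !in_itv/= => /andP[xz zy]; apply: inab; exact: ltW.
Qed.

End integrals.

(** * A smooth positive part *)

Section smooth_positive_part.
Context {R : realType}.
Implicit Types (s t eta : R).

(** A smooth approximation of the absolute value of [s]. *)
Definition hyp eta s : R := Num.sqrt (s ^+ 2 + eta ^+ 2).

(** A smooth convex approximation of the positive part, and its derivative. *)
Definition smooth_pos eta s : R := (s + hyp eta s) / 2.
Definition smooth_step eta s : R := (1 + s / hyp eta s) / 2.

Lemma hyp_gt0 eta s : 0 < eta -> 0 < hyp eta s.
Proof. by move=> e0; rewrite sqrtr_gt0 ltr_wpDl ?sqr_ge0// exprn_gt0. Qed.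

Lemma hyp_sqr eta s : hyp eta s ^+ 2 = s ^+ 2 + eta ^+ 2.
Proof. by rewrite sqr_sqrtr// addr_ge0 ?sqr_ge0. Qed.

Lemma le_norm_hyp eta s : `|s| <= hyp eta s.
Proof. by rewrite -sqrtr_sqr ler_wsqrtr// lerDl sqr_ge0. Qed.

Lemma hyp_le eta s : 0 < eta -> hyp eta s <= `|s| + eta.
Proof.
move=> e0; have p : 0 <= `|s| + eta by rewrite addr_ge0// ltW.
rewrite -[leRHS]ger0_norm// -sqrtr_sqr ler_wsqrtr//.
rewrite -[s ^+ 2]real_normK ?num_real// sqrrD lerD2r lerDl.
by rewrite mulrn_wge0// mulr_ge0// ltW.
Qed.

Lemma pos_le_smooth eta s : Num.max s 0 <= smooth_pos eta s.
Proof.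
have := le_norm_hyp eta s; have := ler_norm s; have := ler_norm (- s); rewrite normrN => h1 h2 h3.
by rewrite ge_max /smooth_pos; apply/andP; split; lra.
Qed.

Lemma smooth_le_pos eta s : 0 < eta -> smooth_pos eta s <= Num.max s 0 + eta.
Proof.
move=> e0; have := hyp_le s e0; rewrite /smooth_pos.
by have [s0|s0] := leP s 0; [rewrite ler0_norm//|rewrite gtr0_norm//]; lra.
Qed.

(** Convexity is the Cauchy-Schwarz inequality for the plane vectors (s, eta)
    and (t, eta). *)
Lemma smooth_pos_convex eta s t : 0 < eta ->
  smooth_pos eta s <= smooth_pos eta t + smooth_step eta s * (s - t).
Proof.
move=> e0; have r0 := hyp_gt0 s e0; have q0 := hyp_gt0 t e0.
have r2 := hyp_sqr eta s; have q2 := hyp_sqr eta t.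
have cs : s * t + eta ^+ 2 <= hyp eta s * hyp eta t.
  have [n0|p0] := leP (s * t + eta ^+ 2) 0; first by rewrite (le_trans n0)// mulr_ge0// ltW.
  have qr0 : 0 <= hyp eta s * hyp eta t by rewrite mulr_ge0// ltW.
  rewrite -(ler_pXn2r (n := 2))// ?nnegrE; [|exact: ltW].
  rewrite exprMn r2 q2.
  by have := sqr_ge0 (s * eta - t * eta); lra.
rewrite /smooth_pos /smooth_step.
suff : hyp eta s <= hyp eta t + s / hyp eta s * (s - t) by lra.
rewrite -(ler_pM2l r0) mulrDr mulrA [hyp eta s * (s / _)]mulrC divfK ?gt_eqF//.
by rewrite -expr2 r2; lra.
Qed.

Lemma smooth_step_bounds eta s : 0 < eta -> 0 <= smooth_step eta s <= 1.
Proof.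
move=> e0; have r0 := hyp_gt0 s e0.
have := le_norm_hyp eta s; rewrite ler_norml => /andP[h1 h2].
have : -1 <= s / hyp eta s by rewrite ler_pdivlMr// mulN1r.
have : s / hyp eta s <= 1 by rewrite ler_pdivrMr// mul1r.
by rewrite /smooth_step => ? ?; apply/andP; split; lra.
Qed.

Definition smooth_bump eta s : R := eta ^+ 2 / hyp eta s ^+ 3 / 2.

Lemma smooth_bump_ge0 eta s : 0 < eta -> 0 <= smooth_bump eta s.
Proof.
by move=> e0; rewrite /smooth_bump !divr_ge0 ?sqr_ge0// exprn_ge0// sqrtr_ge0.
Qed.

Lemma is_derive_hyp eta s : 0 < eta -> is_derive s 1 (hyp eta) (s / hyp eta s).
Proof.
move=> e0; have p : 0 < s ^+ 2 + eta ^+ 2 by rewrite ltr_wpDl ?sqr_ge0// exprn_gt0.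
have d1 := is_derive1_sqrt p.
have d2 : is_derive s 1 (fun s => s ^+ 2 + eta ^+ 2) (2 * s).
  by apply: is_derive_eq; rewrite addr0 /= /GRing.scale /=; ring.
have := @is_derive1_comp _ Num.sqrt (fun s => s ^+ 2 + eta ^+ 2) s _ _ d1 d2.
rewrite /= -/(hyp eta s) => d3; rewrite (_ : s / _ = (2 * hyp eta s)^-1 * (2 * s))//.
by have h0 := gt_eqF (hyp_gt0 s e0); field; rewrite h0.
Qed.

Lemma is_derive_smooth_step eta s : 0 < eta ->
  is_derive s 1 (smooth_step eta) (smooth_bump eta s).
Proof.
move=> e0; have h0 : hyp eta s != 0 by rewrite gt_eqF// hyp_gt0.
have d1 := is_derive_hyp s e0.
have d2 : is_derive s 1 (fun s => (1 + s * (hyp eta s)^-1) * 2^-1) (smooth_bump eta s).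
  have d3 := is_deriveV h0 d1.
  apply: is_derive_eq.
  have e2 : eta ^+ 2 = hyp eta s ^+ 2 - s ^+ 2 by rewrite hyp_sqr addrC addKr.
  rewrite /smooth_bump e2 /GRing.scale/=; move: (hyp eta s) h0 => r r0.
  by field.
exact: d2.
Qed.

Lemma continuous_hyp eta : 0 < eta -> continuous (hyp eta).
Proof.
move=> e0 s; apply: differentiable_continuous; apply/derivable1_diffP.
by have [] := is_derive_hyp s e0.
Qed.

Lemma continuous_smooth_bump eta : 0 < eta -> continuous (smooth_bump eta).
Proof.
move=> e0 s; apply: cvgM; last exact: cvg_cst.
apply: cvgM; first exact: cvg_cst.
apply: cvgV; first by rewrite expf_neq0// gt_eqF// hyp_gt0.
have h := continuous_hyp e0 (x := s).
by rewrite exprS expr2; under eq_cvg do rewrite exprS expr2; apply: cvgM => //; apply: cvgM.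
Qed.

Lemma continuous_smooth_pos eta : 0 < eta -> continuous (smooth_pos eta).
Proof.
move=> e0 s; apply: cvgM; last exact: cvg_cst.
by apply: cvgD; [exact: cvg_id|exact: continuous_hyp].
Qed.

Lemma continuous_smooth_step eta : 0 < eta -> continuous (smooth_step eta).
Proof.
move=> e0 s; apply: differentiable_continuous; apply/derivable1_diffP.
by have [] := is_derive_smooth_step s e0.
Qed.

End smooth_positive_part.

(** * Dispersivity of A *)

Section dispersivity.
Context {R : realType}.
Notation mu := (@lebesgue_measure R).
Notation I := (@I1 R).
Notation L2 := (Lp 2%:E I).
Implicit Types (f g u v w : R -> R) (a b x y h c e eta : R).

Let mI : measurable (I : set (measurableTypeR R)) := @measurable_I1 R.

Lemma domA_L2 u : domA u -> L2 u /\ L2 (opA u).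
Proof. by move=> [L2u _ [[_ _ L2v] _ _]]. Qed.

Lemma integrable_dominated f g : mu.-integrable I (EFin \o g) -> measurable_fun I f ->
  (forall x, I x -> `|f x| <= `|g x|) -> mu.-integrable I (EFin \o f).
Proof.
move=> ig mf fg; apply: (le_integrable mI _ _ ig); first exact/measurable_EFinP.
by move=> x Ix /=; rewrite lee_fin fg.
Qed.

(** Integration by parts on a compact subinterval: the term in which the step
    function is differentiated is rho (u')^2 times a non-negative factor. *)
Lemma int_step_opA_le u c eta a b : domA u -> 0 < eta ->
  -1 < a -> a < b -> b < 1 ->
  \int[mu]_(x in `[a, b]) (smooth_step eta (u x - c) * opA u x) <=
  `|rho_deriv u a| + `|rho_deriv u b|.
Proof.
move=> Du eta0 a1 ab b1.
have [_ L2Au] := domA_L2 Du.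
have [_ lu [[_ lv _] _ _]] := Du.
pose k x := smooth_step eta (u x - c).
have ab_I x : a <= x <= b -> I x.
  by move=> xab; apply: (@subset_itvcc_I1 _ a b) => //=; rewrite in_itv.
have dk x : I x -> is_derive x 1 k (smooth_bump eta (u x - c) * u^`()%classic x).
  move=> Ix; have [du _] := domA_C1 Du Ix.
  have d1 : is_derive x 1 (fun x => u x - c) (u^`()%classic x).
    have d0 : is_derive x 1 u (u^`()%classic x) by rewrite derive1E; exact: DeriveDef.
    by apply: is_derive_eq; rewrite subr0.
  exact: (@is_derive1_comp _ (smooth_step eta) (fun x => u x - c) x _ _ (is_derive_smooth_step _ eta0) d1).
have k'E x : I x -> k^`()%classic x = smooth_bump eta (u x - c) * u^`()%classic x.
  by move=> Ix; rewrite derive1E; have [_ ->] := dk x Ix.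
have cu x : I x -> {for x, continuous u} by exact: loc_abs_cont_continuous.
have ack : abs_cont a b k.
  apply: C1_abs_cont; first exact: ltW.
    by move=> x /ab_I Ix; have [] := dk x Ix.
  move=> x /ab_I Ix; rewrite /prop_for /continuous_at k'E//.
  have c1 : {for x, continuous (fun x => smooth_bump eta (u x - c) * u^`()%classic x)}.
    apply: cvgM; last by have [_] := domA_C1 Du Ix.
    apply: (@continuous_comp _ _ _ (fun x => u x - c) (smooth_bump eta)).
      by apply: cvgB; [exact: cu|exact: cvg_cst].
    exact: continuous_smooth_bump.
  apply: cvg_trans c1; apply: near_eq_cvg; near=> z; rewrite k'E//.
  by near: z; apply: near_in_itvoo; exact: Ix.
have acv : abs_cont a b (rho_deriv u) by apply: loc_abs_cont_I1 => //; exact: ltW.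
have ackv := abs_contM (ltW ab) ack acv.
have [g [gi gE gu]] := abs_cont_FTC ab ackv.
have mab : measurable (`[a, b]%classic : set (measurableTypeR R)) by exact: measurable_itv.
have sub : `[a, b]%classic `<=` I by exact: subset_itvcc_I1.
have k01 x : 0 <= k x <= 1 := smooth_step_bounds _ eta0.
have ck x : I x -> {for x, continuous k}.
  move=> Ix; apply: differentiable_continuous; apply/derivable1_diffP.
  by have [] := dk x Ix.
have mk : measurable_fun I k by exact: continuous_measurable_I1.
have ikA : mu.-integrable I (EFin \o (fun x => k x * opA u x)).
  apply: (integrable_dominated (L2_integrable L2Au)).
    by apply: measurable_funM => //; exact: L2_measurable.
  move=> x _; rewrite normrM; have /andP[k0 k1] := k01 x.
  by rewrite (ger0_norm k0) ler_piMl.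
apply: (@le_trans _ _ (\int[mu]_(x in `[a, b]) g x)).
  apply: ae_le_Rintegral => //.
  - by apply: integrableS ikA.
  - by apply: integrableS gi.
  have vd := loc_abs_cont_ae_derivable lv.
  apply: filterS2 (filterI vd gu) (filterI (ae_neq a) (ae_neq b)) => x [h1 h2] [xa xb].
  rewrite /= in_itv/= => xab; have Ix := ab_I x xab.
  have axb : a < x < b.
    by move: xab => /andP[ax xb']; rewrite !lt_neqAle ax xb' eq_sym xa xb.
  have [_ <-] := h2 axb; have dkx := dk x Ix.
  have dvx : is_derive x 1 (rho_deriv u) (opA u x).
    by rewrite /opA derive1E; apply: DeriveDef => //; exact: h1.
  have -> : (k \* rho_deriv u)^`()%classic x =
      k x * opA u x + rho_deriv u x * (smooth_bump eta (u x - c) * u^`()%classic x).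
    have [_ e] := is_deriveM dkx dvx.
    by rewrite derive1E; exact: e.
  rewrite lerDl /rho_deriv mulrACA mulr_ge0//.
    by rewrite mulr_ge0 ?smooth_bump_ge0// ltW// rho_gt0.
  by rewrite -expr2 sqr_ge0.
rewrite -gE ?lexx//=; last exact: ltW.
have /andP[ka0 ka1] := k01 a; have /andP[kb0 kb1] := k01 b.
apply: le_trans (ler_norm _) _; apply: le_trans (ler_normB _ _) _; rewrite addrC.
rewrite (normrM (k a)) (normrM (k b)).
by rewrite (ger0_norm ka0) (ger0_norm kb0) lerD// ler_piMl.
Unshelve. all: by end_near. Qed.

Lemma inner_endpoints_cvg (v : R -> R) : v x @[x --> (-1)^'+] --> (0 : R) ->
  v x @[x --> 1^'-] --> (0 : R) ->
  `|v (-1 + n.+2%:R^-1)| + `|v (1 - n.+2%:R^-1)| @[n --> \oo] --> (0 : R).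
Proof.
move=> vl vr.
have c0 : (n.+2%:R^-1 : R) @[n --> \oo] --> (0 : R).
  by have := @cvg_harmonic R; rewrite -(cvg_shiftS (@harmonic R)).
rewrite -[X in _ --> X](addr0 0) -(@normr0 _ R); apply: cvgD; apply: cvg_norm.
- move/cvg_at_rightP : vl => /(_ (fun n => -1 + n.+2%:R^-1)); apply.
  split=> [n|]; first by have [] := @inner_itv_bounds R n.
  by rewrite -[X in _ --> X](addr0 (-1)); apply: cvgD => //; exact: cvg_cst.
- move/cvg_at_leftP : vr => /(_ (fun n => 1 - n.+2%:R^-1)); apply.
  split=> [n|]; first by have [] := @inner_itv_bounds R n.
  by rewrite -[X in _ --> X](subr0 1); apply: cvgB => //; exact: cvg_cst.
Qed.

(** The boundary terms of int_step_opA_le vanish in the limit, because rho u'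
    tends to 0 at -1 and at 1. *)
Lemma int_step_opA_le0 u c eta : domA u -> 0 < eta ->
  mu.-integrable I (EFin \o (fun x => smooth_step eta (u x - c) * opA u x)) ->
  \int[mu]_(x in I) (smooth_step eta (u x - c) * opA u x) <= 0.
Proof.
move=> Du eta0 /Rintegral_inner_cvg icvg.
have [_ _ [_ vl vr]] := Du.
apply: ler_cvg_to icvg (inner_endpoints_cvg vl vr) _; apply: nearW => n.
by have [a1 ab b1] := @inner_itv_bounds R n; exact: int_step_opA_le.
Qed.

(** Dispersivity of A in resolvent form. By convexity, the positive part of u
    - c exceeds that of u - c - h A u at most by h times the product of A u
    with a step function of u - c, up to smoothing, and this product has a
    non-positive integral. The case c = 0 makes the semigroup order
    preserving, the other constants give a maximum principle. *)
Lemma domA_resolvent_posint u c h : domA u -> 0 <= h ->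
  posint (u - cst c) <= posint (u - cst c - h *: opA u).
Proof.
move=> Du h0; have [L2u L2Au] := domA_L2 Du.
apply/ler_addgt0Pr => e e0; have e20 : 0 < e / 2 by rewrite divr_gt0.
pose f := u - cst c; pose g := f - h *: opA u.
have L2f : L2 f by apply: L2B => //; exact: L2_cst.
have L2g : L2 g by apply: L2B => //; exact: L2Z.
have mps u' : L2 u' -> measurable_fun I (fun x => smooth_pos (e / 2) (u' x)).
  move=> L2u'; apply: measurableT_comp; last exact: L2_measurable.
  by apply: continuous_measurable_fun; exact: continuous_smooth_pos.
have ips u' : L2 u' -> mu.-integrable I (EFin \o (fun x => smooth_pos (e / 2) (u' x))).
  move=> L2u'; have := integrableD mI (L2_integrable (L2_pos L2u')) (integrable_cst_I1 (e / 2)).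
  move=> i; apply: (le_integrable mI _ _ i); first by apply/measurable_EFinP; exact: mps.
  move=> x _ /=; rewrite lee_fin !ger0_norm; [exact: smooth_le_pos| |].
    by rewrite addr_ge0 ?le_max ?lexx ?orbT// ltW.
  by apply: le_trans (pos_le_smooth _ _); rewrite le_max lexx orbT.
have mk : measurable_fun I (fun x => smooth_step (e / 2) (u x - c)).
  apply: measurableT_comp; last by apply: measurable_funB => //; exact: L2_measurable.
  by apply: continuous_measurable_fun; exact: continuous_smooth_step.
have ikA : mu.-integrable I (EFin \o (fun x => smooth_step (e / 2) (u x - c) * opA u x)).
  apply: (integrable_dominated (L2_integrable L2Au)).
    by apply: measurable_funM => //; exact: L2_measurable.
  move=> x _; rewrite normrM; have /andP[k0 k1] := smooth_step_bounds (u x - c) e20.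
  by rewrite (ger0_norm k0) ler_piMl.
apply: (@le_trans _ _ (\int[mu]_(x in I) smooth_pos (e / 2) (f x))).
  apply: le_Rintegral => //; [exact/L2_integrable/L2_pos|exact: ips|].
  by move=> x _; exact: pos_le_smooth.
apply: (@le_trans _ _ (\int[mu]_(x in I) smooth_pos (e / 2) (g x))).
  have ih : mu.-integrable I (EFin \o (fun x => h * (smooth_step (e / 2) (u x - c) * opA u x))).
    by have := integrableZl mI h ikA; apply: eq_integrable.
  apply: (@le_trans _ _ (\int[mu]_(x in I) (smooth_pos (e / 2) (g x) +
      h * (smooth_step (e / 2) (u x - c) * opA u x)))).
    apply: le_Rintegral => //; first exact: ips.
      by have := integrableD mI (ips g L2g) ih; apply: eq_integrable.
    move=> x _; apply: le_trans (smooth_pos_convex _ (g x) e20) _; rewrite lerD2l.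
    have -> : f x = u x - c by [].
    have -> : g x = u x - c - h * opA u x by [].
    by rewrite subKr mulrCA.
  rewrite RintegralD//; last exact: ips.
  by rewrite RintegralZl// gerDl mulr_ge0_le0//; exact: int_step_opA_le0.
apply: (@le_trans _ _ (\int[mu]_(x in I) (Num.max (g x) 0 + e / 2))).
  apply: le_Rintegral => //; first exact: ips.
    have := integrableD mI (L2_integrable (L2_pos L2g)) (integrable_cst_I1 (e / 2)).
    by apply: eq_integrable.
  by move=> x _; exact: smooth_le_pos.
rewrite RintegralD//; [|exact/L2_integrable/L2_pos|exact: integrable_cst_I1].
rewrite lerD2l Rintegral_cst//.
have -> : fine (mu I) = 2 by rewrite lebesgue_I1.
by rewrite divfK.
Qed.

End dispersivity.

(** * Pointwise bounds in the energy space V *)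

Section embedding.
Context {R : realType}.
Notation mu := (@lebesgue_measure R).
Notation I := (@I1 R).
Notation L2 := (@Lp R 2%:E I).
Implicit Types (f g u v w : R -> R) (a b x y h c e : R).

Lemma derive_integral u f a b : (forall x, I x -> is_derive x 1 u (f x)) ->
  (forall x, I x -> {for x, continuous f}) -> -1 < a -> a < b -> b < 1 ->
  mu.-integrable `[a, b]%classic (EFin \o f) /\ u b - u a = \int[mu]_(x in `[a, b]) f x.
Proof.
move=> du cf a1 ab b1.
have abI x : a <= x <= b -> I x.
  by move=> axb; apply: (@subset_itvcc_I1 _ a b) => //=; rewrite in_itv.
have dE x : I x -> u^`()%classic x = f x.
  by move=> Ix; rewrite derive1E; have /@derive_val := du _ Ix.
apply: abs_cont_derive_int => //.
- apply: C1_abs_cont; [exact: ltW|by move=> x /abI/du/@ex_derive|].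
  move=> x /abI Ix; rewrite /prop_for /continuous_at dE//.
  apply: cvg_trans (cf _ Ix); apply: near_eq_cvg; near=> z; rewrite dE//.
  by near: z; apply: near_in_itvoo; exact: Ix.
- apply: (@measurable_funS _ _ _ _ I); [exact: measurable_I1|exact: subset_itvcc_I1|].
  exact: continuous_measurable_I1.
- by apply: aeW => x /andP[ax xb]; rewrite dE//; apply: abI; rewrite !ltW.
Unshelve. all: by end_near. Qed.

Lemma continuous_rho : continuous (@rho R).
Proof.
by move=> x; apply: cvgB; [exact: cvg_cst|apply: (@exprn_continuous R 2)].
Qed.

(** A primitive of 1 / rho. *)
Definition theta x : R := (ln (1 + x) - ln (1 - x)) / 2.

Lemma is_derive_theta x : I x -> is_derive x 1 theta (rho x)^-1.
Proof.
move=> /[dup] /rho_gt0 r0 /I1_bounds /andP[x1 x2].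
have p0 : 0 < 1 + x by lra.
have m0 : 0 < 1 - x by lra.
have dp : is_derive x 1 (fun x => ln (1 + x)) (1 + x)^-1.
  have d1 : is_derive x 1 (fun x : R => 1 + x) 1.
    by have := is_deriveD (is_derive_cst (1 : R) x 1) (is_derive_id x (1 : R)); rewrite add0r.
  have d2 := is_derive1_ln p0.
  by have := @is_derive1_comp _ _ _ _ _ _ d2 d1; rewrite mulr1.
have dm : is_derive x 1 (fun x => ln (1 - x)) (- (1 - x)^-1).
  have d1 : is_derive x 1 (fun x : R => 1 - x) (-1).
    by have := is_deriveB (is_derive_cst (1 : R) x 1) (is_derive_id x (1 : R)); rewrite sub0r.
  have d2 := is_derive1_ln m0.
  by have := @is_derive1_comp _ (@ln R) (fun x => 1 - x) x _ _ d2 d1; rewrite mulrN1.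
rewrite /theta.
rewrite (_ : (fun x => _) = (2^-1 \*: (fun x => ln (1 + x) - ln (1 - x)))); last first.
  by apply/funext => z; rewrite /= mulrC.
apply: is_derive_eq; rewrite /rho /GRing.scale /=; field.
by apply/and3P; split; rewrite gt_eqF//; nra.
Qed.

(** The power -1/16 of rho. It dominates theta up to a factor, and its eighth
    power is the derivative of the arcsine. *)
Definition weight x : R := expR (- ln (rho x) / 16).

Lemma weight_ge1 x : I x -> 1 <= weight x.
Proof.
move=> /[dup] /rho_gt0 r0 _; rewrite -expR0 ler_expR.
have : ln (rho x) <= 0 by rewrite ln_le0// /rho gerBl sqr_ge0.
lra.
Qed.

Lemma weight_ge0 x : 0 <= weight x. Proof. exact: expR_ge0. Qed.

Lemma continuous_weight x : I x -> {for x, continuous weight}.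
Proof.
move=> Ix; rewrite /weight.
apply: (@continuous_comp _ _ _ (fun x => - ln (rho x) / 16)); last exact: continuous_expR.
apply: continuousM; last exact: cst_continuous.
apply: (@continuousN _ R); apply: (@continuous_comp _ _ _ (@rho R)); first exact: continuous_rho.
exact/continuous_ln/rho_gt0.
Qed.

Lemma theta_le_weight x : I x -> 1 + `|theta x| <= 10 * weight x.
Proof.
move=> /[dup] Ix /I1_bounds /andP[x1 x2].
have hp : ln (1 + x) <= x by exact: le_ln1Dx.
have hm : ln (1 - x) <= - x by apply: le_ln1Dx; lra.
have lr : ln (rho x) = ln (1 + x) + ln (1 - x).
  by rewrite -lnM ?posrE; [congr ln; rewrite /rho; ring|lra|lra].
have := expR_ge1Dx (- ln (rho x) / 16).
have := weight_ge1 Ix; rewrite -/(weight x).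
rewrite lr /theta => h1 h2; rewrite -lerBrDl ler_norml; apply/andP; split; lra.
Qed.

Lemma weight_sqrt x : I x -> weight x ^+ 8 = (Num.sqrt (rho x))^-1.
Proof.
move=> /rho_gt0 r0; rewrite -expRM_natl; set s := Num.sqrt _.
have s0 : 0 < s by rewrite sqrtr_gt0.
have -> : rho x = s ^+ 2 by rewrite sqr_sqrtr// ltW.
by rewrite lnXn// -[RHS]lnK ?posrE ?invr_gt0// lnV ?posrE//; congr expR; field.
Qed.

(** The arcsine is bounded. *)
Lemma weight_integrable : mu.-integrable I (EFin \o (fun x => weight x ^+ 8)).
Proof.
have mw : measurable_fun I (fun x => weight x ^+ 8).
  have mw0 : measurable_fun I weight.
    by apply: continuous_measurable_I1 => x; exact: continuous_weight.
  by apply/measurable_EFinP/measurable_EFinP; exact: measurable_funX.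
apply/integrableP; split; first exact/measurable_EFinP.
rewrite -bigcup_inner_itv.
have : (\int[mu]_(x in @inner_itv R n) `|(weight x ^+ 8)%:E|)%E @[n --> \oo] -->
    (\int[mu]_(x in \bigcup_n @inner_itv R n) `|(weight x ^+ 8)%:E|)%E.
  apply: ge0_nondecreasing_set_cvg_integral => //; first exact: inner_itv_nd.
  - by move=> n; exact: measurable_itv.
  - move=> n; apply: (@measurable_funS _ _ _ _ I); [exact: measurable_I1|exact: inner_itv_sub|].
    by apply: measurableT_comp => //; exact/measurable_EFinP.
move=> h; rewrite -(cvg_lim _ h)//; apply: (@le_lt_trans _ _ pi%:E); last exact: ltry.
apply: lime_le; first by apply/cvg_ex; eexists; exact: h.
apply: nearW => n; have [a1 ab b1] := @inner_itv_bounds R n.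
have da x : I x -> is_derive x 1 (@asin R) (Num.sqrt (rho x))^-1.
  by move=> /I1_bounds; exact: is_derive1_asin.
have cs x : I x -> {for x, continuous (fun x => (Num.sqrt (rho x))^-1)}.
  move=> Ix; apply: continuousV; first by rewrite gt_eqF// sqrtr_gt0 rho_gt0.
  by apply: (@continuous_comp _ _ _ (@rho R)); [exact: continuous_rho|exact: sqrt_continuous].
have [fi fE] := derive_integral da cs a1 ab b1.
under eq_integral => x /set_mem/inner_itv_sub Ix.
  rewrite abse_EFin ger0_norm ?exprn_ge0 ?weight_ge0// (weight_sqrt Ix); over.
rewrite -[leLHS]fineK; last by apply: integrable_fin_num => //; exact: measurable_itv.
rewrite lee_fin -[leLHS]fE.
have l1 : asin (1 - n.+2%:R^-1) <= pi / 2 :> R by apply: asin_lepi2; rewrite !ltW ?(lt_trans a1).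
have l2 : - (pi / 2) <= asin (-1 + n.+2%:R^-1) :> R by apply: asin_geNpi2; rewrite !ltW ?(lt_trans ab).
lra.
Qed.

Lemma L2_weight4 : L2 (fun x => weight x ^+ 4).
Proof.
have mw0 : measurable_fun I weight.
  by apply: continuous_measurable_I1 => x; exact: continuous_weight.
apply/L2P; split; first exact: measurable_funX.
by have := weight_integrable; apply: eq_integrable => [|x _]; [exact: measurable_I1|rewrite /= -exprM].
Qed.

Lemma weight_le4 x : I x -> weight x <= weight x ^+ 4.
Proof. by move=> /weight_ge1 ?; rewrite -[leLHS]expr1 ler_weXn2l. Qed.

Lemma L2_dominated f g : L2 g -> measurable_fun I f ->
  (forall x, I x -> `|f x| <= `|g x|) -> L2 f.
Proof.
move=> /L2P[mg ig] mf fg; apply/L2P; split => //.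
apply: (le_integrable (@measurable_I1 R) _ _ ig).
  by apply/measurable_EFinP/measurable_funX.
move=> x Ix /=; rewrite lee_fin !normrX lerXn2r ?nnegrE//; exact: fg.
Qed.

Lemma L2_weight : L2 weight.
Proof.
apply: (L2_dominated L2_weight4).
  by apply: continuous_measurable_I1 => x; exact: continuous_weight.
move=> x Ix; rewrite !ger0_norm ?exprn_ge0 ?weight_ge0//; exact: weight_le4.
Qed.

(** Integrate the inequality |u'| <= w^2 / N + N / rho, which holds because
    |u'| = |w| / sqrt rho. *)
Lemma energy_oscillation u w N x y : loc_abs_cont I u -> L2 w ->
  ae_eq mu I w (sqrt_rho_deriv u) -> normH w <= N -> 0 < N -> I x -> I y -> x <= y ->
  `|u y - u x| <= N * (1 + (theta y - theta x)).
Proof.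
move=> lu L2w wu wN N0 Ix Iy; rewrite le_eqVlt => /predU1P[->|xy].
  by rewrite !subrr normr0 addr0 mulr1 ltW.
have /andP[x1 _] := I1_bounds Ix; have /andP[_ y1] := I1_bounds Iy.
have xyI : `[x, y]%classic `<=` I by exact: subset_itvcc_I1.
have mxy : measurable (`[x, y]%classic : set (measurableTypeR R)) by exact: measurable_itv.
have crho z : I z -> {for z, continuous (fun z => (rho z)^-1)}.
  by move=> Iz; apply: continuousV; [rewrite gt_eqF// rho_gt0|exact: continuous_rho].
have [ir rE] := derive_integral is_derive_theta crho x1 xy y1.
have [mw iw2] := iffLR (L2P _) L2w.
have mrs : measurable_fun I (fun z => (Num.sqrt (rho z))^-1).
  apply: continuous_measurable_I1 => z Iz; apply: continuousV.
    by rewrite gt_eqF// sqrtr_gt0 rho_gt0.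
  by apply: (@continuous_comp _ _ _ (@rho R)); [exact: continuous_rho|exact: sqrt_continuous].
have mS f : measurable_fun I f -> measurable_fun `[x, y]%classic f.
  by apply: measurable_funS => //; exact: measurable_I1.
have mf : measurable_fun I (fun z => w z * (Num.sqrt (rho z))^-1) by exact: measurable_funM.
have acu : abs_cont x y u by apply: loc_abs_cont_I1 => //; exact: ltW.
have [|fi ->] := abs_cont_derive_int xy acu (mS _ mf).
  apply: filterS wu => z wz /andP[xz zy].
  have Iz : I z by apply: xyI; rewrite /= in_itv/= !ltW.
  rewrite wz// /sqrt_rho_deriv mulrAC divff ?mul1r// gt_eqF//.
  by rewrite sqrtr_gt0 rho_gt0.
have iwxy := integrableS (@measurable_I1 R) mxy xyI iw2.
have iw2' : mu.-integrable `[x, y]%classic (EFin \o (fun z => N^-1 * w z ^+ 2)).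
  by have /(integrableZl mxy N^-1) := iwxy; exact: eq_integrable.
have ir' : mu.-integrable `[x, y]%classic (EFin \o (fun z => N * (rho z)^-1)).
  by have /(integrableZl mxy N) := ir; exact: eq_integrable.
apply: (le_trans (le_normr_Rintegral mxy fi)).
apply: (@le_trans _ _ (\int[mu]_(z in `[x, y]) (N^-1 * w z ^+ 2 + N * (rho z)^-1))).
  apply: le_Rintegral => //.
  - exact: integrable_norm.
  - have := integrableD mxy iw2' ir'; exact: eq_integrable.
  move=> z /xyI/rho_gt0 r0; rewrite normrM normfV (ger0_norm (sqrtr_ge0 _)).
  rewrite -[rho z in leRHS](sqr_sqrtr (ltW r0)); set s := (Num.sqrt _).
  have s0 : 0 < s by rewrite sqrtr_gt0.
  rewrite -[w z ^+ 2]real_normK ?num_real//; set t := `|w z|.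
  have t0 : 0 <= t by exact: normr_ge0.
  (* The arithmetic-geometric mean inequality for |w| / sqrt N and sqrt N /
     sqrt rho. *)
  have e0 : 0 <= (t - N * s^-1) ^+ 2 / N by rewrite divr_ge0 ?sqr_ge0// ltW.
  have e1 : 0 <= t * s^-1 by rewrite mulr_ge0// invr_ge0 ltW.
  rewrite -subr_ge0; apply: le_trans (addr_ge0 e0 e1) _.
  by rewrite le_eqVlt; apply/orP; left; apply/eqP; field; rewrite !gt_eqF.
rewrite RintegralD// !RintegralZl// -?rE.
- rewrite [leRHS]mulrDr lerD2r ler_pdivrMl// ?mulr1.
  apply: (@le_trans _ _ (normH w ^+ 2)).
    rewrite normH_sqr; apply: fine_le.
    + exact: integrable_fin_num.
    + by apply: integrable_fin_num => //; exact: measurable_I1.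
    apply: ge0_subset_integral => //; first exact: measurable_I1.
      by case/integrableP: iw2.
    by move=> z _; rewrite lee_fin sqr_ge0.
  by rewrite expr2 ler_pM// normH_ge0.
Qed.

Lemma theta0 : theta 0 = 0.
Proof. by rewrite /theta addr0 subr0 subrr mul0r. Qed.

Lemma I1_0 : I 0.
Proof. by rewrite /I1 /= in_itv/= ltrN10 ltr01. Qed.

Lemma energy_oscillation0 u w N x : loc_abs_cont I u -> L2 w ->
  ae_eq mu I w (sqrt_rho_deriv u) -> normH w <= N -> 0 < N -> I x ->
  `|u x - u 0| <= 10 * N * weight x.
Proof.
move=> lu L2w wu wN N0 Ix; rewrite (mulrC 10) -mulrA.
apply: (@le_trans _ _ (N * (1 + `|theta x|))); last by rewrite ler_pM2l// theta_le_weight.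
have [x0|x0] := leP 0 x.
  apply: le_trans (energy_oscillation lu L2w wu wN N0 I1_0 Ix x0) _.
  by rewrite ler_pM2l// lerD2l theta0 subr0 ler_norm.
rewrite distrC; apply: le_trans (energy_oscillation lu L2w wu wN N0 Ix I1_0 (ltW x0)) _.
by rewrite ler_pM2l// lerD2l theta0 sub0r -normrN ler_norm.
Qed.

Lemma norm_le_normH_cst c : `|c| <= normH (cst c : R -> R).
Proof.
rewrite normHE (_ : \int[mu]_(x in I) _ = c ^+ 2 * 2); last first.
  transitivity (c ^+ 2 * fine (mu I)); last by rewrite lebesgue_I1.
  exact: (Rintegral_cst _ (@measurable_I1 R) (c ^+ 2)).
by rewrite -sqrtr_sqr ler_wsqrtr// ler_peMr ?sqr_ge0// ler1n.
Qed.

(** By energy_oscillation0, u is everywhere close to u 0, relative to the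
    weight; taking L^2 norms bounds u 0. *)
Lemma energy_bound : exists2 C : R, 0 <= C & forall u w, loc_abs_cont I u -> L2 u ->
  L2 w -> ae_eq mu I w (sqrt_rho_deriv u) ->
  forall x, I x -> `|u x| <= C * (normH u + normH w) * weight x.
Proof.
pose W := normH weight; have W0 : 0 <= W by exact: normH_ge0.
exists (10 * (W + 1)); first by rewrite mulr_ge0// addr_ge0.
move=> u w lu L2u L2w wu x Ix; apply/ler_addgt0Pr => e e0.
have wx0 : 0 < weight x by exact: expR_gt0.
pose d := e / (10 * (W + 1) * weight x).
have d0 : 0 < d by rewrite divr_gt0// !mulr_gt0// ltr_wpDl.
set N := normH w + d.
have wN : normH w <= N by rewrite lerDl ltW.
have N0 : 0 < N by rewrite ltr_wpDl// normH_ge0.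
have u0 : `|u 0| <= normH u + 10 * N * W.
  apply: (@le_trans _ _ (normH (cst (u 0)))).
    exact: norm_le_normH_cst.
  apply: (@le_trans _ _ (normH ((fun x => `|u x|) + (10 * N) *: weight))).
    apply: ae_le_normH; [exact: L2_cst| |].
      by apply: L2D; [exact: L2_norm|exact/L2Z/L2_weight].
    apply: aeW => z Iz /=; rewrite (_ : (_ + _) z = `|u z| + 10 * N * weight z)//.
    apply: le_trans (ler_norm _).
    have := energy_oscillation0 lu L2w wu wN N0 Iz.
    by have := lerB_dist (u 0) (u z); rewrite distrC; lra.
  apply: le_trans (normHD _ _) _; [exact: L2_norm|exact/L2Z/L2_weight|].
  rewrite normH_norm normHZ//; last exact: L2_weight.
  by rewrite gtr0_norm// mulr_gt0.
have h1 := energy_oscillation0 lu L2w wu wN N0 Ix.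
have h2 := lerB_dist (u x) (u 0).
have h3 : `|u x| <= (normH u + 10 * N * W) + 10 * N * weight x by lra.
apply: (le_trans h3).
have -> : 10 * (W + 1) * (normH u + normH w) * weight x + e = 10 * (W + 1) * (normH u + N) * weight x.
  by rewrite /N /d; field; rewrite !gt_eqF// ltr_wpDl.
have w1 := weight_ge1 Ix; have nu := normH_ge0 u.
have : 0 <= (normH u + 10 * N * W) * (weight x - 1).
  by rewrite mulr_ge0 ?subr_ge0// addr_ge0// mulr_ge0// mulr_ge0// ltW.
have : 0 <= normH u * weight x * (10 * W + 9).
  by rewrite !mulr_ge0// ?addr_ge0// ?mulr_ge0// ltW.
lra.
Qed.

Lemma loc_abs_contB u v : loc_abs_cont I u -> loc_abs_cont I v -> loc_abs_cont I (u - v).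
Proof.
by move=> lu lv a b ab abI; apply: abs_contD; [exact: lu|apply: abs_contN; exact: lv].
Qed.

(** Elements of V are continuous on I and grow at the end points at most like
    the weight. In the case of a difference the weighted derivatives agree
    only almost everywhere. *)
Lemma inV_bound : exists2 C : R, 0 <= C &
  (forall u, inV u -> forall x, I x -> `|u x| <= C * normV u * weight x) /\
  (forall u v, inV u -> inV v -> forall x, I x ->
     `|u x - v x| <= C * normV (u - v) * weight x).
Proof.
have [C C0 bC] := energy_bound; exists (C * 2); first by rewrite mulr_ge0.
have nV u : normH u + normH (sqrt_rho_deriv u) <= 2 * normV u.
  rewrite /normV; set a := normH u; set b := normH _.
  have a0 : 0 <= a by exact: normH_ge0.
  have b0 : 0 <= b by exact: normH_ge0.
  have h : 0 <= a ^+ 2 + b ^+ 2 by rewrite addr_ge0// sqr_ge0.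
  have : a <= Num.sqrt (a ^+ 2 + b ^+ 2).
    by rewrite -[leLHS]ger0_norm// -sqrtr_sqr ler_wsqrtr// lerDl sqr_ge0.
  have : b <= Num.sqrt (a ^+ 2 + b ^+ 2).
    by rewrite -[leLHS]ger0_norm// -sqrtr_sqr ler_wsqrtr// lerDr sqr_ge0.
  lra.
have step u w x : loc_abs_cont I u -> L2 u -> L2 w -> ae_eq mu I w (sqrt_rho_deriv u) ->
    I x -> `|u x| <= C * 2 * normV u * weight x.
  move=> lu L2u L2w wu Ix; apply: le_trans (bC u w lu L2u L2w wu x Ix) _.
  rewrite ler_wpM2r ?weight_ge0// -mulrA ler_wpM2l//.
  by rewrite (ae_eq_normH wu) nV.
split => [u [L2u lu L2w] x Ix|u v [L2u lu L2du] [L2v lv L2dv] x Ix].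
  by apply: (step u (sqrt_rho_deriv u)) => //; exact: ae_eq_refl.
apply: (step (u - v) (sqrt_rho_deriv u - sqrt_rho_deriv v) x) => //.
- exact: loc_abs_contB.
- exact: L2B.
- exact: L2B.
apply: filterS2 (loc_abs_cont_ae_derivable lu) (loc_abs_cont_ae_derivable lv) => z du dv Iz.
rewrite (_ : (_ - _) z = sqrt_rho_deriv u z - sqrt_rho_deriv v z)//.
rewrite /sqrt_rho_deriv -mulrBr; congr (_ * _).
by rewrite !derive1E deriveB//; [exact: du|exact: dv].
Qed.

End embedding.

(** * Coefficients with essential bounds *)

Section nonlinearity.
Context {R : realType}.
Notation mu := (@lebesgue_measure R).
Notation I := (@I1 R).
Notation L2 := (@Lp R 2%:E I).
Implicit Types (f g u v w q : R -> R) (a b x y h c e : R).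

(** A set of full measure is dense. *)
Lemma ae_exists_itv (P : R -> Prop) a b : a < b -> {ae mu, forall x, P x} ->
  exists2 x, a < x < b & P x.
Proof.
move=> ab [N [mN N0 PN]]; apply: contrapT => hP.
have sub : `]a, b[%classic `<=` N.
  move=> x /=; rewrite in_itv/= => axb; apply: PN => /= Px; apply: hP.
  by exists x.
have : (mu `]a, b[%classic <= mu N)%E.
  by apply: le_measure => //; rewrite inE//; exact: measurable_itv.
by rewrite N0 lebesgue_measure_itv/= lte_fin ab -EFinD lee_fin; lra.
Qed.

Lemma Lp_oo_measurable (J : set R) f : measurable (J : set (measurableTypeR R)) ->
  Lp +oo%E J f -> measurable_fun J f.
Proof.
move=> mJ; rewrite /Lp inE => /andP[/[!inE] mf _].
exact/measurable_restrictT.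
Qed.

Lemma Lp_oo_bounded (J : set R) f : Lp +oo%E J f ->
  exists M, {ae mu, forall x, J x -> `|f x| <= M}.
Proof.
rewrite /Lp inE => /andP[_ /[!inE]]; rewrite /finite_norm unlock /=.
case: ifPn => [_ fo|/negP[]]; last first.
  apply: (@lt_le_trans _ _ (mu I)); first by rewrite lebesgue_I1 lte_fin.
  by apply: le_measure => //; rewrite inE//; exact: measurable_I1.
have := ess_sup_ge mu (abse \o (EFin \o f \_ J)).
set s := ess_sup _ _ in fo *; case: s fo => [s| |] //= _ h.
  exists s; apply: filterS h => x /=; rewrite lee_fin patchE.
  by case: ifPn => [//|/negP hx _ Jx]; exfalso; apply/hx/mem_set.
by exists 0; apply: filterS h.
Qed.

Lemma W1_oo_lipschitz f : W1 +oo%E setT f ->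
  exists2 L, 0 <= L & forall x y, `|f y - f x| <= L * `|y - x|.
Proof.
move=> [_ lf /Lp_oo_bounded[M fM]]; exists `|M| => //.
suff H x y : x < y -> `|f y - f x| <= `|M| * (y - x).
  move=> x y; have [xy|yx|->] := ltgtP x y; last by rewrite !subrr normr0 mulr0.
    by rewrite (@gtr0_norm _ (y - x)) ?subr_gt0// H.
  by rewrite distrC (distrC y) (@gtr0_norm _ (x - y)) ?subr_gt0// H.
move=> xy; have [|g [gi gE gu]] := @abs_cont_FTC _ x y f xy; first by apply: lf => //; exact: ltW.
have mxy : measurable (`[x, y]%classic : set (measurableTypeR R)) by exact: measurable_itv.
have gi' : mu.-integrable `[x, y]%classic (EFin \o g) by exact: integrableS gi.
rewrite gE ?lexx ?(ltW xy)//; apply: le_trans (le_normr_Rintegral mxy gi') _.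
have -> : `|M| * (y - x) = \int[mu]_(z in `[x, y]) `|M|.
  transitivity (`|M| * fine (mu `[x, y]%classic)).
    by rewrite lebesgue_measure_itv/= lte_fin xy.
  by rewrite [RHS](Rintegral_cst _ mxy `|M|).
apply: ae_le_Rintegral => //.
- exact: integrable_norm.
- by apply: continuous_integrable_itv => z _; exact: cst_continuous.
apply: filterS2 (filterI gu fM) (filterI (ae_neq x) (ae_neq y)) => z [h1 h2] [zx zy].
rewrite /= in_itv/= => /andP[xz zy'].
rewrite -(h1 _).2; first by apply: le_trans (h2 _) (ler_norm _).
by rewrite !lt_neqAle eq_sym zx zy xz.
Qed.

(** An essential bound of a monotone function is a bound. *)
Lemma W1_oo_nondecreasing_bounded f : W1 +oo%E setT f -> {homo f : x y / x <= y} ->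
  exists M, forall x, f x <= M.
Proof.
move=> [/Lp_oo_bounded[M fM] _ _] nf; exists M => x.
have x1 : x < x + 1 by rewrite ltrDl.
have [y /andP[xy _] fy] := ae_exists_itv x1 fM.
by apply: le_trans (nf _ _ (ltW xy)) _; apply: le_trans (ler_norm _) (fy _).
Qed.

Lemma hoelder_near theta f x e : 0 < theta -> hoelder_I theta f -> I x -> 0 < e ->
  exists2 y, x < y & forall z, x < z < y -> I z /\ `|f x - f z| <= e.
Proof.
move=> t0 hf Ix e0; have [a [b [a1 ax xb b1]]] := I1_inner Ix.
have abI : `[a, b]%classic `<=` I by exact: subset_itvcc_I1.
have [C fC] := hf _ _ abI.
pose d := (e / (`|C| + 1)) `^ theta^-1.
have C0 : 0 < `|C| + 1 by rewrite ltr_wpDl.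
have d0 : 0 < d by rewrite powR_gt0// divr_gt0.
exists (Num.min b (x + d)); first by rewrite lt_min xb ltrDl.
move=> z; rewrite lt_min => /and3P[xz zb zd].
have zab : z \in `[a, b] by rewrite in_itv/= (ltW (lt_trans ax xz)) ltW.
split; first by apply: abI; exact: zab.
have xab : x \in `[a, b] by rewrite in_itv/= !ltW.
apply: le_trans (fC _ _ xab zab) _.
have : `|x - z| `^ theta <= e / (`|C| + 1).
  have -> : e / (`|C| + 1) = d `^ theta.
    by rewrite /d -powRrM mulVf ?gt_eqF// powRr1// divr_ge0// ltW.
  apply: ge0_ler_powR; rewrite ?nnegrE ?(ltW t0) ?(ltW d0)//.
  by rewrite distrC gtr0_norm ?subr_gt0//; lra.
rewrite ler_pdivlMr// => h; have p0 := powR_ge0 `|x - z| theta.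
have := ler_norm C; move: (_ `^ _) h p0 => p h p0 Cn.
by apply: le_trans (ler_wpM2r p0 Cn) _; nra.
Qed.

(** An essential bound of a continuous function is a bound. *)
Lemma hoelder_bounded theta f : 0 < theta -> hoelder_I theta f -> Lp +oo%E I f ->
  exists M, forall x, I x -> f x <= M.
Proof.
move=> t0 hf /Lp_oo_bounded[M fM]; exists M => x Ix; apply/ler_addgt0Pr => e e0.
have [y xy fy] := hoelder_near t0 hf Ix e0.
have [z /fy[Iz fz] /(_ Iz)] := ae_exists_itv xy fM.
by have := ler_norm (f z); have := ler_norm (f x - f z); lra.
Qed.

Lemma quartic_le a b : a <= b -> `|a| ^+ 3 * a <= `|b| ^+ 3 * b.
Proof.
move=> ab; have [a0|a0] := leP 0 a.
  rewrite (ger0_norm a0) (ger0_norm (le_trans a0 ab)) ler_pM ?exprn_ge0//.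
  by rewrite lerXn2r ?nnegrE// (le_trans a0).
have [b0|b0] := leP 0 b.
  apply: (@le_trans _ _ 0); last by rewrite mulr_ge0// exprn_ge0.
  by rewrite mulr_ge0_le0 ?exprn_ge0// ltW.
rewrite -lerN2 -!mulrN !ltr0_norm// ler_pM ?exprn_ge0 ?oppr_ge0 ?(ltW a0) ?(ltW b0) ?lerN2//.
by rewrite lerXn2r ?nnegrE ?oppr_ge0 ?(ltW a0) ?(ltW b0) ?lerN2.
Qed.

Lemma quartic_lipschitz a b :
  `| `|a| ^+ 3 * a - `|b| ^+ 3 * b| <= 4 * (`|a| + `|b|) ^+ 3 * `|a - b|.
Proof.
have H x y : `|x| ^+ 3 * x - `|y| ^+ 3 * y =
    (`|x| - `|y|) * (`|x| ^+ 2 + `|x| * `|y| + `|y| ^+ 2) * x + `|y| ^+ 3 * (x - y) by ring.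
rewrite H; apply: le_trans (ler_normD _ _) _; rewrite !normrM !normr_id.
set p := `|a|; set r := `|b|; set d := `|a - b|.
have p0 : 0 <= p by exact: normr_ge0.
have r0 : 0 <= r by exact: normr_ge0.
have d0 : 0 <= d by exact: normr_ge0.
have pd : `|p - r| <= d by exact: ler_dist_dist.
have s0 : 0 <= p ^+ 2 + p * r + r ^+ 2 by rewrite !addr_ge0 ?exprn_ge0// mulr_ge0.
rewrite (ger0_norm s0).
apply: (@le_trans _ _ (d * (p ^+ 2 + p * r + r ^+ 2) * p + r ^+ 3 * d)).
  have -> : r * (r * r) = r ^+ 3 by ring.
  by rewrite lerD2r ler_wpM2r// ler_wpM2r.
rewrite (_ : _ + _ = (p ^+ 3 + p ^+ 2 * r + p * r ^+ 2 + r ^+ 3) * d); last by ring.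
rewrite ler_wpM2r//.
have h1 : 0 <= p ^+ 3 by rewrite exprn_ge0.
have h2 : 0 <= r ^+ 3 by rewrite exprn_ge0.
have h3 : 0 <= p ^+ 2 * r by rewrite mulr_ge0// exprn_ge0.
have h4 : 0 <= p * r ^+ 2 by rewrite mulr_ge0// exprn_ge0.
rewrite (_ : (p + r) ^+ 3 = p ^+ 3 + 3 * (p ^+ 2 * r) + 3 * (p * r ^+ 2) + r ^+ 3); last by ring.
lra.
Qed.

End nonlinearity.

(** * The reaction terms and the differential equation *)

Section reaction.
Context {R : realType}.
Notation mu := (@lebesgue_measure R).
Notation I := (@I1 R).
Notation L2 := (@Lp R 2%:E I).
Implicit Types (a s d M N x : R).
Variables (gamma_a gamma_s lambda eps_a sigma_B r0 : R) (beta_s q : R -> R).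
Hypotheses (gamma_a_gt0 : 0 < gamma_a) (gamma_s_gt0 : 0 < gamma_s).
Hypotheses (sigma_B_gt0 : 0 < sigma_B) (lambda_ge0 : 0 <= lambda).
Hypotheses (eps_a_gt0 : 0 < eps_a) (eps_a_lt2 : eps_a < 2) (r0_gt0 : 0 < r0).
Variables (Lb qmax : R).
Hypothesis Lb_ge0 : 0 <= Lb.
Hypothesis beta_lipschitz : forall x y, `|beta_s y - beta_s x| <= Lb * `|y - x|.
Hypothesis beta_nondecreasing : {homo beta_s : x y / x <= y}.
Hypothesis q_measurable : measurable_fun I q.
Hypothesis q_bounds : forall x, I x -> 0 <= q x <= qmax.

Notation ra := (react_a lambda eps_a sigma_B).
Notation rs := (react_s lambda eps_a sigma_B beta_s).
Notation G := (G0 gamma_a gamma_s lambda eps_a sigma_B r0 q beta_s).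

Let qmax_ge0 : 0 <= qmax.
Proof. by have /andP[h1 h2] := q_bounds (@I1_0 R); exact: le_trans h2. Qed.

(** The quartic terms give a Lipschitz constant of cubic growth. *)
Lemma react_lipschitz : exists2 K, 0 <= K & forall M d a s a' s' Q,
  `|a| <= M -> `|s| <= M -> `|a'| <= M -> `|s'| <= M ->
  `|a - a'| <= d -> `|s - s'| <= d -> 0 <= Q <= r0 * qmax ->
  `|ra a s - ra a' s'| <= K * (1 + M ^+ 3) * d /\
  `|rs Q a s - rs Q a' s'| <= K * (1 + M ^+ 3) * d.
Proof.
have rq0 : 0 <= r0 * qmax * Lb by rewrite !mulr_ge0// ltW.
exists (2 * lambda + 192 * sigma_B + r0 * qmax * Lb); first by rewrite !addr_ge0 ?mulr_ge0// ltW.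
move=> M d a s a' s' Q aM sM a'M s'M ad sd /andP[Q0 QM].
have M0 : 0 <= M by exact: le_trans aM.
have d0 : 0 <= d by exact: le_trans ad.
have lip x y : `|x| <= M -> `|y| <= M -> `|x - y| <= d ->
    `| `|x| ^+ 3 * x - `|y| ^+ 3 * y| <= 32 * M ^+ 3 * d.
  move=> xM yM xyd; apply: le_trans (quartic_lipschitz _ _) _.
  apply: ler_pM => //.
  rewrite (_ : 32 * M ^+ 3 = 4 * (M + M) ^+ 3); last by ring.
  by rewrite ler_pM2l// lerXn2r ?nnegrE ?addr_ge0// lerD.
have ha := lip _ _ aM a'M ad; have hs := lip _ _ sM s'M sd.
have scal c x y : 0 <= c -> `|x| <= y -> `|c * x| <= c * y.
  by move=> c0 xy; rewrite normrM (ger0_norm c0) ler_wpM2l.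
have es0 : 0 <= eps_a * sigma_B by rewrite mulr_ge0// ltW.
have T0 : 0 <= M ^+ 3 * d by rewrite mulr_ge0// exprn_ge0.
have esT : eps_a * sigma_B * (32 * M ^+ 3 * d) <= 64 * (sigma_B * (M ^+ 3 * d)).
  have -> : eps_a * sigma_B * (32 * M ^+ 3 * d) = eps_a * (32 * (sigma_B * (M ^+ 3 * d))) by ring.
  have -> : 64 * (sigma_B * (M ^+ 3 * d)) = 2 * (32 * (sigma_B * (M ^+ 3 * d))) by ring.
  by apply: ler_wpM2r; [rewrite !mulr_ge0// ltW|exact: ltW].
have n1 : 0 <= lambda * d by rewrite mulr_ge0.
have n2 : 0 <= lambda * (M ^+ 3 * d) by rewrite mulr_ge0.
have n3 : 0 <= sigma_B * d by rewrite mulr_ge0// ltW.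
have n4 : 0 <= sigma_B * (M ^+ 3 * d) by rewrite mulr_ge0// ltW.
have n5 : 0 <= r0 * qmax * Lb * d by rewrite mulr_ge0.
have n6 : 0 <= r0 * qmax * Lb * (M ^+ 3 * d) by rewrite mulr_ge0.
have -> : (2 * lambda + 192 * sigma_B + r0 * qmax * Lb) * (1 + M ^+ 3) * d =
  2 * (lambda * d) + 192 * (sigma_B * d) + r0 * qmax * Lb * d + 2 * (lambda * (M ^+ 3 * d))
  + 192 * (sigma_B * (M ^+ 3 * d)) + r0 * qmax * Lb * (M ^+ 3 * d) by ring.
have la := scal _ _ _ lambda_ge0 ad; have ls := scal _ _ _ lambda_ge0 sd.
have ea := scal _ _ _ es0 ha; have es := scal _ _ _ es0 hs.
split.
- have -> : ra a s - ra a' s' = - (lambda * (a - a')) + lambda * (s - s') +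
    eps_a * sigma_B * (`|s| ^+ 3 * s - `|s'| ^+ 3 * s') -
    2 * (eps_a * sigma_B * (`|a| ^+ 3 * a - `|a'| ^+ 3 * a')).
    by rewrite /react_a; ring.
  move: la ls ea es; rewrite !ler_norml => /andP[? ?] /andP[? ?] /andP[? ?] /andP[? ?].
  by apply/andP; split; lra.
- have ss := scal _ _ _ (ltW sigma_B_gt0) hs.
  have qb : `|Q * (beta_s s - beta_s s')| <= r0 * qmax * Lb * d.
    rewrite normrM (ger0_norm Q0) -mulrA ler_pM//.
    by apply: le_trans (beta_lipschitz _ _) _; rewrite ler_wpM2l.
  have -> : rs Q a s - rs Q a' s' = - (lambda * (s - s')) + lambda * (a - a') -
    sigma_B * (`|s| ^+ 3 * s - `|s'| ^+ 3 * s') +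
    eps_a * sigma_B * (`|a| ^+ 3 * a - `|a'| ^+ 3 * a') + Q * (beta_s s - beta_s s').
    by rewrite /react_s; ring.
  move: la ls ea ss qb; rewrite !ler_norml => /andP[? ?] /andP[? ?] /andP[? ?] /andP[? ?] /andP[? ?].
  by apply/andP; split; lra.
Qed.

Lemma continuous_beta : continuous beta_s.
Proof.
move=> x; apply/cvgrPdist_le => e e0.
have L0 : 0 < Lb + 1 by rewrite ltr_wpDl.
near=> y.
apply: le_trans (beta_lipschitz _ _) _.
apply: (@le_trans _ _ ((Lb + 1) * `|x - y|)); first by rewrite ler_wpM2r// lerDl.
rewrite -ler_pdivlMl// mulrC; near: y.
apply/nbhs_ballP; exists (e / (Lb + 1)); first by rewrite /= divr_gt0.
by move=> y; rewrite /ball /= => /ltW.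
Unshelve. all: by end_near. Qed.

Lemma reaction_measurable (u : fun2 R) : measurable_fun I u.1 -> measurable_fun I u.2 ->
  measurable_fun I (G u).1 /\ measurable_fun I (G u).2.
Proof.
move=> m1 m2.
have mb : measurable_fun I (fun x => beta_s (u.2 x)).
  apply: (@measurableT_comp _ _ _ _ _ _ beta_s) => //.
  exact: continuous_measurable_fun continuous_beta.
have mquart (v : R -> R) : measurable_fun I v -> measurable_fun I (fun x => `|v x| ^+ 3 * v x).
  move=> mv; apply: measurable_funM => //.
  by apply: measurable_funX; exact: measurableT_comp.
have mZ c (v : R -> R) : measurable_fun I v -> measurable_fun I (fun x => c * v x).
  by move=> mv; apply: measurable_funM.
split.
- apply: (eq_measurable_fun (fun x => gamma_a^-1 * (- lambda * (u.1 x - u.2 x) +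
    eps_a * sigma_B * (`|u.2 x| ^+ 3 * u.2 x) - 2 * eps_a * sigma_B * (`|u.1 x| ^+ 3 * u.1 x)))).
    by move=> x _; rewrite /= /react_a !mulrA.
  exact: mZ (measurable_funB (measurable_funD (mZ _ _ (measurable_funB m1 m2))
    (mZ _ _ (mquart _ m2))) (mZ _ _ (mquart _ m1))).
- apply: (eq_measurable_fun (fun x => gamma_s^-1 * (- lambda * (u.2 x - u.1 x) -
    sigma_B * (`|u.2 x| ^+ 3 * u.2 x) + eps_a * sigma_B * (`|u.1 x| ^+ 3 * u.1 x)
    + r0 * (q x * beta_s (u.2 x))))).
    by move=> x _; rewrite /= /react_s !mulrA.
  exact: mZ (measurable_funD (measurable_funD (measurable_funB
    (mZ _ _ (measurable_funB m2 m1)) (mZ _ _ (mquart _ m2)))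
    (mZ _ _ (mquart _ m1))) (mZ _ _ (measurable_funM q_measurable mb))).
Qed.

(** Three powers of the weight come from the Lipschitz constant and one from
    the difference of the states. The square of this bound is integrable since
    weight ^+ 8 is. *)
Lemma reaction_bound : exists2 K, 0 <= K & forall N d (u v : fun2 R) x, 0 <= N -> 0 <= d -> I x ->
  `|u.1 x| <= N * weight x -> `|u.2 x| <= N * weight x ->
  `|v.1 x| <= N * weight x -> `|v.2 x| <= N * weight x ->
  `|u.1 x - v.1 x| <= d * weight x -> `|u.2 x - v.2 x| <= d * weight x ->
  `|(G u).1 x - (G v).1 x| <= K * (1 + N ^+ 3) * d * weight x ^+ 4 /\
  `|(G u).2 x - (G v).2 x| <= K * (1 + N ^+ 3) * d * weight x ^+ 4.
Proof.
have [K K0 bK] := react_lipschitz.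
have ga0 : 0 <= gamma_a^-1 by rewrite invr_ge0 ltW.
have gs0 : 0 <= gamma_s^-1 by rewrite invr_ge0 ltW.
exists ((gamma_a^-1 + gamma_s^-1) * K); first by rewrite mulr_ge0// addr_ge0.
move=> N d u v x N0 d0 Ix u1 u2 v1 v2 d1 d2.
have Q0 : 0 <= r0 * q x <= r0 * qmax.
  have /andP[h1 h2] := q_bounds Ix.
  by apply/andP; split; [rewrite mulr_ge0// ltW|rewrite ler_wpM2l// ltW].
have [h1 h2] := bK _ _ _ _ _ _ _ u1 u2 v1 v2 d1 d2 Q0.
have w1 := weight_ge1 Ix; have w0 := weight_ge0 x.
have w4 : K * (1 + (N * weight x) ^+ 3) * (d * weight x) <= K * (1 + N ^+ 3) * d * weight x ^+ 4.
  have -> : K * (1 + N ^+ 3) * d * weight x ^+ 4 = K * ((1 + N ^+ 3) * weight x ^+ 3) * (d * weight x) by ring.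
  rewrite ler_wpM2r ?mulr_ge0// ler_wpM2l// mulrDl mul1r exprMn lerD2r.
  exact: exprn_ege1.
have W0 : 0 <= K * (1 + N ^+ 3) * d * weight x ^+ 4.
  by rewrite !mulr_ge0 ?addr_ge0 ?exprn_ge0.
have E : (gamma_a^-1 + gamma_s^-1) * K * (1 + N ^+ 3) * d * weight x ^+ 4 =
  (gamma_a^-1 + gamma_s^-1) * (K * (1 + N ^+ 3) * d * weight x ^+ 4) by rewrite !mulrA.
split; rewrite /= -mulrBr normrM ger0_norm//.
- apply: le_trans (ler_wpM2l ga0 (le_trans h1 w4)) _.
  by rewrite E ler_wpM2r// lerDl.
- apply: le_trans (ler_wpM2l gs0 (le_trans h2 w4)) _.
  by rewrite E ler_wpM2r// lerDr.
Qed.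

Lemma reaction_inHH N (u : fun2 R) : 0 <= N ->
  measurable_fun I u.1 -> measurable_fun I u.2 ->
  (forall x, I x -> `|u.1 x| <= N * weight x /\ `|u.2 x| <= N * weight x) -> inHH (G u).
Proof.
move=> N0 m1 m2 uN; have [K K0 bK] := reaction_bound.
have [mG1 mG2] := reaction_measurable m1 m2.
have c0 : exists c, forall x, I x -> `|(G (0 : fun2 R)).1 x| <= c /\ `|(G (0 : fun2 R)).2 x| <= c.
  exists (gamma_s^-1 * (r0 * qmax * `|beta_s 0|)) => x Ix; have /andP[q0 qM] := q_bounds Ix.
  rewrite /= /react_a /react_s (_ : (0 : R -> R) x = 0)//.
  rewrite !(mulr0, subr0, addr0, normr0, oppr0, add0r); split.
    have ig : 0 <= gamma_s^-1 by rewrite invr_ge0 ltW.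
    by rewrite !mulr_ge0// ltW//.
  rewrite !normrM normfV (gtr0_norm gamma_s_gt0) (gtr0_norm r0_gt0) (ger0_norm q0).
  have ig : 0 <= gamma_s^-1 by rewrite invr_ge0 ltW.
  by apply: ler_wpM2l => //; apply: ler_wpM2r => //; apply: ler_wpM2l => //; exact: ltW.
have [c bc] := c0; pose b := K * (1 + N ^+ 3) * N + `|c|.
have b0 : 0 <= b by rewrite addr_ge0// !mulr_ge0// addr_ge0// exprn_ge0.
have key x : I x -> `|(G u).1 x| <= `|(b *: (fun x => weight x ^+ 4)) x| /\
    `|(G u).2 x| <= `|(b *: (fun x => weight x ^+ 4)) x|.
  move=> Ix; have [h1 h2] := uN x Ix; have [c1 c2] := bc x Ix.
  have w1 : 1 <= weight x ^+ 4 by rewrite exprn_ege1// weight_ge1.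
  have z0 : `|(0 : fun2 R).1 x| <= N * weight x /\ `|(0 : fun2 R).2 x| <= N * weight x.
    by rewrite /= normr0 mulr_ge0// weight_ge0.
  have [g1 g2] : `|(G u).1 x - (G 0).1 x| <= K * (1 + N ^+ 3) * N * weight x ^+ 4 /\
      `|(G u).2 x - (G 0).2 x| <= K * (1 + N ^+ 3) * N * weight x ^+ 4.
    have e1 : (0 : fun2 R).1 x = 0 by [].
    have e2 : (0 : fun2 R).2 x = 0 by [].
    have [z1 z2] := z0; by apply: (bK N N u 0 x) => //; rewrite ?e1 ?e2 subr0.
  have bw0 : 0 <= b * weight x ^+ 4 by rewrite mulr_ge0// exprn_ge0// weight_ge0.
  rewrite (_ : (_ *: _) x = b * weight x ^+ 4)// (ger0_norm bw0).
  have cw : c <= `|c| * weight x ^+ 4.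
    by apply: le_trans (ler_norm _) _; rewrite ler_peMr.
  have h := lerB_dist ((G u).1 x) ((G 0).1 x); have h' := lerB_dist ((G u).2 x) ((G 0).2 x).
  have bE : b * weight x ^+ 4 = K * (1 + N ^+ 3) * N * weight x ^+ 4 + `|c| * weight x ^+ 4.
    by rewrite mulrDl.
  by rewrite bE; split; lra.
split.
- apply: (L2_dominated (L2Z b (@L2_weight4 R))) => // x Ix; exact: (key x Ix).1.
- apply: (L2_dominated (L2Z b (@L2_weight4 R))) => // x Ix; exact: (key x Ix).2.
Qed.

Lemma reaction_normS_lipschitz : exists2 K, 0 <= K & forall N d (u v : fun2 R),
  0 <= N -> 0 <= d -> inHH (G u) -> inHH (G v) ->
  (forall x, I x -> `|u.1 x| <= N * weight x /\ `|u.2 x| <= N * weight x) ->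
  (forall x, I x -> `|v.1 x| <= N * weight x /\ `|v.2 x| <= N * weight x) ->
  (forall x, I x -> `|u.1 x - v.1 x| <= d * weight x /\ `|u.2 x - v.2 x| <= d * weight x) ->
  normS (G u - G v) <= K * (1 + N ^+ 3) * d.
Proof.
have [K K0 bK] := reaction_bound.
pose W := normH (fun x : R => weight x ^+ 4); have W0 : 0 <= W by exact: normH_ge0.
exists (2 * (K * W)); first by rewrite !mulr_ge0.
move=> N d u v N0 d0 [gu1 gu2] [gv1 gv2] uN vN uv.
pose b := K * (1 + N ^+ 3) * d.
have b0 : 0 <= b by rewrite !mulr_ge0// addr_ge0// exprn_ge0.
have key x : I x -> `|(G u - G v).1 x| <= `|(b *: (fun x => weight x ^+ 4)) x| /\
    `|(G u - G v).2 x| <= `|(b *: (fun x => weight x ^+ 4)) x|.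
  move=> Ix; have [u1 u2] := uN x Ix; have [v1 v2] := vN x Ix; have [d1 d2] := uv x Ix.
  have bw0 : 0 <= b * weight x ^+ 4 by rewrite mulr_ge0// exprn_ge0// weight_ge0.
  rewrite (_ : (_ *: _) x = b * weight x ^+ 4)// (ger0_norm bw0).
  exact: bK.
have L2b := L2Z b (@L2_weight4 R).
have n1 : normH (G u - G v).1 <= b * W.
  rewrite -(ger0_norm b0) -normHZ; last exact: L2_weight4.
  by apply: ae_le_normH => //; [exact: L2B|apply: aeW => x /key[]].
have n2 : normH (G u - G v).2 <= b * W.
  rewrite -(ger0_norm b0) -normHZ; last exact: L2_weight4.
  by apply: ae_le_normH => //; [exact: L2B|apply: aeW => x /key[]].
have -> : 2 * (K * W) * (1 + N ^+ 3) * d = b * W + b * W by rewrite /b; ring.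
exact: lerD.
Qed.

(** Only components in which (a, s) exceeds (a', s') are counted. If both do,
    then with the factors 1 and 2 the terms in |a|^3 a cancel, and those in
    |s|^3 s combine with the factor (eps_a - 2) sigma_B, which is negative. If
    only one does, the interaction terms have the favourable sign, since the
    system is cooperative. What remains is linear in the difference. *)
Lemma react_one_sided a s a' s' Q : 0 <= Q <= r0 * qmax ->
  (a' < a)%R%:R * (ra a s - ra a' s') + 2 * ((s' < s)%R%:R * (rs Q a s - rs Q a' s')) <=
  (lambda + 2 * (r0 * qmax * Lb)) * (Num.max (a - a') 0 + Num.max (s - s') 0).
Proof.
move=> /andP[Q0 QM].
have b1 : s' < s -> Q * (beta_s s - beta_s s') <= r0 * qmax * Lb * (s - s').
  move=> ss; rewrite -mulrA; apply: ler_pM => //.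
    by rewrite subr_ge0 beta_nondecreasing// ltW.
  apply: le_trans (ler_norm _) _; apply: le_trans (beta_lipschitz _ _) _.
  by rewrite gtr0_norm// subr_gt0.
have rql : 0 <= r0 * qmax * Lb by rewrite !mulr_ge0// ltW.
have qa : a' < a -> 0 <= `|a| ^+ 3 * a - `|a'| ^+ 3 * a' by move=> /ltW/quartic_le; rewrite subr_ge0.
have qa' : a <= a' -> `|a| ^+ 3 * a - `|a'| ^+ 3 * a' <= 0 by move=> /quartic_le; rewrite subr_le0.
have qs : s' < s -> 0 <= `|s| ^+ 3 * s - `|s'| ^+ 3 * s' by move=> /ltW/quartic_le; rewrite subr_ge0.
have qs' : s <= s' -> `|s| ^+ 3 * s - `|s'| ^+ 3 * s' <= 0 by move=> /quartic_le; rewrite subr_le0.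
have -> : ra a s - ra a' s' = - lambda * (a - a') + lambda * (s - s') +
    eps_a * sigma_B * (`|s| ^+ 3 * s - `|s'| ^+ 3 * s') -
    2 * eps_a * sigma_B * (`|a| ^+ 3 * a - `|a'| ^+ 3 * a').
  by rewrite /react_a; ring.
have -> : rs Q a s - rs Q a' s' = - lambda * (s - s') + lambda * (a - a') -
    sigma_B * (`|s| ^+ 3 * s - `|s'| ^+ 3 * s') +
    eps_a * sigma_B * (`|a| ^+ 3 * a - `|a'| ^+ 3 * a') + Q * (beta_s s - beta_s s').
  by rewrite /react_s; ring.
move: b1 qa qa' qs qs'; rewrite -(subr_gt0 s') -(subr_gt0 a') -(subr_le0 a') -(subr_le0 s').
move: (`|a| ^+ 3 * a - _) (`|s| ^+ 3 * s - _) (Q * (_ - _)) (a - a') (s - s') => pa ps b x y.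
have es0 : 0 <= eps_a * sigma_B by rewrite mulr_ge0// ltW.
have [x0|x0] := ltP 0 x; have [y0|y0] := ltP 0 y; rewrite !(mul1r, mul0r, mulr0, add0r, addr0).
- move=> /(_ isT) hb /(_ isT) ha _ /(_ isT) hs _.
  have : 0 <= (2 - eps_a) * sigma_B * ps by apply: mulr_ge0 => //; apply: mulr_ge0; rewrite ?subr_ge0; exact: ltW.
  have : 0 <= lambda * y by rewrite mulr_ge0// ltW.
  have : 0 <= r0 * qmax * Lb * x by rewrite mulr_ge0// ltW.
  lra.
- move=> _ /(_ isT) ha _ _ /(_ isT) hs.
  have : eps_a * sigma_B * ps <= 0 by rewrite mulr_ge0_le0.
  have : 0 <= eps_a * sigma_B * pa by rewrite mulr_ge0.
  have : 0 <= lambda * x by rewrite mulr_ge0// ltW.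
  have : lambda * y <= 0 by rewrite mulr_ge0_le0.
  have : 0 <= r0 * qmax * Lb * x by rewrite mulr_ge0// ltW.
  lra.
- move=> /(_ isT) hb _ /(_ isT) ha /(_ isT) hs _.
  have : 0 <= sigma_B * ps by rewrite mulr_ge0// ltW.
  have : eps_a * sigma_B * pa <= 0 by rewrite mulr_ge0_le0.
  have : lambda * x <= 0 by rewrite mulr_ge0_le0.
  have : 0 <= lambda * y by rewrite mulr_ge0// ltW.
  have : 0 <= r0 * qmax * Lb * y by rewrite mulr_ge0// ltW.
  lra.
- by [].
Qed.

Notation Q := (r0 * qmax).

Let Q_ge0 : 0 <= Q. Proof. by rewrite mulr_ge0// ltW. Qed.

Let raE a s : ra a s = lambda * s - lambda * a + eps_a * sigma_B * (`|s| ^+ 3 * s) -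
  2 * (eps_a * sigma_B * (`|a| ^+ 3 * a)).
Proof. by rewrite /react_a; ring. Qed.

Let rsE c a s : rs c a s = lambda * a - lambda * s - sigma_B * (`|s| ^+ 3 * s) +
  eps_a * sigma_B * (`|a| ^+ 3 * a) + c * beta_s s.
Proof. by rewrite /react_s; ring. Qed.

Let es_ge0 : 0 <= eps_a * sigma_B. Proof. by rewrite mulr_ge0// ltW. Qed.

Lemma react_a_mono a s s' : s <= s' -> ra a s <= ra a s'.
Proof.
move=> ss; rewrite !raE.
have h1 := ler_wpM2l es_ge0 (quartic_le ss).
have h2 := ler_wpM2l lambda_ge0 ss.
lra.
Qed.

Lemma react_s_mono a a' s c : a <= a' -> rs c a s <= rs c a' s.
Proof.
move=> aa; rewrite !rsE.
have h1 := ler_wpM2l es_ge0 (quartic_le aa).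
have h2 := ler_wpM2l lambda_ge0 aa.
lra.
Qed.

Definition sub_equilibrium : set (R * R) := [set p | 0 <= ra p.1 p.2 /\ 0 <= rs Q p.1 p.2].

(** In the combination react_a + 2 react_s the terms in |a|^3 a cancel, and
    what remains bounds s^4. *)
Lemma sub_equilibrium_bounded B : (forall x, beta_s x <= B) -> (forall x, 0 < beta_s x) ->
  exists C, forall p, sub_equilibrium p -> p.1 <= C /\ p.2 <= C.
Proof.
move=> bB b0; have B0 : 0 <= B by exact: le_trans (ltW (b0 0)) (bB 0).
have e2 : 0 < (2 - eps_a) * sigma_B by rewrite mulr_gt0// subr_gt0.
have QB : 0 <= Q * B by rewrite mulr_ge0.
pose C := 1 + 2 * (Q * B) / ((2 - eps_a) * sigma_B).
have C1 : 1 <= C by rewrite lerDl divr_ge0 ?(ltW e2)// mulr_ge0.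
exists C => -[a s] [/= h1 h2].
have aS : 0 < a -> a <= s.
  move=> a0; rewrite leNgt; apply/negP => sa; move: h1; rewrite raE.
  have q1 := ler_wpM2l es_ge0 (quartic_le (ltW sa)).
  have q2 : 0 < eps_a * sigma_B * (`|a| ^+ 3 * a).
    by rewrite (gtr0_norm a0) !mulr_gt0.
  have q3 : lambda * s <= lambda * a by rewrite ler_wpM2l// ltW.
  lra.
suff sC : s <= C.
  by split => //; have [/aS/le_trans-> //|] := ltP 0 a; move/le_trans; apply; lra.
rewrite leNgt; apply/negP => Cs; have s1 : 1 < s by exact: le_lt_trans Cs.
have s0 : 0 < s by lra.
have al : lambda * a <= lambda * s.
  rewrite ler_wpM2l//; have [/aS//|a0] := ltP 0 a; exact: le_trans (ltW s0).
have := addr_ge0 h1 (mulr_ge0 (ler0n R 2) h2); rewrite raE rsE.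
have s4 : (2 - eps_a) * sigma_B * C < (2 - eps_a) * sigma_B * (`|s| ^+ 3 * s).
  rewrite ltr_pM2l//; apply: lt_le_trans Cs _.
  by rewrite ler_peMl ?(ltW s0)// exprn_ege1// gtr0_norm// ltW.
have CE : (2 - eps_a) * sigma_B * C = (2 - eps_a) * sigma_B + 2 * (Q * B).
  by rewrite /C; field; rewrite !gt_eqF// subr_gt0.
have Qb : Q * beta_s s <= Q * B by rewrite ler_wpM2l.
lra.
Qed.

(** The componentwise supremum of all sub-equilibria is an equilibrium:
    cooperativity lets the other component be replaced by its supremum, and a
    positive reaction at the supremum would leave room for a larger
    sub-equilibrium. *)
Lemma sub_equilibrium_le B E p : (forall x, beta_s x <= B) -> (forall x, 0 < beta_s x) ->
  warmest_ode_equilibrium lambda eps_a sigma_B beta_s Q E -> sub_equilibrium p ->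
  p.1 <= E.1 /\ p.2 <= E.2.
Proof.
move=> bB b0 [_ Emax] subp; have [C bC] := sub_equilibrium_bounded bB b0.
pose A1 := [set x.1 | x in sub_equilibrium]; pose A2 := [set x.2 | x in sub_equilibrium].
have S1 : has_sup A1.
  by split; [exists p.1, p|exists C => _ [x /bC[? _] <-]].
have S2 : has_sup A2.
  by split; [exists p.2, p|exists C => _ [x /bC[_ ?] <-]].
set a := sup A1; set s := sup A2.
have ua (x : R * R) : sub_equilibrium x -> x.1 <= a.
  by move=> sx; apply: ub_le_sup; [case: S1|exists x].
have us (x : R * R) : sub_equilibrium x -> x.2 <= s.
  by move=> sx; apply: ub_le_sup; [case: S2|exists x].
have [K K0 bK] := react_lipschitz.
pose M := `|a| + `|s| + 1.
have QQ : 0 <= Q <= Q by rewrite Q_ge0 lexx.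
have [L L0 bL] : exists2 L, 0 < L & forall e x, 0 < e -> e <= 1 ->
    (`|x - a| <= e -> `|ra x s - ra a s| <= L * e) /\
    (`|x - s| <= e -> `|rs Q a x - rs Q a s| <= L * e).
  exists (K * (1 + M ^+ 3) + 1).
    by rewrite ltr_wpDl// mulr_ge0// addr_ge0// exprn_ge0// /M !addr_ge0.
  move=> e x e0 e1.
  have aM : `|a| <= M by rewrite /M -addrA lerDl addr_ge0.
  have sM : `|s| <= M by rewrite /M -addrA addrCA lerDl addr_ge0.
  have aa : `|a - a| <= e by rewrite subrr normr0 ltW.
  have ss : `|s - s| <= e by rewrite subrr normr0 ltW.
  split => xe.
  - have xM : `|x| <= M.
      by have := lerB_dist x a; have := normr_ge0 s; rewrite /M; lra.
    have [h _] := bK _ _ _ _ _ _ _ xM sM aM sM xe ss QQ.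
    apply: (le_trans h).
    by rewrite ler_wpM2r ?lerDl// ltW.
  - have xM : `|x| <= M.
      by have := lerB_dist x s; have := normr_ge0 a; rewrite /M; lra.
    have [_ h] := bK _ _ _ _ _ _ _ aM xM aM sM aa xe QQ.
    apply: (le_trans h).
    by rewrite ler_wpM2r ?lerDl// ltW.
have ra0 : 0 <= ra a s.
  apply/ler_addgt0Pr => e e0.
  pose d := Num.min 1 (e / L); have d0 : 0 < d by rewrite lt_min ltr01 divr_gt0.
  have d1 : d <= 1 by rewrite ge_min lexx.
  have dL : L * d <= e by rewrite mulrC -ler_pdivlMr// ge_min lexx orbT.
  have [_ [x sx <-] xa] := sup_adherent d0 S1.
  have xd : `|x.1 - a| <= d.
    by have := ua _ sx; rewrite -/a in xa; rewrite ler_norml; move=> ?; apply/andP; split; lra.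
  have := (bL d x.1 d0 d1).1 xd; have := react_a_mono x.1 (us _ sx); have := sx.1.
  rewrite ler_norml => h1 h2 /andP[h3 h4]; lra.
have rs0 : 0 <= rs Q a s.
  apply/ler_addgt0Pr => e e0.
  pose d := Num.min 1 (e / L); have d0 : 0 < d by rewrite lt_min ltr01 divr_gt0.
  have d1 : d <= 1 by rewrite ge_min lexx.
  have dL : L * d <= e by rewrite mulrC -ler_pdivlMr// ge_min lexx orbT.
  have [_ [x sx <-] xa] := sup_adherent d0 S2.
  have xd : `|x.2 - s| <= d.
    by have := us _ sx; rewrite -/s in xa; rewrite ler_norml; move=> ?; apply/andP; split; lra.
  have := (bL d x.2 d0 d1).2 xd; have := react_s_mono x.2 Q (ua _ sx); have := sx.2.
  rewrite ler_norml => h1 h2 /andP[h3 h4]; lra.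
have room c : 0 < c -> exists d, [/\ 0 < d, d <= 1 & L * d <= c].
  move=> c0; exists (Num.min 1 (c / L)); split; first by rewrite lt_min ltr01 divr_gt0.
    by rewrite ge_min lexx.
  by rewrite mulrC -ler_pdivlMr// ge_min lexx orbT.
suff Eas : ode_equilibrium lambda eps_a sigma_B beta_s Q (a, s).
  have /=[ha hs] := Emax _ Eas.
  by split; [apply: le_trans (ua _ subp) ha|apply: le_trans (us _ subp) hs].
split; apply/eqP; rewrite eq_le /= ?ra0 ?rs0 andbT leNgt; apply/negP => pos.
- have [d [d0 d1 dc]] := room _ pos.
  have /= : (a + d, s).1 <= a.
    apply: ua; split => /=; last by apply: (le_trans rs0); apply: react_s_mono; rewrite lerDl ltW.
    have := (bL d (a + d) d0 d1).1; rewrite addrAC subrr add0r gtr0_norm// lexx => /(_ isT).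
    by rewrite ler_norml => /andP[h _]; lra.
  by rewrite gerDl leNgt d0.
- have [d [d0 d1 dc]] := room _ pos.
  have /= : (a, s + d).2 <= s.
    apply: us; split => /=; first by apply: (le_trans ra0); apply: react_a_mono; rewrite lerDl ltW.
    have := (bL d (s + d) d0 d1).2; rewrite addrAC subrr add0r gtr0_norm// lexx => /(_ isT).
    by rewrite ler_norml => /andP[h _]; lra.
  by rewrite gerDl leNgt d0.
Qed.

End reaction.

(** * Density of the domain of A *)

Section density.
Context {R : realType}.
Notation mu := (@lebesgue_measure R).
Notation I := (@I1 R).
Notation L2 := (@Lp R 2%:E I).
Implicit Types (f g u v w : R -> R) (a b x y h c e : R).

Lemma heine f a b e : continuous f -> 0 < e ->
  exists2 d, 0 < d & forall x y, a <= x <= b -> `|x - y| < d -> `|f x - f y| < e.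
Proof.
move=> cf e0.
have := @segment_compact R a b => /compact_near_coveringP.
move=> /(_ R (0^'+) (fun d x => forall y, `|x - y| < d -> `|f x - f y| < e) _)[].
  move=> x _; have e2 : 0 < e / 2 by rewrite divr_gt0.
  have /cvgrPdist_lt/(_ _ e2)/nbhs_ballP[r /= r0 fr] := cf x.
  have r2 : 0 < r / 2 by rewrite divr_gt0.
  exists (ball x (r / 2), [set d | 0 < d < r / 2]).
    split; first exact: nbhsx_ballx.
    by near=> d; apply/andP; split; near: d; [exact: nbhs_right_gt|exact: nbhs_right_lt].
  move=> [x' d] /= [xx' /andP[d0 dr]] y xy.
  have h1 := fr x' _; have h2 := fr y _.
  have {}h1 : `|f x - f x'| < e / 2.
    by apply: h1; rewrite /ball /= in xx' *; lra.
  have {}h2 : `|f x - f y| < e / 2.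
    apply: h2; rewrite /ball /= in xx' *.
    by have := ler_distD x' x y; lra.
  by have := ler_distD (f x) (f x') (f y); rewrite (distrC (f x') (f x)); lra.
move=> d /= d0 H; exists (d / 2); first by rewrite divr_gt0.
move=> x y xab; apply: (H (d / 2)) => //.
- by rewrite /ball /= sub0r normrN gtr0_norm ?divr_gt0//; lra.
- by rewrite divr_gt0.
Unshelve. all: by end_near. Qed.

Lemma primitive f a b : a < b -> (forall x, a <= x <= b -> {for x, continuous f}) ->
  exists F, forall x, a < x < b -> is_derive x 1 F (f x).
Proof.
move=> ab cf; exists (fun x => \int[mu]_(t in `[a, x]) f t) => x /andP[ax xb].
have fi : mu.-integrable `[a, b]%classic (EFin \o f).
  by apply: continuous_integrable_itv => z; rewrite in_itv/=; exact: cf.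
have [|d1 d2] := continuous_FTC1_closed xb fi ax; first by apply: cf; rewrite !ltW.
by rewrite -d2 derive1E; exact: DeriveDef.
Qed.

(** Second-order Steklov averages: the second difference quotient of a second
    primitive of [f] is the value of [f] at a nearby point, by two
    applications of the mean value theorem. *)
Lemma C2_approximation f e : continuous f -> 0 < e -> exists y y1 y2 : R -> R,
  [/\ forall x, -2 < x < 2 -> is_derive x 1 y (y1 x),
      forall x, -2 < x < 2 -> is_derive x 1 y1 (y2 x),
      continuous y2 & forall x, -2 < x < 2 -> `|f x - y x| <= e].
Proof.
move=> cf e0.
have [U1 dU1] := @primitive f (-4) 4 ltac:(lra) (fun x _ => cf x).
have cU1 x : -3 <= x <= 3 -> {for x, continuous U1}.
  move=> /andP[h1 h2]; apply: differentiable_continuous; apply/derivable1_diffP.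
  have := dU1 x; apply: contraPP => ?; move=> /(_ _)/@ex_derive.
  by move=> H; suff : derivable U1 x 1 by []; apply: H; apply/andP; split; lra.
have [U2 dU2] := @primitive U1 (-3) 3 ltac:(lra) cU1.
have [d d0 fd] := heine (-3) 3 cf e0.
pose h := Num.min (4^-1) (d / 3).
have h0 : 0 < h by rewrite lt_min invr_gt0 ltr0n divr_gt0.
have h4 : h <= 4^-1 by rewrite ge_min lexx.
have hd : h <= d / 3 by rewrite ge_min lexx orbT.
have shift (F : R -> R) F' t x : is_derive (x + t) 1 F F' -> is_derive x 1 (fun x => F (x + t)) F'.
  move=> dF; have d1 : is_derive x 1 (fun x : R => x + t) 1.
    by have := is_deriveD (is_derive_id x (1 : R)) (is_derive_cst t x 1); rewrite addr0.
  by have := @is_derive1_comp _ F (fun x => x + t) x _ _ dF d1; rewrite mulr1.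
pose D2 (F : R -> R) x := h^-2 * (F (x + 2 * h) - 2 * F (x + h) + F x).
have dD2 (F F' : R -> R) x : is_derive x 1 F (F' x) -> is_derive (x + h) 1 F (F' (x + h)) ->
    is_derive (x + 2 * h) 1 F (F' (x + 2 * h)) -> is_derive x 1 (D2 F) (D2 F' x).
  move=> d1 /shift d2 /shift d3.
  have := is_deriveZ (h ^- 2) (is_deriveD (is_deriveB d3 (is_deriveZ 2 d2)) d1).
  by [].
exists (D2 U2), (D2 U1), (D2 f); split.
- by move=> x /andP[h1 h2]; apply: dD2; apply: dU2; apply/andP; split; lra.
- by move=> x /andP[h1 h2]; apply: dD2; apply: dU1; apply/andP; split; lra.
- move=> x; rewrite /D2.
  have cs t : {for x, continuous (fun x => f (x + t))}.
    apply: (@continuous_comp _ _ _ (fun x => x + t)); last exact: cf.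
    by apply: cvgD; [exact: cvg_id|exact: cvg_cst].
  apply: cvgM; first exact: cvg_cst.
  apply: cvgD; last exact: cf.
  apply: cvgB; first exact: cs.
  by apply: cvgM; [exact: cvg_cst|exact: cs].
- move=> x /andP[h1 h2].
  pose g z := U2 (z + h) - U2 z.
  have dg z : -3 < z -> z < 3 - h -> is_derive z 1 g (U1 (z + h) - U1 z).
    move=> z1 z2; apply: is_deriveB; last by apply: dU2; apply/andP; split; lra.
    by apply: shift; apply: dU2; apply/andP; split; lra.
  have xh : x < x + h by rewrite ltrDl.
  have cont (F : R -> R) (F' z : R) : is_derive z 1 F F' -> {for z, continuous F}.
    by move=> dF; apply: differentiable_continuous; apply/derivable1_diffP; exact: ex_derive.
  have [z] : exists2 z, z \in `]x, (x + h)[ & g (x + h) - g x = (U1 (z + h) - U1 z) * (x + h - x).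
    apply: MVT => // [z|].
      by rewrite in_itv/= => /andP[z1 z2]; apply: dg; lra.
    apply: continuous_in_subspaceT => z; rewrite inE/= in_itv/= => /andP[z1 z2].
    by apply: cont (dg z _ _); lra.
  rewrite in_itv/= => /andP[z1 z2] gE; have zh : z < z + h by rewrite ltrDl.
  have [t] : exists2 t, t \in `]z, (z + h)[ & U1 (z + h) - U1 z = f t * (z + h - z).
    apply: MVT => // [t|].
      by rewrite in_itv/= => /andP[t1 t2]; apply: dU1; apply/andP; split; lra.
    apply: continuous_in_subspaceT => t; rewrite inE/= in_itv/= => /andP[t1 t2].
    by apply: cU1; apply/andP; split; lra.
  rewrite in_itv/= => /andP[t1 t2] UE.
  have -> : D2 U2 x = f t.
    have -> : D2 U2 x = h^-2 * (g (x + h) - g x).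
      rewrite /D2 /g (_ : x + h + h = x + 2 * h); last by ring.
      by congr (_ * _); ring.
    rewrite gE UE (_ : x + h - x = h); last by ring.
    by rewrite (_ : z + h - z = h); [field; rewrite gt_eqF|ring].
  by apply: ltW; apply: fd; [apply/andP; split; lra|rewrite ltr_norml; apply/andP; split; lra].
Unshelve. all: by end_near. Qed.

Lemma near_eq_is_derive1 F f (g : R -> R) x : {near x, f =1 g} ->
  is_derive x 1 f F -> is_derive x 1 g F.
Proof.
move=> fg [df <-]; have dg := near_eq_derivable fg df.
by apply: (DeriveDef dg); exact/esym/near_eq_derive.
Qed.

Definition C1_on J f f' := forall x, J x -> is_derive x 1 f (f' x) /\ {for x, continuous f'}.

Notation J2 := `]-2, 2[%classic.

Lemma C1_near (f g f' : R -> R) : C1_on J2 f f' -> {in J2, f =1 g} -> C1_on J2 g f'.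
Proof.
move=> ff' fg x Jx; have [df cf] := ff' x Jx; split => //.
apply: near_eq_is_derive1 df; near=> z; apply: fg; rewrite inE.
by near: z; exact: near_in_itvoo.
Unshelve. all: by end_near. Qed.

Lemma C1_derive1 f f' x : C1_on J2 f f' -> J2 x -> f^`()%classic x = f' x.
Proof. by move=> h Jx; have [df _] := h x Jx; rewrite derive1E; exact: derive_val. Qed.

Lemma I1_J2 x : -1 <= x <= 1 -> J2 x.
Proof. by rewrite /= in_itv/= => /andP[? ?]; apply/andP; split; lra. Qed.

Lemma C1_loc_abs_cont f f' : C1_on J2 f f' -> loc_abs_cont I f.
Proof.
move=> ff' a b ab abI.
have J z : a <= z <= b -> J2 z.
  move=> zab; apply: I1_J2; have /abI/I1_bounds/andP[? ?] : `[a, b]%classic z by rewrite /= in_itv.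
  by rewrite !ltW.
apply: C1_abs_cont => // z /J Jz; first by have [/@ex_derive] := ff' z Jz.
rewrite /prop_for /continuous_at (C1_derive1 ff' Jz).
apply: cvg_trans (ff' z Jz).2; apply: near_eq_cvg; near=> t.
apply/esym/(C1_derive1 ff'); near: t; exact: near_in_itvoo.
Unshelve. all: by end_near. Qed.

Lemma continuous_L2 f : (forall x, -1 <= x <= 1 -> {for x, continuous f}) -> L2 f.
Proof.
move=> cf.
have cn : {within `[-1, 1], continuous (fun x => `|f x|)}.
  apply: continuous_in_subspaceT => x; rewrite inE /= in_itv/= => xI.
  by apply: (@continuous_comp _ _ _ f); [exact: cf|exact: norm_continuous].
have l11 : -1 <= 1 :> R by lra.
have [c _ fc] := EVT_max l11 cn.
have I1b x : I x -> -1 <= x <= 1 by move=> /I1_bounds/andP[? ?]; rewrite !ltW.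
apply: (@bounded_L2 _ `|f c|); last by move=> x /I1b xI; apply: fc; rewrite in_itv.
by apply: continuous_measurable_I1 => x /I1b; exact: cf.
Qed.

Lemma Lp_eq p (J : set R) f g : {in J, f =1 g} -> Lp p J f -> Lp p J g.
Proof. by rewrite /Lp => /eq_restrictP ->. Qed.

Lemma is_derive_continuous f F x : is_derive x 1 f F -> {for x, continuous f}.
Proof.
by move=> df; apply: differentiable_continuous; apply/derivable1_diffP; exact: ex_derive.
Qed.

(** The flux rho f' vanishes at -1 and 1 because rho does. *)
Lemma C2_domA f f1 f2 : C1_on J2 f f1 -> C1_on J2 f1 f2 -> domA f.
Proof.
move=> cf cf1; pose w x := rho x * f1 x; pose w' x := rho x * f2 x - 2 * x * f1 x.
have cw : C1_on J2 w w'.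
  move=> x Jx; have [d1 c1] := cf1 x Jx; split.
    have dr : is_derive x 1 (@rho R) (- (2 * x)).
      have := is_deriveB (is_derive_cst (1 : R) x 1) (is_deriveX 2 (is_derive_id x (1 : R))).
      rewrite sub0r /= => h; apply: is_derive_eq h _.
      by rewrite expr1 /GRing.scale /= mulr1.
    apply: is_derive_eq (is_deriveM dr d1) _; rewrite /w' /GRing.scale /=; ring.
  apply: cvgB; first by apply: cvgM; [exact: continuous_rho|exact: c1].
  apply: cvgM; last exact: is_derive_continuous d1.
  by apply: cvgM; [exact: cvg_cst|exact: cvg_id].
have wE : {in J2, w =1 rho_deriv f}.
  by move=> x /set_mem Jx; rewrite /w /rho_deriv (C1_derive1 cf).
have cv := C1_near cw wE.
have lim0 z : -1 <= z <= 1 -> rho z = 0 -> rho_deriv f x @[x --> z] --> (0 : R).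
  move=> /I1_J2 Jz rz; have := is_derive_continuous (cv z Jz).1.
  by rewrite /prop_for /continuous_at [X in _ --> X](_ : _ = 0)// /rho_deriv rz mul0r.
split.
- by apply: continuous_L2 => x /I1_J2 Jx; exact: is_derive_continuous (cf x Jx).1.
- exact: C1_loc_abs_cont cf.
split; last 2 first.
- by apply/cvg_at_right_filter/lim0; [apply/andP; split; lra|rewrite /rho; ring].
- by apply/cvg_at_left_filter/lim0; [apply/andP; split; lra|rewrite /rho; ring].
split.
- by apply: continuous_L2 => x /I1_J2 Jx; exact: is_derive_continuous (cv x Jx).1.
- exact: C1_loc_abs_cont cv.
- apply: (@Lp_eq _ _ w').
    move=> x /set_mem/I1_bounds/andP[x1 x2]; rewrite (C1_derive1 cv)//; apply: I1_J2.
    by rewrite !ltW.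
  by apply: continuous_L2 => x /I1_J2 Jx; exact: (cv x Jx).2.
Qed.

(** A continuous function equal to 1 on [[-r, r]] and to 0 near -1 and 1. *)
Definition cutoff (r x : R) : R :=
  Num.max 0 (Num.min 1 (((1 + r) / 2 - `|x|) / ((1 - r) / 2))).

Lemma cutoff_bounds r x : 0 <= cutoff r x <= 1.
Proof. by rewrite /cutoff le_max lexx/= ge_max ler01 ge_min lexx. Qed.

Lemma cutoff_eq1 r x : r < 1 -> `|x| <= r -> cutoff r x = 1.
Proof.
move=> r1 xr; rewrite /cutoff (min_idPl _); first by rewrite (max_idPr _).
by rewrite ler_pdivlMr; lra.
Qed.

Lemma cutoff_eq0 r x : r < 1 -> (1 + r) / 2 <= `|x| -> cutoff r x = 0.
Proof.
move=> r1 xr; rewrite /cutoff (max_idPl _)// ge_min; apply/orP; right.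
by rewrite ler_pdivrMr; lra.
Qed.

Lemma continuous_cutoff r : continuous (cutoff r).
Proof.
move=> x.
have c3 : {for x, continuous (fun x => ((1 + r) / 2 - `|x|) / ((1 - r) / 2))}.
  apply: cvgM; last exact: cvg_cst.
  by apply: cvgB; [exact: cvg_cst|exact: norm_continuous].
have c1 z : {for x, continuous (cst z : R -> R)} by exact: cst_continuous.
exact: (@continuous_max R R _ _ x (c1 0) (@continuous_min R R _ _ x (c1 1) c3)).
Qed.

Lemma continuous_cutoffM r f : r < 1 -> (forall x, I x -> {for x, continuous f}) ->
  continuous (fun x => cutoff r x * f x).
Proof.
move=> r1 cf x; have [xr|xr] := ltP `|x| 1.
  apply: cvgM; first exact: continuous_cutoff.
  by apply: cf; rewrite /I1 /= in_itv/= -ltr_norml.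
have c0 z : (1 + r) / 2 < `|z| -> cutoff r z * f z = 0.
  by move=> /ltW zr; rewrite cutoff_eq0// mul0r.
rewrite /continuous_at c0; last lra.
have h : (cst 0 : R -> R) z @[z --> x] --> (0 : R) by exact: cvg_cst.
apply: cvg_trans h; apply: near_eq_cvg; near=> z.
rewrite c0//; near: z.
apply/nbhs_ballP; exists ((1 - r) / 2); first by rewrite /= divr_gt0// subr_gt0.
move=> z; rewrite /ball /= => xz; have := lerB_dist x z; lra.
Unshelve. all: by end_near. Qed.

(** Cut the function off near -1 and 1, then average it. *)
Lemma domA_dense f e : (forall x, I x -> {for x, continuous f}) -> L2 f -> 0 < e ->
  exists2 g, domA g & normH (f - g) <= e.
Proof.
move=> cf L2f e0; have [mf if2] := iffLR (L2P _) L2f.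
pose r n : R := 1 - n.+2%:R^-1.
have r1 n : r n < 1 by have [] := @inner_itv_bounds R n.
pose g n x := cutoff (r n) x * f x.
have cg n : continuous (g n) by exact: continuous_cutoffM.
have L2g n : L2 (g n).
  apply: (L2_dominated L2f); first by apply: continuous_measurable_I1 => x _; exact: cg.
  move=> x _; rewrite /g normrM; have /andP[h1 h2] := cutoff_bounds (r n) x.
  by rewrite (ger0_norm h1) ler_piMl.
have [n fgn] : exists n, normH (f - g n) <= e / 2.
  have := Rintegral_inner_cvg if2; move=> /cvgrPdist_le /(_ (e / 2 * (e / 2))).
  move=> /(_ ltac:(by rewrite mulr_gt0// divr_gt0))[n _ /(_ n (leqnn n)) h]; exists n.
  rewrite -(ler_pXn2r (n := 2))// ?nnegrE ?normH_ge0 ?divr_ge0 ?(ltW e0)//.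
  rewrite normH_sqr; apply: le_trans h; apply: le_trans (ler_norm _).
  rewrite lerBrDr.
  have -> : \int[mu]_(x in inner_itv n) (f x ^+ 2) =
      \int[mu]_(x in I) (((fun x => f x ^+ 2) \_ (@inner_itv R n)) x).
    rewrite -Rintegral_mkcondr; congr (\int[mu]_(x in _) _).
    by rewrite setIidr//; exact: inner_itv_sub.
  have fg2 := L2_integrable_sqr (L2B L2f (L2g n)).
  have mi : measurable (@inner_itv R n : set (measurableTypeR R)) by exact: measurable_itv.
  have if2n : mu.-integrable I (EFin \o ((fun x => f x ^+ 2) \_ (@inner_itv R n))).
    apply: (le_integrable (@measurable_I1 R) _ _ if2).
      apply/measurable_EFinP; apply/(measurable_restrict _ mi (@measurable_I1 R)).
      apply: (@measurable_funS _ _ _ _ I); [exact: measurable_I1|by move=> x []|].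
      exact: measurable_funX.
    by move=> x Ix /=; rewrite lee_fin patchE; case: ifPn => // _; rewrite (_ : point = 0)// normr0.
  rewrite -RintegralD//; last exact: measurable_I1.
  apply: le_Rintegral => //; first exact: measurable_I1.
    by have := integrableD (@measurable_I1 R) fg2 if2n; apply: eq_integrable => //; exact: measurable_I1.
  move=> x Ix; rewrite patchE (_ : (f - g n) x = f x - g n x)// /g.
  have /andP[h1 h2] := cutoff_bounds (r n) x; have fx := sqr_ge0 (f x).
  case: ifPn => [/set_mem xn|_].
    rewrite cutoff_eq1 ?mul1r ?subrr ?expr0n ?add0r//.
    move: xn; rewrite /inner_itv /= in_itv/= ler_norml /r; move: (n.+2%:R^-1) => z /andP[? ?].
    by apply/andP; split; lra.
  rewrite (_ : point = 0)// addr0 (_ : f x - _ = (1 - cutoff (r n) x) * f x); last by ring.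
  rewrite exprMn ler_piMl// -(expr1n R 2) lerXn2r ?nnegrE ?subr_ge0//; lra.
have e4 : 0 < e / 4 by rewrite divr_gt0.
have [y [y1 [y2 [dy dy1 cy2 gy]]]] := C2_approximation (cg n) e4.
have Dy : domA y.
  apply: (@C2_domA _ y1 y2) => x; rewrite /= in_itv/= => Jx.
    by split; [exact: dy|exact: is_derive_continuous (dy1 x Jx)].
  by split; [exact: dy1|exact: cy2].
exists y => //; have [L2y _ _] := Dy.
rewrite (_ : f - y = (f - g n) + (g n - y)); last by rewrite addrA subrK.
apply: le_trans (normHD (L2B L2f (L2g n)) (L2B (L2g n) L2y)) _.
suff : normH (g n - y) <= 2 * `|e / 4| by rewrite gtr0_norm//; lra.
apply: ae_bounded_normH; first exact: L2B.
apply: aeW => x /I1_bounds/andP[x1 x2]; rewrite (_ : (_ - _) x = g n x - y x)//.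
by apply: gy; apply/andP; split; lra.
Qed.

End density.

(** * The Duhamel formula *)

Section mild_increment.
Context {R : realType} (S : R -> fun2 R -> fun2 R).
Hypothesis CS : C0_semigroup S.
Implicit Types (u v w z : fun2 R) (t h e : R).

Lemma eqHH_sum (a b : nat -> fun2 R) n : (forall i, (i < n)%N -> eqHH (a i) (b i)) ->
  eqHH (\sum_(i < n) a i) (\sum_(i < n) b i).
Proof.
elim: n => [|n IH] ab; first by rewrite !big_ord0; exact: eqHH_refl.
rewrite !big_ord_recr /=; apply: eqHHD; last exact: ab.
by apply: IH => i /ltnW; exact: ab.
Qed.

Lemma inHH_sum (a : nat -> fun2 R) n : (forall i, (i < n)%N -> inHH (a i)) ->
  inHH (\sum_(i < n) a i).
Proof.
elim: n => [|n IH] ab; first by rewrite big_ord0; exact: inHH0.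
by rewrite big_ord_recr /=; apply: inHHD; [apply: IH => i /ltnW; exact: ab|exact: ab].
Qed.

Lemma normS_sum (a : nat -> fun2 R) (b : nat -> R) n :
  (forall i, (i < n)%N -> inHH (a i) /\ normS (a i) <= b i) ->
  normS (\sum_(i < n) a i) <= \sum_(i < n) b i.
Proof.
elim: n => [|n IH] ab; first by rewrite !big_ord0 normS0.
rewrite !big_ord_recr /=; apply: le_trans (normSD _ _) _.
- by apply: inHH_sum => i /ltnW /ab[].
- by have [] := ab n (ltnSn n).
by apply: lerD; [apply: IH => i /ltnW; exact: ab|have [] := ab n (ltnSn n)].
Qed.

Lemma semigroup_sum t (c : nat -> R) (a : nat -> fun2 R) n : 0 <= t ->
  (forall i, (i < n)%N -> inHH (a i)) ->
  eqHH (S t (\sum_(i < n) c i *: a i)) (\sum_(i < n) c i *: S t (a i)).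
Proof.
move=> t0; elim: n => [|n IH] aH.
  rewrite !big_ord0; apply: normS_eqHH; rewrite ?subr0; try exact: inHH0.
    exact: (semigroup_inHH CS t0 (@inHH0 R)).
  by have := semigroup_normSZ CS 0 t0 (@inHH0 R); rewrite scale0r normr0 mul0r.
have aH' i : (i < n)%N -> inHH (a i) by move=> /ltnW; exact: aH.
have sH : inHH (\sum_(i < n) c i *: a i) 
  by apply: (@inHH_sum (fun i => c i *: a i)) => i /aH'; exact: inHHZ.
rewrite !big_ord_recr /= addrC; apply: eqHH_trans (semigroup_lin CS _ t0 (aH n _) sH) _ => //.
by rewrite [X in eqHH X _]addrC; apply: eqHHD; [exact: IH|exact: eqHH_refl].
Qed.

Definition two_step_partition t h n (k : nat) : R :=
  if (k <= n)%N then t * (k%:R / n%:R) else t + h * ((k - n)%:R / n%:R).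

Lemma two_step_lo t h n k : (k <= n)%N -> two_step_partition t h n k = t * (k%:R / n%:R).
Proof. by rewrite /two_step_partition => ->. Qed.

Lemma two_step_hi t h n k : (0 < n)%N ->
  two_step_partition t h n (n + k) = t + h * (k%:R / n%:R).
Proof.
move=> n0; rewrite /two_step_partition -{2}[n]addn0 leq_add2l leqn0.
case: k => [|k] /=; last by rewrite addKn.
by rewrite addn0 divff ?pnatr_eq0 -?lt0n// mulr1 mul0r mulr0 addr0.
Qed.

Lemma step_le t n k : 0 <= t -> (k <= n)%N -> 0 <= t * (k%:R / n%:R) <= t.
Proof.
move=> t0 kn; rewrite mulr_ge0//= ler_piMr//.
by case: n kn => [|n] kn; rewrite ?invr0 ?mulr0// ler_pdivrMr ?mul1r ?ler_nat ?ltr0n.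
Qed.

Lemma uniform_step t n k : t * (k.+1%:R / n%:R) - t * (k%:R / n%:R) = t / n%:R.
Proof. by rewrite -mulrBr -mulrBl -natrB// subSnn mul1r. Qed.

Lemma is_integralHH_bound f a b v e : is_integralHH f a b v -> 0 < e ->
  exists2 d, 0 < d & forall n p c, tagged_partition a b d n p c ->
    normS (\sum_(i < n) (p i.+1 - p i) *: f (c i) - v) < e.
Proof.
move=> [_ _ fv] e0; have [d d0 fd] := fv _ (divr_gt0 e0 (ltr0n R 2)).
exists d => // n p c /fd h; apply: le_lt_trans (normS_le_normHH _) _.
by rewrite mulrC -ltr_pdivlMr.
Qed.

Variables (g : R -> fun2 R) (T0 : fun2 R) (T : R -> fun2 R) (K d : R).
Hypothesis K_ge0 : 0 <= K.
Hypothesis S_bound : forall h u, 0 <= h <= d -> inHH u -> normS (S h u) <= K * normS u.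
Hypothesis T0_inHH : inHH T0.
Hypothesis T_inHH : forall t, 0 <= t -> inHH (T t).
Hypothesis g_inHH : forall t, 0 <= t -> inHH (g t).
Hypothesis T_mild : forall t, 0 <= t -> exists2 v,
  is_integralHH (fun s => S (t - s) (g s)) 0 t v & eqHH (T t) (S t T0 + v).

(** The Duhamel formula on [[t, t + h]], in the form of an estimate. The mild
    solution is given by two separate integrals, on [[0, t]] and on [[0, t +
    h]]. Riemann sums for them with the same points in [[0, t]] correspond to
    each other under S h, and the part of the second sum in [[t, t + h]] is
    close to h z. *)
Lemma mild_increment t h z eta eta' : 0 <= t -> 0 <= h <= d -> inHH z ->
  (forall s, t <= s <= t + h -> normS (g s - z) <= eta) ->
  (forall r, 0 <= r <= h -> normS (S r z - z) <= eta') ->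
  normS (T (t + h) - S h (T t) - h *: z) <= h * (K * eta + eta').
Proof.
move=> t0 /andP[h0 hd] zH gz Sz; have th0 : 0 <= t + h by exact: addr_ge0.
have [v1 i1 T1] := T_mild t0; have [v2 i2 T2] := T_mild th0.
have [_ v1H _] := i1; have [_ v2H _] := i2.
have [M M0 SM] := semigroup_bound CS h0.
have Sv1H := semigroup_inHH CS h0 v1H.
have StH := semigroup_inHH CS t0 T0_inHH.
have -> : normS (T (t + h) - S h (T t) - h *: z) = normS (v2 - S h v1 - h *: z).
  apply: eqHH_normS.
  - apply: inHHB; last exact: inHHZ.
    by apply: inHHB; [exact: T_inHH|exact: (semigroup_inHH CS h0 (T_inHH t0))].
  - by apply: inHHB; [exact: inHHB|exact: inHHZ].
  apply: eqHHB; last exact: eqHH_refl.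
  have e1 : eqHH (S h (T t)) (S (t + h) T0 + S h v1).
    apply: eqHH_trans (semigroup_eqHH CS h0 (T_inHH t0) (inHHD StH v1H) T1) _.
    have := semigroup_lin CS 1 h0 StH v1H; rewrite !scale1r => /eqHH_trans; apply.
    apply: eqHHD; last exact: eqHH_refl.
    by apply: eqHH_sym; rewrite addrC; exact: semigroupD.
  have := eqHHB T2 e1; rewrite opprD addrA [_ + v2 - _]addrAC subrr add0r.
  by apply.
apply/ler_addgt0Pr => e e0.
have e'0 : 0 < e / (M + 1) by rewrite divr_gt0// ltr_wpDl.
have [d1 d10 H1] := is_integralHH_bound i1 e'0.
have [d2 d20 H2] := is_integralHH_bound i2 e'0.
pose m := Num.min d1 d2; have m0 : 0 < m by rewrite lt_min d10.
pose n := (Num.truncn ((t + h) / m)).+1.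
have n0 : (0 < n)%N by [].
have nR : 0 < n%:R :> R by rewrite ltr0n.
have thn : (t + h) / n%:R < m.
  by rewrite ltr_pdivrMr// mulrC -ltr_pdivrMr//; exact: truncnS_gt.
have tn : t / n%:R < m by apply: le_lt_trans thn; rewrite ler_wpM2r ?invr_ge0 ?(ltW nR)// lerDl.
have hn : h / n%:R < m by apply: le_lt_trans thn; rewrite ler_wpM2r ?invr_ge0 ?(ltW nR)// lerDr.
have md1 : m <= d1 by rewrite ge_min lexx.
have md2 : m <= d2 by rewrite ge_min lexx orbT.
pose p k := t * (k%:R / n%:R) : R; pose p' := two_step_partition t h n.
have plo k : (k <= n)%N -> p' k = p k by exact: two_step_lo.
have phi k : p' (n + k)%N = t + h * (k%:R / n%:R) by exact: two_step_hi.
have stepE c k : c * (k.+1%:R / n%:R) = c * (k%:R / n%:R) + c / n%:R :> R.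
  by rewrite -(uniform_step c n k) addrC subrK.
have inc (x c r : R) : 0 <= c -> c < r -> [/\ x <= x, x <= x + c & x + c - x < r].
  by move=> c0 cr; split; [exact: lexx|rewrite lerDl|rewrite (addrC x) addrK].
have tn0 : 0 <= t / n%:R by rewrite divr_ge0.
have hn0 : 0 <= h / n%:R by rewrite divr_ge0.
have P1 : tagged_partition 0 t d1 n p p.
  split; first by rewrite /p mul0r mulr0.
    by rewrite /p divff ?mulr1// gt_eqF.
  by move=> i _; rewrite /p stepE; apply: inc => //; exact: lt_le_trans md1.
have P2 : tagged_partition 0 (t + h) d2 (n + n) p' p'.
  split; first by rewrite plo// /p mul0r mulr0.
    by rewrite phi divff ?mulr1// gt_eqF.
  move=> i _; have [ni|ni] := leqP n i.
    rewrite -(subnKC ni) -addnS !phi stepE addrA.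
    by apply: inc => //; exact: lt_le_trans md2.
  by rewrite !plo ?(ltnW ni)// /p stepE; apply: inc => //; exact: lt_le_trans md2.
have pt k : (k <= n)%N -> 0 <= p k <= t by exact: step_le.
have ht k : (k <= n)%N -> 0 <= h * (k%:R / n%:R) <= h by exact: step_le.
have kn k : (k < n)%N -> (k <= n)%N by exact: ltnW.
pose a1 i := S (t - p i) (g (p i)).
have a1H i : (i < n)%N -> inHH (a1 i).
  by move=> /kn/pt/andP[q0 q1]; apply: (semigroup_inHH CS); [rewrite subr_ge0|exact: g_inHH].
pose Sum1 := \sum_(i < n) (p i.+1 - p i) *: a1 i.
have Sum1H : inHH Sum1 
  by apply: (@inHH_sum (fun i => (p i.+1 - p i) *: a1 i)) => i /a1H; exact: inHHZ.
pose a2 i := S (t + h - p i) (g (p i)).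
have a2H i : (i < n)%N -> inHH (a2 i).
  move=> /kn/pt/andP[q0 q1]; apply: (semigroup_inHH CS); last exact: g_inHH.
  by rewrite subr_ge0 (le_trans q1)// lerDl.
pose SumA := \sum_(i < n) (p i.+1 - p i) *: a2 i.
have SumAH : inHH SumA 
  by apply: (@inHH_sum (fun i => (p i.+1 - p i) *: a2 i)) => i /a2H; exact: inHHZ.
have SA : eqHH (S h Sum1) SumA.
  apply: eqHH_trans (semigroup_sum (fun i => p i.+1 - p i) h0 a1H) _.
  apply: (@eqHH_sum (fun i => (p i.+1 - p i) *: S h (a1 i)) (fun i => (p i.+1 - p i) *: a2 i)) => i ilt.
  apply: eqHHZ; rewrite /a1 /a2.
  have /andP[q0 q1] := pt i (kn i ilt).
  rewrite (_ : t + h - p i = h + (t - p i)); last by ring.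
  apply/eqHH_sym/semigroupD => //; first by rewrite subr_ge0.
  exact: g_inHH.
pose s i := t + h * (i%:R / n%:R).
pose a3 i := S (t + h - s i) (g (s i)).
pose SumB := \sum_(i < n) (s i.+1 - s i) *: a3 i.
have a3H i : (i < n)%N -> inHH (a3 i) /\ normS (a3 i - z) <= K * eta + eta'.
  move=> /kn/ht/andP[q0 q1].
  have s0 : 0 <= s i by rewrite addr_ge0.
  have r0 : 0 <= t + h - s i <= h.
    rewrite (_ : t + h - s i = h - h * (i%:R / n%:R)); last by rewrite /s; ring.
    by rewrite subr_ge0 q1 gerBl.
  have /andP[r1 r2] := r0.
  have gH := g_inHH s0; have SgH := semigroup_inHH CS r1 gH; have SzH := semigroup_inHH CS r1 zH.
  split => //; apply: le_trans (normS_trans SgH zH SzH) _; apply: lerD; last exact: Sz.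
  rewrite semigroup_normSB//; apply: le_trans (S_bound _ _) _; last first.
  - by rewrite ler_wpM2l//; apply: gz; rewrite /s lerDl lerD2l q0.
  - exact: inHHB.
  - by rewrite r1 (le_trans r2).
have SumBH : inHH SumB 
  by apply: (@inHH_sum (fun i => (s i.+1 - s i) *: a3 i)) => i /a3H[? _]; exact: inHHZ.
have sumE : \sum_(i < n + n) (p' i.+1 - p' i) *: S (t + h - p' i) (g (p' i)) = SumA + SumB.
  rewrite big_split_ord.
  have -> : SumA = \sum_(i < n) (p' (lshift n i).+1 - p' (lshift n i)) *:
      S (t + h - p' (lshift n i)) (g (p' (lshift n i))).
    apply: eq_bigr => i _; have ilt := ltn_ord i; rewrite [nat_of_ord (lshift _ _)]/=.
    by rewrite (plo i.+1 ilt) (plo i (ltnW ilt)).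
  have -> : SumB = \sum_(i < n) (p' (rshift n i).+1 - p' (rshift n i)) *:
      S (t + h - p' (rshift n i)) (g (p' (rshift n i))).
    by apply: eq_bigr => i _; rewrite [nat_of_ord (rshift _ _)]/= -addnS !phi.
  by [].
have sE i : s i.+1 - s i = h / n%:R by rewrite /s stepE; ring.
have hzE : h *: z = \sum_(i < n) (s i.+1 - s i) *: z.
  rewrite -scaler_suml; congr (_ *: _).
  transitivity (\sum_(i < n) (h / n%:R)).
    by rewrite sumr_const card_ord -[RHS]mulr_natr divfK ?gt_eqF.
  by apply: eq_bigr => i _; rewrite sE.
have Bz : normS (SumB - h *: z) <= h * (K * eta + eta').
  rewrite hzE -sumrB.
  have := @normS_sum (fun i => (s i.+1 - s i) *: a3 i - (s i.+1 - s i) *: z)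
    (fun i => h / n%:R * (K * eta + eta')) n.
  rewrite sumr_const card_ord -[X in _ <= X]mulr_natr mulrAC divfK ?gt_eqF//; apply.
  move=> i ilt; have [aH az] := a3H i ilt; split; first by apply: inHHB; exact: inHHZ.
  rewrite -scalerBr normSZ; last exact: inHHB.
  by rewrite sE ger0_norm// [leRHS]mulrAC ler_wpM2l.
have n1 : normS (SumA + SumB - v2) < e / (M + 1) by rewrite -sumE; exact: H2 P2.
have n2 : normS (Sum1 - v1) < e / (M + 1) by exact: H1 P1.
have hzH : inHH (h *: z) by exact: inHHZ.
have n3 : normS (SumA - S h v1) <= M * (e / (M + 1)).
  have -> : normS (SumA - S h v1) = normS (S h Sum1 - S h v1).
    apply: eqHH_normS; [exact: inHHB|apply: inHHB => //; exact: (semigroup_inHH CS h0 Sum1H)|].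
    by apply: eqHHB; [exact: eqHH_sym|exact: eqHH_refl].
  rewrite semigroup_normSB//; apply: le_trans (SM _ _) _; first exact: inHHB.
  by rewrite ler_wpM2l// ltW.
have -> : v2 - S h v1 - h *: z =
    - (SumA + SumB - v2) + ((SumA - S h v1) + (SumB - h *: z)).
  by rewrite opprB (addrACA SumA) -opprD addrA subrK opprD addrA.
apply: le_trans (normSD _ _) _.
- by apply: inHHN; apply: inHHB => //; exact: inHHD.
- by apply: inHHD; exact: inHHB.
rewrite normSN; last by apply: inHHB => //; exact: inHHD.
have n4 := normSD (inHHB SumAH Sv1H) (inHHB SumBH hzH).
have e1 : e = e / (M + 1) + M * (e / (M + 1)) by field; rewrite gt_eqF// ltr_wpDl.
by rewrite [X in _ <= _ + X]e1; move: (e / (M + 1)) n1 n3 => ee n1 n3; lra.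
Qed.

End mild_increment.

Lemma duhamel_rearrangement (V : zmodType) (a b c e F T s s' : V) :
  a - b - (s - F - c) - (T - s' - b) = F - T - (e - a) - (s - s') + (c + e).
Proof.
rewrite !opprB !addrA [LHS](ACl (1*3*4*5*7*8*6*2)) /= addrK.
by rewrite [RHS](ACl (3*7*1*6*5*2*8*4)) /= addrK.
Qed.

(** * Comparison of a stationary state with a mild solution *)

Section comparison.
Context {R : realType}.
Notation mu := (@lebesgue_measure R).
Notation I := (@I1 R).
Notation L2 := (@Lp R 2%:E I).
Implicit Types (u v w z : fun2 R) (t h e x : R).
Variables (gamma_a gamma_s kappa_a kappa_s : R).
Hypotheses (gamma_a_gt0 : 0 < gamma_a) (gamma_s_gt0 : 0 < gamma_s).
Hypotheses (kappa_a_gt0 : 0 < kappa_a) (kappa_s_gt0 : 0 < kappa_s).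

(** A weighted measure of how far [w] is from being non-positive; the factors
    1 and 2 are those of react_one_sided. *)
Definition excess w : R := gamma_a * posint w.1 + 2 * (gamma_s * posint w.2).

Lemma excess_ge0 w : 0 <= excess w.
Proof. by rewrite addr_ge0// !mulr_ge0// ?posint_ge0 ?ltW. Qed.

Let C0 := 2 * gamma_a + 4 * gamma_s.
Let C0_ge0 : 0 <= C0. Proof. by rewrite addr_ge0// mulr_ge0// ltW. Qed.

Lemma excess_lipschitz u v : inHH u -> inHH v -> excess u <= excess v + C0 * normS (u - v).
Proof.
move=> [u1 u2] [v1 v2]; have := posint_le u1 v1; have := posint_le u2 v2.
have := normH_ge0 (u - v).1; have := normH_ge0 (u - v).2.
rewrite /excess /normS /C0 (_ : (u - v).1 = u.1 - v.1)// (_ : (u - v).2 = u.2 - v.2)//.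
move: (normH _) (normH _) => n1 n2 n20 n10 /(ler_wpM2l (ltW gamma_s_gt0)) p2.
move=> /(ler_wpM2l (ltW gamma_a_gt0)) p1.
have : 0 <= gamma_a * n2 by rewrite mulr_ge0// ltW.
have : 0 <= gamma_s * n1 by rewrite mulr_ge0// ltW.
lra.
Qed.

Lemma excess_resolvent w h : domAA w -> 0 <= h ->
  excess w <= excess (w - h *: opAA kappa_a kappa_s w).
Proof.
move=> [D1 D2] h0; have c0 (f : R -> R) : f - cst 0 = f by exact: subr0.
have h1 : 0 <= h * kappa_a by rewrite mulr_ge0// ltW.
have h2 : 0 <= h * kappa_s by rewrite mulr_ge0// ltW.
have := domA_resolvent_posint 0 D1 h1; have := domA_resolvent_posint 0 D2 h2.
rewrite !c0 => p2 p1.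
have E1 : (w - h *: opAA kappa_a kappa_s w).1 = w.1 - (h * kappa_a) *: opA w.1.
  by rewrite -scalerA.
have E2 : (w - h *: opAA kappa_a kappa_s w).2 = w.2 - (h * kappa_s) *: opA w.2.
  by rewrite -scalerA.
rewrite /excess E1 E2 lerD ?(ler_pM2l gamma_a_gt0)//.
have g2 : 0 < 2 * gamma_s by rewrite mulr_gt0.
by rewrite !(mulrA 2) (ler_pM2l g2); exact: p2.
Qed.

Lemma domAA_inHH w : domAA w -> inHH w /\ inHH (opAA kappa_a kappa_s w).
Proof.
by move=> [/domA_L2[? ?] /domA_L2[? ?]]; split; split => //=; exact: L2Z.
Qed.

Variables (S : R -> fun2 R -> fun2 R).
Hypothesis gen : semigroup_generated_by (@domAA R) (opAA kappa_a kappa_s) S.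
Let CS : C0_semigroup S := gen.1.
Variables (K d : R).
Hypotheses (K_ge0 : 0 <= K) (d_gt0 : 0 < d).
Hypothesis S_bound : forall h u, 0 <= h <= d -> inHH u -> normS (S h u) <= K * normS u.

Definition continuous_I1 u := forall x, I x -> {for x, continuous u.1} /\ {for x, continuous u.2}.

(** On the domain of A this is accretive_contraction, whose hypothesis is the
    dispersivity of A; the domain is dense. *)
Lemma excess_contraction u h : continuous_I1 u -> inHH u -> 0 <= h <= d ->
  excess (S h u) <= excess u.
Proof.
move=> cu uH hd; have h0 : 0 <= h by case/andP: hd.
apply/ler_addgt0Pr => e e0; pose r := e / (C0 * (K + 1) + 1).
have c1 : 0 < C0 * (K + 1) + 1 by rewrite ltr_wpDl// mulr_ge0// addr_ge0.
have r2 : 0 < r / 2 by rewrite !divr_gt0.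
have [v1 D1 n1] := domA_dense (fun x Ix => (cu x Ix).1) uH.1 r2.
have [v2 D2 n2] := domA_dense (fun x Ix => (cu x Ix).2) uH.2 r2.
pose v : fun2 R := (v1, v2); have Dv : domAA v by [].
have [vH _] := domAA_inHH Dv.
have uv : normS (u - v) <= r by rewrite /normS [leRHS]splitr lerD.
have SuH := semigroup_inHH CS h0 uH; have SvH := semigroup_inHH CS h0 vH.
have e1 := excess_lipschitz SuH SvH; have e2 := excess_lipschitz vH uH.
have e3 := accretive_contraction gen domAA_inHH C0_ge0 K_ge0 excess_lipschitz
  excess_resolvent S_bound Dv hd.
have s1 : normS (S h u - S h v) <= K * r.
  rewrite (semigroup_normSB CS)//; apply: le_trans (S_bound hd (inHHB uH vH)) _.
  by rewrite ler_wpM2l.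
rewrite (normS_dist vH uH) in e2.
have q1 := ler_wpM2l C0_ge0 s1; have q2 := ler_wpM2l C0_ge0 uv.
have eE : e = (C0 * (K + 1) + 1) * r by rewrite /r mulrC divfK// gt_eqF.
have r0 : 0 < r by move: r2; lra.
by rewrite [X in _ + X]eE; lra.
Qed.

Variables (F GF : fun2 R) (g T : R -> fun2 R) (T0 : fun2 R) (C : R).
Hypotheses (DF : domAA F) (GF_inHH : inHH GF).
Hypothesis F_stationary : eqHH (opAA kappa_a kappa_s F + GF) 0.
Hypothesis T0_inHH : inHH T0.
Hypothesis T_inHH : forall t, 0 <= t -> inHH (T t).
Hypothesis T_cont_I1 : forall t, 0 <= t -> continuous_I1 (T t).
Hypothesis g_inHH : forall t, 0 <= t -> inHH (g t).
Hypothesis T_continuous : forall t e, 0 <= t -> 0 < e -> exists2 r, 0 < r &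
  forall s, 0 <= s -> `|s - t| < r -> normS (T s - T t) < e.
Hypothesis g_continuous : forall t e, 0 <= t -> 0 < e -> exists2 r, 0 < r &
  forall s, 0 <= s -> `|s - t| < r -> normS (g s - g t) < e.
Hypothesis T_mild : forall t, 0 <= t -> exists2 v,
  is_integralHH (fun s => S (t - s) (g s)) 0 t v & eqHH (T t) (S t T0 + v).
Hypothesis C_ge0 : 0 <= C.
Hypothesis one_sided : forall t h, 0 <= t -> 0 <= h ->
  (1 - C * h) * excess (F - T t) <= excess (F - T t - h *: (GF - g t)).
Hypothesis initial : excess (F - T 0) = 0.

Let F_inHH : inHH F := (domAA_inHH DF).1.

Lemma continuous_I1_sub u v : continuous_I1 u -> continuous_I1 v -> continuous_I1 (u - v).
Proof.
move=> cu cv x Ix; have [u1 u2] := cu x Ix; have [v1 v2] := cv x Ix.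
by split; exact: continuousB.
Qed.

Lemma domAA_continuous_I1 w : domAA w -> continuous_I1 w.
Proof. by move=> [[_ l1 _] [_ l2 _]] x Ix; split; exact: loc_abs_cont_continuous Ix. Qed.

Let w t := F - T t.
Let w_inHH t : 0 <= t -> inHH (w t).
Proof. by move=> t0; apply: inHHB; [exact: F_inHH|exact: T_inHH]. Qed.

(** An implicit Euler step. Both F and T satisfy the equation up to o(h), so
    that S h (F - T t) differs by o(h) from F - T (t + h) minus h times the
    difference of the reactions at the time t + h, to which [one_sided]
    applies. *)
Lemma excess_step t e : 0 <= t -> 0 < e -> exists2 r, 0 < r & forall h, 0 < h < r ->
  (1 - C * h) * excess (w (t + h)) <= excess (w t) + e * h.
Proof.
move=> t0 e0; pose c := C0 + 1; have c0 : 0 < c by rewrite ltr_wpDl.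
pose eta := e / (c * (K + 4)).
have eta0 : 0 < eta by rewrite divr_gt0// mulr_gt0// ltr_wpDl.
have [AFH AGH] : inHH (opAA kappa_a kappa_s F) /\ inHH (g t).
  by split; [exact: (domAA_inHH DF).2|exact: g_inHH].
have [r1 r10 SF] := generator_derivative gen domAA_inHH DF eta0.
have [r2 r20 Sg] := semigroup_continuous0 CS AGH eta0.
have [r3 r30 gg] := g_continuous t0 eta0.
pose r := Num.min (Num.min r1 r2) (Num.min r3 d).
exists r; first by rewrite !lt_min r10 r20 r30.
move=> h /andP[h0]; rewrite !lt_min => /andP[/andP[hr1 hr2] /andP[hr3 hd]].
have h0' := ltW h0; have th0 : 0 <= t + h by rewrite addr_ge0.
have h0d : 0 <= h <= d by rewrite h0' ltW.
have gH := g_inHH th0.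
apply: le_trans (one_sided th0 h0') _; rewrite -/(w (t + h)).
have ShT := semigroup_inHH CS h0' (T_inHH t0); have ShF := semigroup_inHH CS h0' F_inHH.
have incr : normS (T (t + h) - S h (T t) - h *: g t) <= h * (K * eta + eta).
  apply: (mild_increment CS K_ge0 S_bound T0_inHH T_inHH g_inHH T_mild) => //.
  - move=> s /andP[ts sh]; apply/ltW/gg; first exact: le_trans ts.
    by rewrite ger0_norm; lra.
  - by move=> s /andP[s0 sh]; apply/ltW/Sg; rewrite s0 (le_lt_trans sh).
have gth : normS (g (t + h) - g t) <= eta.
  by apply/ltW/gg => //; rewrite addrAC subrr add0r gtr0_norm.
have wH := w_inHH t0; have wthH := w_inHH th0.
have ShwH := semigroup_inHH CS h0' wH.
have GgH : inHH (GF - g (t + h)) by exact: inHHB.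
have lhsH : inHH (w (t + h) - h *: (GF - g (t + h))).
  by apply: inHHB => //; exact: inHHZ.
apply: le_trans (excess_lipschitz lhsH ShwH) _; apply: lerD.
  apply: excess_contraction => //.
  by apply: continuous_I1_sub; [exact: domAA_continuous_I1|exact: T_cont_I1].
pose X := S h F - F - h *: opAA kappa_a kappa_s F.
pose Y := T (t + h) - S h (T t) - h *: g t.
have XH : inHH X by apply: inHHB; [exact: inHHB|exact: inHHZ].
have YH : inHH Y by apply: inHHB; [apply: inHHB => //; exact: T_inHH|exact: inHHZ].
have nE : normS (w (t + h) - h *: (GF - g (t + h)) - S h (w t)) =
    normS (h *: (g (t + h) - g t) - X - Y).
  apply: eqHH_normS; first exact: inHHB.
    by apply: inHHB => //; apply: inHHB => //; apply: inHHZ; exact: inHHB.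
  have e1 := semigroupB CS h0' F_inHH (T_inHH t0).
  have e2 : eqHH (h *: (opAA kappa_a kappa_s F + GF)) 0.
    by have := eqHHZ h F_stationary; rewrite scaler0.
  have e3 := eqHHB (eqHH_refl (w (t + h) - h *: (GF - g (t + h)))) e1.
  apply: (eqHH_trans e3).
  have := eqHHD (eqHH_refl (w (t + h) - h *: (GF - g (t + h)) - (S h F - S h (T t)))) e2.
  rewrite addr0 => /eqHH_sym /eqHH_trans; apply.
  rewrite (_ : h *: (g (t + h) - g t) - X - Y = w (t + h) - h *: (GF - g (t + h)) -
    (S h F - S h (T t)) + h *: (opAA kappa_a kappa_s F + GF)); first exact: eqHH_refl.
  by rewrite /X /Y /w !scalerBr scalerDr; exact: duhamel_rearrangement.
rewrite nE.
have n1 := normSB (inHHB (inHHZ h (inHHB gH AGH)) XH) YH.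
have n2 := normSB (inHHZ h (inHHB gH AGH)) XH.
have n3 : normS (h *: (g (t + h) - g t)) <= h * eta.
  by rewrite normSZ; [rewrite gtr0_norm// ler_pM2l|exact: inHHB].
have n4 : normS X <= eta * h by apply: SF; rewrite h0.
have tot : normS (h *: (g (t + h) - g t) - X - Y) <= h * (eta * (K + 4)).
  have := mulr_gt0 h0 eta0; rewrite -/Y in incr; lra.
have eE : eta * (K + 4) = e / c by rewrite /eta; field; rewrite !gt_eqF// ltr_wpDl.
rewrite eE in tot; apply: le_trans (ler_wpM2l C0_ge0 tot) _.
have -> : C0 * (h * (e / c)) = e * h * (C0 / c) by ring.
by rewrite ler_piMr ?mulr_ge0 ?(ltW e0)// ler_pdivrMr// mul1r lerDl.
Qed.

(** The lemma of Gronwall, for exp (- 2 C t) times the excess; the rate 2 C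
    absorbs the factor 1 / (1 - C h) of excess_step. *)
Lemma excess_vanishes t : 0 <= t -> excess (w t) = 0.
Proof.
move=> t0; pose f s := expR (- (2 * C * s)) * excess (w s).
have ex0 s : 0 < expR (- (2 * C * s)) by exact: expR_gt0.
have ex1 s : 0 <= s -> expR (- (2 * C * s)) <= 1.
  by move=> s0; rewrite -expR0 ler_expR oppr_le0 !mulr_ge0.
suff : f t <= f 0.
  rewrite /f /w initial mulr0 pmulr_rle0// => le0.
  by apply/eqP; rewrite eq_le le0 excess_ge0.
have Tdist s r : 0 <= s -> 0 <= r -> `|excess (w s) - excess (w r)| <= C0 * normS (T s - T r).
  move=> s0 r0; have e1 := excess_lipschitz (w_inHH s0) (w_inHH r0).
  have e2 := excess_lipschitz (w_inHH r0) (w_inHH s0).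
  have n1 : normS (w s - w r) = normS (T s - T r).
    have -> : w s - w r = - (T s - T r) by rewrite /w opprD opprK addrACA subrr add0r addrC opprB.
    by rewrite normSN//; apply: inHHB; exact: T_inHH.
  have n2 : normS (w r - w s) = normS (T s - T r).
    by rewrite normS_dist ?n1//; exact: w_inHH.
  by rewrite n1 in e1; rewrite n2 in e2; rewrite ler_norml; apply/andP; split; lra.
apply: dini_nonincreasing => // [s /andP[s0 st] e e0|s /andP[s0 st] e e0].
- have c1 : 0 < C0 + 1 by rewrite ltr_wpDl.
  have [r1 r10 Tr] := T_continuous s0 (divr_gt0 e0 (mulr_gt0 (ltr0n R 2) c1)).
  pose m := excess (w s) + 1; have m0 : 0 < m by rewrite ltr_wpDl// excess_ge0.
  have cexp : {for s, continuous (fun s => expR (- (2 * C * s)))}.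
    apply: (@continuous_comp _ _ _ (fun s => - (2 * C * s))); last exact: continuous_expR.
    by apply: (@continuousN _ R); apply: cvgM; [exact: cvg_cst|exact: cvg_id].
  have [r2 r20 er] : exists2 r : R, 0 < r & forall z : R, `|s - z| < r ->
      `|expR (- (2 * C * s)) - expR (- (2 * C * z))| < e / (2 * m).
    move/cvgrPdist_lt: cexp => /(_ (e / (2 * m)) ltac:(by rewrite divr_gt0// mulr_gt0)).
    by move=> /nbhs_ballP[r r0 rb]; exists r.
  exists (Num.min r1 r2); first by rewrite lt_min r10.
  move=> z /andP[z0 zt]; rewrite lt_min => /andP[zr1 zr2].
  have := er z; rewrite distrC => /(_ zr2) d2; have d1 := Tr z z0 zr1.
  have d3 := Tdist z s z0 s0.
  have -> : f z - f s = expR (- (2 * C * z)) * (excess (w z) - excess (w s)) -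
      (expR (- (2 * C * s)) - expR (- (2 * C * z))) * excess (w s) by rewrite /f; ring.
  apply: le_lt_trans (ler_normB _ _) _; rewrite !normrM (gtr0_norm (ex0 z)).
  have a1 : expR (- (2 * C * z)) * `|excess (w z) - excess (w s)| <= C0 * (e / (2 * (C0 + 1))).
    apply: le_trans (ler_piMl _ (ex1 z z0)) _ => //; apply: (le_trans d3).
    by rewrite ler_wpM2l// ltW.
  have a2 : C0 * (e / (2 * (C0 + 1))) < e / 2.
    have -> : C0 * (e / (2 * (C0 + 1))) = e / 2 * (C0 / (C0 + 1)) by field; rewrite gt_eqF.
    by rewrite gtr_pMr ?divr_gt0// ltr_pdivrMr// mul1r ltrDl.
  have a3 : `|expR (- (2 * C * s)) - expR (- (2 * C * z))| * `|excess (w s)| <= e / 2.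
    have -> : e / 2 = e / (2 * m) * m by field; rewrite gt_eqF.
    by apply: ler_pM => //; [exact: ltW|rewrite ger0_norm ?excess_ge0// /m lerDl].
  by rewrite [ltRHS]splitr; exact: ltr_leD (le_lt_trans a1 a2) a3.
- have [r r0 step] := excess_step s0 (divr_gt0 e0 (ltr0n R 2)).
  have c1 : 0 < 2 * C + 1 by rewrite ltr_wpDl// mulr_ge0.
  pose h := Num.min (Num.min (r / 2) (t - s)) (Num.min (2 * C + 1)^-1 1).
  have h0 : 0 < h by rewrite !lt_min divr_gt0// subr_gt0 st invr_gt0 c1 /=.
  have : h <= h by [].
  rewrite {2}/h !le_min => /andP[/andP[hr hts] /andP[hc _]].
  exists h; split => //; first by rewrite addrC -lerBrDr.
  have hr' : 0 < h < r by rewrite h0/=; lra.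
  have st1 := step h hr'; have E1 := excess_ge0 (w (s + h)).
  have Ch : 2 * C * h <= 1.
    have : (2 * C + 1) * h <= 1 by rewrite mulrC -ler_pdivlMr ?div1r.
    by lra.
  have Ch0 : 0 <= C * h by rewrite mulr_ge0// ltW.
  have eh : expR (- (2 * C * h)) <= 1 - C * h.
    rewrite expRN invf_ple ?posrE ?expR_gt0//; last lra.
    apply: le_trans (expR_ge1Dx _).
    by rewrite -div1r ler_pdivrMr; [nra|lra].
  rewrite /f (_ : - (2 * C * (s + h)) = - (2 * C * s) + - (2 * C * h)); last by ring.
  rewrite expRD.
  have x0 := ex0 s; have x1 := ex1 s s0.
  have y1 : expR (- (2 * C * h)) * excess (w (s + h)) <= excess (w s) + e / 2 * h.
    by apply: le_trans st1; rewrite ler_wpM2r.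
  rewrite -mulrA; apply: le_trans (ler_wpM2l (ltW x0) y1) _; rewrite mulrDr.
  rewrite lerD2l; apply: (@le_trans _ _ (e / 2 * h)).
    by rewrite ler_piMl// mulr_ge0 ?(ltW h0)// divr_ge0// ltW.
  by rewrite ler_pM2r// ler_pdivrMr// ler_peMr ?(ltW e0)// ler1n.
Qed.
End comparison.

(** * Continuous representatives and the maximum principle *)

Section continuous_representatives.
Context {R : realType}.
Notation mu := (@lebesgue_measure R).
Notation I := (@I1 R).
Notation J := (@I1bar R).
Notation L2 := (@Lp R 2%:E I).
Implicit Types (f g u v : R -> R) (a b c d e h x y : R).

Lemma I1bar_bounds x : J x -> -1 <= x <= 1.
Proof. by rewrite /I1bar /= in_itv. Qed.

Lemma I1_I1bar x : I x -> J x.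
Proof. by rewrite /I1 /I1bar /= !in_itv/= => /andP[? ?]; rewrite !ltW. Qed.

Lemma continuous_bar_near f x e : {within J, continuous f} -> J x -> 0 < e ->
  exists2 d, 0 < d & forall y, J y -> `|x - y| < d -> `|f x - f y| < e.
Proof.
move=> /subspace_continuousP cf Jx e0; have /cvgrPdist_lt/(_ e e0) := cf x Jx.
by rewrite /prop_near1 /within /= => /nbhs_ballP[d d0 fd]; exists d => // y Jy /fd; apply.
Qed.

Lemma continuous_bar_I1 f x : {within J, continuous f} -> I x -> {for x, continuous f}.
Proof.
move=> cf Ix; have Jx := I1_I1bar Ix.
apply/cvgrPdist_lt => e e0; have [d d0 fd] := continuous_bar_near cf Jx e0.
near=> y; apply: fd.
  by apply: I1_I1bar; near: y; exact: near_in_itvoo.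
by near: y; apply/nbhs_ballP; exists d.
Unshelve. all: by end_near. Qed.

Lemma ae_le_bar f c : {within J, continuous f} ->
  {ae mu, forall x, I x -> f x <= c} -> forall x, J x -> f x <= c.
Proof.
move=> cf fc x Jx; apply/ler_addgt0Pr => e e0.
have [d d0 fd] := continuous_bar_near cf Jx e0; have /I1bar_bounds/andP[x1 x2] := Jx.
have ab : Num.max (-1) (x - d) < Num.min 1 (x + d).
  by rewrite lt_min !gt_max; apply/andP; split; apply/andP; split; lra.
have [y] := ae_exists_itv ab fc; rewrite gt_max lt_min => /andP[/andP[y1 y2] /andP[y3 y4]] fy.
have Iy : I y by rewrite /I1 /= in_itv/= y1.
have xy : `|x - y| < d by rewrite ltr_norml; apply/andP; split; lra.
by have := fy Iy; have := fd y (I1_I1bar Iy) xy; rewrite ltr_norml => /andP[? ?]; lra.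
Qed.

Lemma continuous_bar_bounded f : {within J, continuous f} ->
  exists2 N, 0 <= N & forall x, J x -> `|f x| <= N.
Proof.
move=> cf; have l11 : -1 <= 1 :> R by lra.
have cn : {within J, continuous (fun x => `|f x|)}.
  by move=> x; apply: continuous_comp; [exact: cf|exact: norm_continuous].
have [c _ fc] := EVT_max l11 cn; exists `|f c| => // x Jx; exact: fc.
Qed.

Lemma continuous_bar_L2 f : {within J, continuous f} -> L2 f.
Proof.
move=> cf; have [N N0 fN] := continuous_bar_bounded cf.
apply: (bounded_L2 (c := N)); last by move=> x /I1_I1bar/fN.
by apply: continuous_measurable_I1 => x; exact: continuous_bar_I1.
Qed.

Lemma ae_eq_continuous_I1 f g : (forall x, I x -> {for x, continuous f}) ->
  (forall x, I x -> {for x, continuous g}) -> ae_eq mu I f g -> forall x, I x -> f x = g x.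
Proof.
move=> cf cg fg x Ix; apply/eqP; rewrite -subr_eq0 -normr_le0; apply/ler_addgt0Pr => e e0.
have c : {for x, continuous (fun z => f z - g z)}.
  by apply: (@continuousB _ R); [exact: cf|exact: cg].
move/cvgrPdist_lt: c => /(_ e e0)/nbhs_ballP[d /= d0 fd].
have [a [b [a1 ax xb b1]]] := I1_inner Ix.
have ab : x < Num.min b (x + d) by rewrite lt_min xb ltrDl.
have [y] := ae_exists_itv ab fg; rewrite lt_min => /and3P[xy yb yd] fgy.
have Iy : I y by apply: (@subset_itvcc_I1 _ a b) => //; rewrite /= in_itv/= !ltW// (lt_trans ax).
have := fd y; rewrite /ball /= fgy// subrr subr0 => h; rewrite add0r ltW//; apply: h.
by rewrite distrC gtr0_norm ?subr_gt0//; lra.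
Qed.

Lemma near_I1 (f g : R -> R) x : (forall x, I x -> f x = g x) -> I x -> {near x, f =1 g}.
Proof. by move=> fg Ix; near=> y; apply: fg; near: y; exact: near_in_itvoo.
Unshelve. all: by end_near. Qed.

Lemma derive1_eq_I1 f g x : (forall x, I x -> f x = g x) -> I x ->
  f^`()%classic x = g^`()%classic x.
Proof. by move=> fg Ix; rewrite !derive1E; apply: near_eq_derive; exact: near_I1. Qed.

Lemma loc_abs_cont_eq f g : (forall x, I x -> f x = g x) -> loc_abs_cont I f -> loc_abs_cont I g.
Proof.
move=> fg lf a b ab abI e e0; have [d d0 fd] := lf a b ab abI e e0; exists d => // n x y xy yx l.
have abE z : a <= z <= b -> f z = g z by move=> zab; apply/fg/abI; rewrite /= in_itv.
suff -> : \sum_(i < n) `|g (y i) - g (x i)| = \sum_(i < n) `|f (y i) - f (x i)| by exact: fd.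
apply: eq_bigr => i _; have [ax xyi yb] := xy i (ltn_ord i).
by rewrite !abE// ?ax ?yb ?(le_trans xyi yb) ?(le_trans ax xyi).
Qed.

(** The elements of D(A) and their images depend only on the values on the
    open interval I, where derivatives are local. *)
Lemma domA_eq f g : (forall x, I x -> f x = g x) -> domA f ->
  domA g /\ forall x, I x -> opA f x = opA g x.
Proof.
move=> fg [L2f lf [[L2r lr L2d] rl rr]].
have rE x : I x -> rho_deriv f x = rho_deriv g x.
  by move=> Ix; rewrite /rho_deriv (derive1_eq_I1 fg Ix).
have oE x : I x -> opA f x = opA g x by move=> Ix; exact: derive1_eq_I1.
split; last exact: oE.
split; first by apply: Lp_eq L2f => x /set_mem; exact: fg.
  exact: loc_abs_cont_eq lf.
have l11 : -1 < 1 :> R by lra.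
split; first split.
- by apply: Lp_eq L2r => x /set_mem; exact: rE.
- exact: loc_abs_cont_eq lr.
- by apply: Lp_eq L2d => x /set_mem; exact: oE.
- apply: cvg_trans rl; apply: near_eq_cvg; near=> x; apply: rE.
  by rewrite /I1 /= in_itv/=; apply/andP; split; near: x; [exact: nbhs_right_gt|exact: nbhs_right_lt].
- apply: cvg_trans rr; apply: near_eq_cvg; near=> x; apply: rE.
  by rewrite /I1 /= in_itv/=; apply/andP; split; near: x; [exact: nbhs_left_gt|exact: nbhs_left_lt].
Unshelve. all: by end_near. Qed.

(** At a point where f attains its maximum M the reaction r would be negative.
    Hence a resolvent step leads below a level c < M, and
    domA_resolvent_posint gives f <= c. *)
Lemma maximum_principle f r kappa gamma M delta L : {within J, continuous f} -> domA f ->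
  0 <= kappa -> 0 < gamma -> (exists2 x, J x & f x = M) -> (forall x, J x -> f x <= M) ->
  {ae mu, forall x, I x -> kappa * opA f x + gamma^-1 * r x = 0} ->
  0 < delta -> 0 <= L -> (forall x, I x -> r x <= L * (M - f x) - delta) -> False.
Proof.
move=> cf Df k0 g0 [x0 Jx0 fx0] fM fr d0 L0 rL.
have L1 : 0 < L + 1 by rewrite ltr_wpDl.
pose h := gamma / (L + 1); have h0 : 0 < h by rewrite divr_gt0.
pose c := M - h * gamma^-1 * delta.
have hg : 0 < h * gamma^-1 by rewrite mulr_gt0// invr_gt0.
have cM : c < M by rewrite /c gtrBl mulr_gt0.
have hk : 0 <= h * kappa by rewrite mulr_ge0// ltW.
have [L2f L2o] := domA_L2 Df.
have L2fc : L2 (f - cst c) by apply: L2B => //; exact: L2_cst.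
have := domA_resolvent_posint c Df hk.
rewrite (@posint_eq0_le _ (f - cst c - (h * kappa) *: opA f)); last 2 first.
- by apply: L2B => //; exact: L2Z.
- apply: filterS fr => x /[swap] Ix /(_ Ix) frx.
  rewrite (_ : _ x = f x - c - h * kappa * opA f x)//.
  have kE : kappa * opA f x = - (gamma^-1 * r x) by lra.
  rewrite -mulrA kE mulrN opprK mulrA.
  have r1 := ler_wpM2l (ltW hg) (rL x Ix); have Mf : 0 <= M - f x by rewrite subr_ge0 fM//; exact: I1_I1bar.
  have hL : h * gamma^-1 * L <= 1.
    rewrite (_ : _ * L = L / (L + 1)); last by rewrite /h; field; rewrite !gt_eqF.
    by rewrite ler_pdivrMr// mul1r lerDl.
  have := ler_wpM2r Mf hL; rewrite /c; lra.
move=> p0; have pe0 : posint (f - cst c) = 0 by apply/eqP; rewrite eq_le p0 posint_ge0.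
have := posint_eq0 L2fc pe0 => fc.
have : f x0 <= c.
  apply: (ae_le_bar cf) => //; apply: filterS fc => x /[apply].
  by rewrite (_ : _ x = f x - c)// subr_le0.
by rewrite fx0 leNgt cM.
Qed.

End continuous_representatives.

(** * Stationary states *)

Section stationary_states.
Context {R : realType}.
Notation mu := (@lebesgue_measure R).
Notation I := (@I1 R).
Notation J := (@I1bar R).
Notation L2 := (@Lp R 2%:E I).
Implicit Types (t h e x : R) (u v w : fun2 R).
Variables (gamma_a gamma_s lambda eps_a sigma_B r0 : R) (beta_s q : R -> R).
Hypotheses (gamma_a_gt0 : 0 < gamma_a) (gamma_s_gt0 : 0 < gamma_s).
Hypotheses (sigma_B_gt0 : 0 < sigma_B) (lambda_ge0 : 0 <= lambda).
Hypotheses (eps_a_gt0 : 0 < eps_a) (eps_a_lt2 : eps_a < 2) (r0_gt0 : 0 < r0).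
Variables (Lb qmax B : R).
Hypothesis Lb_ge0 : 0 <= Lb.
Hypothesis beta_lipschitz : forall x y, `|beta_s y - beta_s x| <= Lb * `|y - x|.
Hypothesis beta_nondecreasing : {homo beta_s : x y / x <= y}.
Hypothesis beta_gt0 : forall y, 0 < beta_s y.
Hypothesis beta_le : forall y, beta_s y <= B.
Hypothesis q_measurable : measurable_fun I q.
Hypothesis q_bounds : forall x, I x -> 0 <= q x <= qmax.

Notation ra := (react_a lambda eps_a sigma_B).
Notation rs := (react_s lambda eps_a sigma_B beta_s).
Notation G := (G0 gamma_a gamma_s lambda eps_a sigma_B r0 q beta_s).

Let qmax_ge0 : 0 <= qmax.
Proof. by have /andP[h1 h2] := q_bounds (@I1_0 R); exact: le_trans h2. Qed.

Let Q_bounds x : I x -> 0 <= r0 * q x <= r0 * qmax.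
Proof.
move=> /q_bounds/andP[h1 h2].
by apply/andP; split; [rewrite mulr_ge0// ltW|rewrite ler_wpM2l// ltW].
Qed.

Lemma Rintegral_lincomb (a b : R) (f g : R -> R) : L2 f -> L2 g ->
  mu.-integrable I (EFin \o (fun x => a * f x + b * g x)) /\
  \int[mu]_(x in I) (a * f x + b * g x) = a * \int[mu]_(x in I) f x + b * \int[mu]_(x in I) g x.
Proof.
move=> L2f L2g; split; first exact: (L2_integrable (L2D (L2Z a L2f) (L2Z b L2g))).
have mI : measurable (I : set (measurableTypeR R)) by exact: measurable_I1.
rewrite RintegralD//; [|exact: (L2_integrable (L2Z a L2f))|exact: (L2_integrable (L2Z b L2g))].
by congr (_ + _); rewrite RintegralZl//; exact: L2_integrable.
Qed.

(** The integrated form of react_one_sided. *)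
Lemma excess_reaction : exists2 C, 0 <= C & forall u v h, inHH u -> inHH v ->
  inHH (G u) -> inHH (G v) -> 0 <= h ->
  (1 - C * h) * excess gamma_a gamma_s (u - v) <=
  excess gamma_a gamma_s (u - v - h *: (G u - G v)).
Proof.
pose Cm := lambda + 2 * (r0 * qmax * Lb).
have Cm0 : 0 <= Cm by rewrite addr_ge0// !mulr_ge0// ltW.
have iga : 0 < gamma_a^-1 by rewrite invr_gt0.
have igs : 0 < gamma_s^-1 by rewrite invr_gt0.
exists (Cm * (gamma_a^-1 + gamma_s^-1)); first by rewrite mulr_ge0// addr_ge0// ltW.
move=> u v h uH vH GuH GvH h0; set z := u - v; set z' := u - v - _.
have [z1 z2] : inHH z by exact: inHHB.
have [z1' z2'] : inHH z' by apply: inHHB; [exact: inHHB|apply: inHHZ; exact: inHHB].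
pose f1 x := Num.max (z.1 x) 0; pose f2 x := Num.max (z.2 x) 0.
pose g1 x := Num.max (z'.1 x) 0; pose g2 x := Num.max (z'.2 x) 0.
have [il lE] := Rintegral_lincomb (gamma_a - h * Cm) (2 * gamma_s - h * Cm) (L2_pos z1) (L2_pos z2).
have [ir rE] := Rintegral_lincomb gamma_a (2 * gamma_s) (L2_pos z1') (L2_pos z2').
apply: (@le_trans _ _ ((gamma_a - h * Cm) * posint z.1 + (2 * gamma_s - h * Cm) * posint z.2)).
  have p1 := posint_ge0 z.1; have p2 := posint_ge0 z.2.
  rewrite /excess; move: (posint _) (posint _) p1 p2 => y x x0 y0.
  have a1 : 0 <= h * Cm * (gamma_a * gamma_s^-1) * x by rewrite !mulr_ge0// ltW.
  have a2 : 0 <= h * Cm * (2 * gamma_s * gamma_a^-1 + 1) * y.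
    by rewrite !mulr_ge0// addr_ge0// !mulr_ge0// ltW.
  rewrite -subr_ge0; apply: le_trans (addr_ge0 a1 a2) _; rewrite le_eqVlt; apply/orP; left.
  by apply/eqP; field; rewrite !gt_eqF.
rewrite /posint -lE /excess /posint mulrA -rE; apply: le_Rintegral => //; first exact: measurable_I1.
move=> x Ix.
have := react_one_sided sigma_B_gt0 lambda_ge0 eps_a_gt0 eps_a_lt2 r0_gt0 Lb_ge0
  beta_lipschitz beta_nondecreasing q_bounds (u.1 x) (u.2 x) (v.1 x) (v.2 x) (Q_bounds Ix).
rewrite -/Cm.
have -> : z.1 x = u.1 x - v.1 x by [].
have -> : z.2 x = u.2 x - v.2 x by [].
have -> : z'.1 x = u.1 x - v.1 x - h * (gamma_a^-1 * ra (u.1 x) (u.2 x) - gamma_a^-1 * ra (v.1 x) (v.2 x)) by [].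
have -> : z'.2 x = u.2 x - v.2 x - h * (gamma_s^-1 * rs (r0 * q x) (u.1 x) (u.2 x) - gamma_s^-1 * rs (r0 * q x) (v.1 x) (v.2 x)) by [].
rewrite -!mulrBr -(subr_gt0 (v.1 x)) -(subr_gt0 (v.2 x)).
move: (ra _ _ - ra _ _) (rs _ _ _ - rs _ _ _) (u.1 x - v.1 x) (u.2 x - v.2 x) => A1 A2 x1 x2 os.
have os' := ler_wpM2l h0 os.
have key (gam y a : R) : 0 < gam ->
    gam * Num.max y 0 - h * ((0 < y)%R%:R * a) <= gam * Num.max (y - h * (gam^-1 * a)) 0.
  move=> gam0; case: (ltP 0 y) => y0.
    apply: (@le_trans _ _ (gam * (y - h * (gam^-1 * a)))); last by rewrite ler_pM2l// le_max lexx.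
    by rewrite le_eqVlt; apply/orP; left; apply/eqP; rewrite /=; field; rewrite gt_eqF.
  by rewrite mul0r !mulr0 subr0 mulr_ge0 ?(ltW gam0)// le_max lexx orbT.
have k1 := key _ x1 A1 gamma_a_gt0; have k2 := key _ x2 A2 gamma_s_gt0.
lra.
Qed.

Variables (kappa_a kappa_s : R).
Hypotheses (kappa_a_gt0 : 0 < kappa_a) (kappa_s_gt0 : 0 < kappa_s).

(** By the maximum principle and cooperativity, the pair of the maxima of F.1
    and F.2 is a sub-equilibrium of the differential equation, even if the two
    maxima are attained at different points. *)
Lemma stationary_le_warmest F E : stationary kappa_a kappa_s G F ->
  warmest_ode_equilibrium lambda eps_a sigma_B beta_s (r0 * qmax) E ->
  forall x, J x -> F.1 x <= E.1 /\ F.2 x <= E.2.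
Proof.
move=> [[c1 c2] [D1 D2] [e1 e2]] wE.
have l11 : -1 <= 1 :> R by lra.
have [xa Jxa Fa] := EVT_max l11 c1; have [xs Jxs Fs] := EVT_max l11 c2.
set Ma := F.1 xa; set Ms := F.2 xs.
have [Na Na0 bNa] := continuous_bar_bounded c1; have [Ns Ns0 bNs] := continuous_bar_bounded c2.
have [K K0 bK] := react_lipschitz sigma_B_gt0 lambda_ge0 eps_a_gt0 eps_a_lt2 r0_gt0 Lb_ge0
  beta_lipschitz q_bounds.
pose N := Na + Ns; pose L := K * (1 + N ^+ 3).
have L0 : 0 <= L by rewrite mulr_ge0// addr_ge0// exprn_ge0// addr_ge0.
have NaN x : J x -> `|F.1 x| <= N by move=> /bNa /le_trans; apply; rewrite lerDl.
have NsN x : J x -> `|F.2 x| <= N by move=> /bNs /le_trans; apply; rewrite lerDr.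
have QQ : 0 <= r0 * qmax <= r0 * qmax by rewrite lexx mulr_ge0// ltW.
have z0 (y d : R) : 0 <= d -> `|y - y| <= d by rewrite subrr normr0.
suff sub : sub_equilibrium lambda eps_a sigma_B r0 beta_s qmax (Ma, Ms).
  have [h1 h2] := sub_equilibrium_le sigma_B_gt0 lambda_ge0 eps_a_gt0 eps_a_lt2 r0_gt0 Lb_ge0
    beta_lipschitz q_bounds beta_le beta_gt0 wE sub.
  move=> x Jx; split; first exact: le_trans (Fa x Jx) h1.
  exact: le_trans (Fs x Jx) h2.
split => /=; rewrite leNgt; apply/negP => neg.
- apply: (@maximum_principle _ F.1 (fun x => ra (F.1 x) (F.2 x)) kappa_a gamma_a Ma
    (- ra Ma Ms) L) => //.
  + exact: ltW.
  + by exists xa.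
  + by rewrite oppr_gt0.
  move=> x /I1_I1bar Jx.
  have Mx : 0 <= Ma - F.1 x by rewrite subr_ge0; exact: Fa.
  have m1 := react_a_mono sigma_B_gt0 lambda_ge0 eps_a_gt0 (F.1 x) (Fs x Jx).
  have dx : `|F.1 x - Ma| <= Ma - F.1 x by rewrite distrC ger0_norm.
  have [+ _] := bK _ _ _ _ _ _ _ (NaN x Jx) (NsN xs Jxs) (NaN xa Jxa) (NsN xs Jxs) dx (z0 Ms _ Mx) QQ.
  rewrite -/L -/Ms -/Ma ler_norml opprK => /andP[_ h2]; lra.
- apply: (@maximum_principle _ F.2 (fun x => rs (r0 * q x) (F.1 x) (F.2 x)) kappa_s gamma_s Ms
    (- rs (r0 * qmax) Ma Ms) L) => //.
  + exact: ltW.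
  + by exists xs.
  + by rewrite oppr_gt0.
  move=> x Ix; have Jx := I1_I1bar Ix.
  have Mx : 0 <= Ms - F.2 x by rewrite subr_ge0; exact: Fs.
  have m1 := react_s_mono beta_s sigma_B_gt0 lambda_ge0 eps_a_gt0 (F.2 x) (r0 * qmax) (Fa x Jx).
  have m2 : rs (r0 * q x) (F.1 x) (F.2 x) <= rs (r0 * qmax) (F.1 x) (F.2 x).
    rewrite /react_s lerD2l ler_wpM2r//; first exact: ltW.
    by have /andP[] := Q_bounds Ix.
  have dx : `|F.2 x - Ms| <= Ms - F.2 x by rewrite distrC ger0_norm.
  have [_] := bK _ _ _ _ _ _ _ (NaN xa Jxa) (NsN x Jx) (NaN xa Jxa) (NsN xs Jxs) (z0 Ma _ Mx) dx QQ.
  rewrite -/L -/Ms -/Ma ler_norml opprK => /andP[_ h2]; rewrite -/Ma in m1; lra.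
Qed.

Lemma normH_le_normV (u : R -> R) : normH u <= normV u.
Proof.
by rewrite /normV -[leLHS]ger0_norm ?normH_ge0// -sqrtr_sqr ler_wsqrtr// lerDl sqr_ge0.
Qed.

Lemma normV_le_normVV u : normV u.1 <= normVV u /\ normV u.2 <= normVV u.
Proof.
have n0 (f : R -> R) : 0 <= normV f by exact: sqrtr_ge0.
split; rewrite /normVV -[leLHS]ger0_norm// -sqrtr_sqr ler_wsqrtr//.
  by rewrite lerDl sqr_ge0.
by rewrite lerDr sqr_ge0.
Qed.

Lemma normS_le_normVV u : normS u <= 2 * normVV u.
Proof.
have [h1 h2] := normV_le_normVV u.
rewrite mulr_natl mulr2n; apply: lerD.
  exact: le_trans (normH_le_normV u.1) h1.
exact: le_trans (normH_le_normV u.2) h2.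
Qed.

Lemma inVV_inHH u : inVV u -> inHH u.
Proof. by move=> [[? _ _] [? _ _]]. Qed.

Lemma inVV_continuous_I1 u : inVV u -> continuous_I1 u.
Proof. by move=> [[_ l1 _] [_ l2 _]] x Ix; split; exact: loc_abs_cont_continuous Ix. Qed.

Lemma inVV_bound : exists2 c, 0 <= c &
  (forall u, inVV u -> forall x, I x ->
    `|u.1 x| <= c * normVV u * weight x /\ `|u.2 x| <= c * normVV u * weight x) /\
  (forall u v, inVV u -> inVV v -> forall x, I x ->
    `|u.1 x - v.1 x| <= c * normVV (u - v) * weight x /\
    `|u.2 x - v.2 x| <= c * normVV (u - v) * weight x).
Proof.
have [c c0 [b1 b2]] := @inV_bound R; exists c => //.
have w (m n x : R) : m <= n -> c * m * weight x <= c * n * weight x.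
  by move=> mn; rewrite ler_wpM2r ?weight_ge0// ler_wpM2l.
split=> [u [V1 V2] x Ix|u v [U1 U2] [V1 V2] x Ix].
  have [h1 h2] := normV_le_normVV u.
  by split; [apply: le_trans (b1 _ V1 x Ix) (w _ _ x h1)|apply: le_trans (b1 _ V2 x Ix) (w _ _ x h2)].
have [h1 h2] := normV_le_normVV (u - v).
by split; [apply: le_trans (b2 _ _ U1 V1 x Ix) (w _ _ x h1)|
  apply: le_trans (b2 _ _ U2 V2 x Ix) (w _ _ x h2)].
Qed.

Lemma inVV_reaction u : inVV u -> inHH (G u).
Proof.
move=> Vu; have [c c0 [b1 _]] := inVV_bound; have [L1 L2u] := inVV_inHH Vu.
apply: (reaction_inHH gamma_a_gt0 gamma_s_gt0 sigma_B_gt0 lambda_ge0 eps_a_gt0 eps_a_lt2 r0_gt0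
  Lb_ge0 beta_lipschitz q_measurable q_bounds (N := c * normVV u)).
- by rewrite mulr_ge0// sqrtr_ge0.
- exact: L2_measurable.
- exact: L2_measurable.
- by move=> x Ix; exact: b1.
Qed.

(** The embedding of V turns continuity in V into continuity of the reaction
    in H. *)
Lemma mild_reaction_continuous (T : R -> fun2 R) t e : (forall t, 0 <= t -> inVV (T t)) ->
  (forall t, 0 <= t -> normVV (T s - T t) @[s --> within `[0, +oo[ (nbhs t)] --> (0 : R)) ->
  0 <= t -> 0 < e -> exists2 r, 0 < r & forall s, 0 <= s -> `|s - t| < r ->
    normS (T s - T t) < e /\ normS (G (T s) - G (T t)) < e.
Proof.
move=> VT cT t0 e0; have [c c0 [b1 b2]] := inVV_bound.
have [K K0 bK] := reaction_normS_lipschitz gamma_a_gt0 gamma_s_gt0 sigma_B_gt0 lambda_ge0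
  eps_a_gt0 eps_a_lt2 r0_gt0 Lb_ge0 beta_lipschitz q_bounds.
pose N := c * normVV (T t) + c; have nn u : 0 <= normVV u by exact: sqrtr_ge0.
have N0 : 0 <= N by rewrite addr_ge0// mulr_ge0.
pose M := K * (1 + N ^+ 3) * c; have M0 : 0 <= M by rewrite !mulr_ge0// addr_ge0// exprn_ge0.
pose d := Num.min 1 (e / (M + 3)).
have M3 : 0 < M + 3 by rewrite ltr_wpDl.
have d0 : 0 < d by rewrite lt_min ltr01 divr_gt0.
have d1 : d <= 1 by rewrite ge_min lexx.
have dM : (M + 3) * d <= e by rewrite mulrC -ler_pdivlMr// ge_min lexx orbT.
have := cT t t0 => /cvgrPdist_lt/(_ d d0); rewrite /prop_near1 /within /=.
move=> /nbhs_ballP[r r0' rT]; exists r => // s s0 str.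
have nd : normVV (T s - T t) < d.
  have := rT s; rewrite /ball /= distrC => /(_ str); rewrite in_itv/= s0 => /(_ isT).
  by rewrite sub0r normrN ger0_norm.
have e1 : M * normVV (T s - T t) <= M * d by rewrite ler_wpM2l// ltW.
have Md : 0 <= M * d by rewrite mulr_ge0// ltW.
split; first by apply: le_lt_trans (normS_le_normVV _) _; lra.
apply: le_lt_trans (bK N (c * normVV (T s - T t)) _ _ N0 _ _ _ _ _ _) _.
- by rewrite mulr_ge0.
- exact/inVV_reaction/VT.
- exact/inVV_reaction/VT.
- move=> x Ix; have [h1 h2] := b1 _ (VT t t0) x Ix; have [h3 h4] := b2 _ _ (VT s s0) (VT t t0) x Ix.
  have w0 := weight_ge0 x.
  have cw : c * normVV (T s - T t) * weight x <= c * weight x.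
    by rewrite ler_wpM2r// ler_piMr//; apply: le_trans d1; exact: ltW.
  have tri (y z : R) : `|y| <= `|z| + `|y - z| by rewrite -lerBlDl lerB_dist.
  rewrite /N mulrDl; split; apply: le_trans (tri _ _) _; apply: lerD.
  + exact: h1.
  + exact: le_trans h3 cw.
  + exact: h2.
  + exact: le_trans h4 cw.
- move=> x Ix; have [h1 h2] := b1 _ (VT t t0) x Ix.
  have cw : 0 <= c * weight x by rewrite mulr_ge0// weight_ge0.
  rewrite /N mulrDl; split; first by apply: (le_trans h1); rewrite lerDl.
  by apply: (le_trans h2); rewrite lerDl.
- by move=> x Ix; exact: b2 (VT s s0) (VT t t0) x Ix.
- by rewrite mulrA -/M; apply: (le_lt_trans e1); lra.
Qed.

Lemma uniform_bar_near (f : R -> R -> R) (E : R -> R) e :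
  {uniform J, f t @[t --> +oo] --> E} -> 0 < e ->
  \forall t \near +oo, forall x, J x -> `|E x - f t x| < e.
Proof.
move=> fE e0; apply: (fE [set h : {uniform` J -> R} | forall x, J x -> `|E x - h x| < e]).
apply/uniform_nbhs; exists [set xy | `|xy.1 - xy.2| < e]; split => //.
by rewrite -entourage_ballE; exists e.
Qed.

Variable S : R -> fun2 R -> fun2 R.
Hypothesis gen : semigroup_generated_by (@domAA R) (opAA kappa_a kappa_s) S.
Let CS : C0_semigroup S := gen.1.

(** The initial excess of F over the solution is zero, and it remains so. *)
Lemma stationary_le_mild F (T0 : fun2 R) (T : R -> fun2 R) t : stationary kappa_a kappa_s G F ->
  inHH T0 -> mild_solution S G T0 T -> inHH (G F) ->
  (forall x, I x -> F.1 x <= T0.1 x /\ F.2 x <= T0.2 x) -> 0 <= t ->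
  {ae mu, forall x, I x -> F.1 x <= (T t).1 x /\ F.2 x <= (T t).2 x}.
Proof.
move=> [cF DF eF] T0H [VT cT T0E mild] GFH FT0 t0.
have [K [d [K0 d0 bS]]] := semigroup_bounded_near0 CS.
have TH s : 0 <= s -> inHH (T s) by move=> s0; exact/inVV_inHH/VT.
have FH := (domAA_inHH kappa_a kappa_s DF).1.
have [C C0 one_sided] := excess_reaction.
have ex0 : excess gamma_a gamma_s (F - T 0) = 0.
  have T00 := TH 0 (lexx 0); have [L1 L2'] : inHH (F - T 0) by exact: inHHB.
  have [E1 E2] := T0E.
  rewrite /excess (posint_eq0_le L1) ?(posint_eq0_le L2') ?mulr0 ?addr0//.
    by apply: filterS E2 => x h Ix; rewrite (_ : _ x = F.2 x - (T 0).2 x)// h// subr_le0; exact: (FT0 x Ix).2.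
  by apply: filterS E1 => x h Ix; rewrite (_ : _ x = F.1 x - (T 0).1 x)// h// subr_le0; exact: (FT0 x Ix).1.
have ex : excess gamma_a gamma_s (F - T t) = 0.
  apply: (excess_vanishes gamma_a_gt0 gamma_s_gt0 kappa_a_gt0 kappa_s_gt0 gen K0 d0 bS DF GFH eF
    T0H TH _ (g := G \o T) (C := C)) => //.
  - by move=> s s0; exact/inVV_continuous_I1/VT.
  - by move=> s s0; exact/inVV_reaction/VT.
  - move=> s e s0 e0; have [r r0' h] := mild_reaction_continuous VT cT s0 e0.
    by exists r => // z z0 /(h z z0)[].
  - move=> s e s0 e0; have [r r0' h] := mild_reaction_continuous VT cT s0 e0.
    by exists r => // z z0 /(h z z0)[].
  - by move=> s h s0 h0; apply: one_sided => //; [exact: TH|exact/inVV_reaction/VT].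
have [L1 L2'] : inHH (F - T t) by apply: inHHB => //; exact: TH.
have p1 := posint_ge0 (F - T t).1; have p2 := posint_ge0 (F - T t).2.
have m1 : 0 <= gamma_a * posint (F - T t).1 by rewrite mulr_ge0// ltW.
have m2 : 0 <= gamma_s * posint (F - T t).2 by rewrite mulr_ge0// ltW.
have q1 : gamma_a * posint (F - T t).1 = 0 by move: ex; rewrite /excess; lra.
have q2 : gamma_s * posint (F - T t).2 = 0 by move: ex; rewrite /excess; lra.
have {}q1 : posint (F - T t).1 = 0.
  by move/eqP: q1; rewrite mulf_eq0 gt_eqF//= => /eqP.
have {}q2 : posint (F - T t).2 = 0.
  by move/eqP: q2; rewrite mulf_eq0 gt_eqF//= => /eqP.
apply: filterS2 (posint_eq0 L1 q1) (posint_eq0 L2' q2) => x h1 h2 Ix.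
split; rewrite -subr_le0; [exact: h1|exact: h2].
Qed.

Lemma continuous2_bar_bound u : continuous2_bar u -> exists2 N, 0 <= N &
  forall x, J x -> `|u.1 x| <= N /\ `|u.2 x| <= N.
Proof.
move=> [/continuous_bar_bounded[N N0 b1] /continuous_bar_bounded[M M0 b2]].
exists (N + M); first by rewrite addr_ge0.
move=> x Jx; split; [apply: le_trans (b1 x Jx) _|apply: le_trans (b2 x Jx) _].
  by rewrite lerDl.
by rewrite lerDr.
Qed.

Lemma continuous2_bar_reaction u : continuous2_bar u -> inHH u /\ inHH (G u).
Proof.
move=> cu; have [N N0 bN] := continuous2_bar_bound cu.
have uH : inHH u by case: cu => c1 c2; split; exact: continuous_bar_L2.
split => //; have [L1 L2u] := uH.
apply: (reaction_inHH gamma_a_gt0 gamma_s_gt0 sigma_B_gt0 lambda_ge0 eps_a_gt0 eps_a_lt2 r0_gt0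
  Lb_ge0 beta_lipschitz q_measurable q_bounds N0); try exact: L2_measurable.
move=> x Ix; have [h1 h2] := bN x (I1_I1bar Ix).
by split; [apply: (le_trans h1)|apply: (le_trans h2)]; rewrite ler_peMr// weight_ge1.
Qed.

Lemma cvg_uniform_bar_near (T : R -> fun2 R) (E : fun2 R) e : cvg_uniform_bar T E -> 0 < e ->
  exists2 t0, 0 <= t0 & forall t, t0 <= t -> continuous2_bar (T t) /\
    forall x, J x -> `|E.1 x - (T t).1 x| < e /\ `|E.2 x - (T t).2 x| < e.
Proof.
move=> [cT u1 u2] e0; have n1 := uniform_bar_near u1 e0; have n2 := uniform_bar_near u2 e0.
have [M [_ H]] : \forall t \near +oo, continuous2_bar (T t) /\
    (forall x, J x -> `|E.1 x - (T t).1 x| < e) /\ (forall x, J x -> `|E.2 x - (T t).2 x| < e).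
  by near=> t; split; [|split]; near: t.
exists (`|M| + 1); first by rewrite addr_ge0.
move=> t Mt; have [|c [h1 h2]] := H t; first by have := ler_norm M; lra.
by split => // x Jx; split; [exact: h1|exact: h2].
Unshelve. all: by end_near. Qed.

(** In the Duhamel formula on [[t, t + h]] let t tend to infinity: the limit E
    satisfies S h E - E = - h G E + o(h), so that E is in the domain of the
    generator and A E = - G E. *)
Lemma limit_stationary (T0 : fun2 R) (T : R -> fun2 R) (E : fun2 R) :
  inHH T0 -> mild_solution S G T0 T -> cvg_uniform_bar T E -> stationary kappa_a kappa_s G E.
Proof.
move=> T0H [VT cT T0E mild] TE.
have cE : continuous2_bar E.
  have [cn u1 u2] := TE; split.
    apply: (@uniform_limit_continuous_subspace _ _ _ _ _ _ _ u1).
    by apply: filterS cn => t [].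
  apply: (@uniform_limit_continuous_subspace _ _ _ _ _ _ _ u2).
  by apply: filterS cn => t [].
have [EH zH] := continuous2_bar_reaction cE; set z := G E in zH *.
have [N N0 bN] := continuous2_bar_bound cE.
have [K [d [K0 d0 bS]]] := semigroup_bounded_near0 CS.
have [Kr Kr0 bK] := reaction_normS_lipschitz gamma_a_gt0 gamma_s_gt0 sigma_B_gt0 lambda_ge0
  eps_a_gt0 eps_a_lt2 r0_gt0 Lb_ge0 beta_lipschitz q_bounds.
have TH s : 0 <= s -> inHH (T s) by move=> s0; exact/inVV_inHH/VT.
have gH s : 0 <= s -> inHH (G (T s)) by move=> s0; exact/inVV_reaction/VT.
pose M := Kr * (1 + (N + 1) ^+ 3).
have M0 : 0 <= M by rewrite mulr_ge0// addr_ge0// exprn_ge0// addr_ge0.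
have close e : 0 < e -> e <= 1 -> exists2 t0, 0 <= t0 & forall t, t0 <= t ->
    normS (T t - E) <= 4 * e /\ normS (G (T t) - z) <= M * e.
  move=> e0 e1; have [t0 t00 Ht] := cvg_uniform_bar_near TE e0; exists t0 => // t tt.
  have [_ ht] := Ht t tt; have tp := le_trans t00 tt; have [L1 L2T] := TH t tp; have [L1E L2E] := EH.
  split.
    have e2 : 4 * e = 2 * `|e| + 2 * `|e| by rewrite gtr0_norm//; ring.
    rewrite e2; apply: lerD; apply: ae_bounded_normH.
    - exact: L2B.
    - apply: aeW => x /I1_I1bar/ht[h _]; rewrite (_ : _ x = (T t).1 x - E.1 x)// distrC; exact: ltW.
    - exact: L2B.
    - apply: aeW => x /I1_I1bar/ht[_ h]; rewrite (_ : _ x = (T t).2 x - E.2 x)// distrC; exact: ltW.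
  have tri (y y' : R) : `|y'| <= N -> `|y' - y| < e -> `|y| <= N + 1.
    by move=> y1 y2; have := lerB_dist y y'; rewrite distrC; lra.
  have up (y c x : R) : I x -> 0 <= c -> y <= c -> y <= c * weight x.
    by move=> Ix c0 yc; apply: (le_trans yc); rewrite ler_peMr// weight_ge1.
  have N1 : 0 <= N + 1 by rewrite addr_ge0.
  apply: (bK (N + 1) e) => //; [exact: ltW|exact: gH| | |].
  - move=> x Ix; have Jx := I1_I1bar Ix; have [h1 h2] := ht x Jx; have [n1 n2] := bN x Jx.
    by split; apply: up => //; [exact: tri n1 h1|exact: tri n2 h2].
  - move=> x Ix; have [n1 n2] := bN x (I1_I1bar Ix).
    by split; apply: up => //; [apply: (le_trans n1)|apply: (le_trans n2)]; rewrite lerDl.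
  - move=> x Ix; have [h1 h2] := ht x (I1_I1bar Ix).
    by split; apply: up; rewrite ?(ltW e0)// distrC ltW.
have zN := inHHN zH.
have [w [Dw Ew zw]] : exists w, [/\ domAA w, eqHH E w & eqHH (- z) (opAA kappa_a kappa_s w)].
  apply: (generator_domain gen) => // e e0.
  have [d1 d10 Sz] := semigroup_continuous0 CS zH e0.
  exists (Num.min d1 d); first by rewrite lt_min d10.
  move=> h /andP[h0]; rewrite lt_min => /andP[hd1 hd]; have h0' := ltW h0.
  have hd' : 0 <= h <= d by rewrite h0' ltW.
  apply/ler_addgt0Pr => e2 e20.
  pose c := h * K * M + 4 + 4 * K + 1.
  have hKM : 0 <= h * K * M by apply: mulr_ge0 => //; exact: mulr_ge0.
  have c0 : 0 < c by rewrite /c; lra.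
  pose e1 := Num.min 1 (e2 / c).
  have e10 : 0 < e1 by rewrite lt_min ltr01 divr_gt0.
  have e11 : e1 <= 1 by rewrite ge_min lexx.
  have ce1 : c * e1 <= e2 by rewrite mulrC -ler_pdivlMr// ge_min lexx orbT.
  have [t t0 Ht] := close e1 e10 e11; have th0 : 0 <= t + h by rewrite addr_ge0.
  have ShE := semigroup_inHH CS h0' EH; have ShT := semigroup_inHH CS h0' (TH t t0).
  have hz : inHH (h *: z) by exact: inHHZ.
  have n1 : normS (T (t + h) - S h (T t) - h *: z) <= h * (K * (M * e1) + e).
    apply: (mild_increment CS K0 bS T0H TH gH mild) => //.
    - by move=> s /andP[ts _]; have [] := Ht s ts.
    - by move=> r /andP[r0' rh]; apply/ltW/Sz; rewrite r0' (le_lt_trans rh).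
  have n2 : normS (T (t + h) - E) <= 4 * e1 by have [] := Ht (t + h); rewrite ?lerDl.
  have n3 : normS (S h E - S h (T t)) <= K * (4 * e1).
    rewrite (semigroup_normSB CS)//; last exact: TH.
    apply: le_trans (bS _ _ hd' (inHHB EH (TH t t0))) _.
    by rewrite ler_wpM2l// normS_dist//; [have [] := Ht t (lexx t)|exact: TH].
  have -> : S h E - E - h *: - z =
      - (T (t + h) - S h (T t) - h *: z) + (T (t + h) - E) + (S h E - S h (T t)).
    rewrite scalerN opprK !opprB !addrA.
    by rewrite [RHS](ACl (6*5*1*3*4*2*7)) /= ?addrK ?subrK.
  have YH : inHH (T (t + h) - S h (T t) - h *: z).
    by apply: inHHB => //; apply: inHHB => //; exact: TH.
  have ZH : inHH (T (t + h) - E) by apply: inHHB => //; exact: TH.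
  have WH : inHH (S h E - S h (T t)) by exact: inHHB.
  apply: le_trans (normSD (inHHD (inHHN YH) ZH) WH) _.
  have := normSD (inHHN YH) ZH; rewrite (normSN YH) => n4.
  by move: ce1; rewrite /c; lra.
have [D1 D2] := Dw; have [E1 E2] := Ew; have cw := domAA_continuous_I1 Dw.
have [cE1 cE2] := cE.
have w1 : forall x, I x -> w.1 x = E.1 x.
  apply: ae_eq_continuous_I1; last exact: ae_eq_sym.
    by move=> x Ix; exact: (cw x Ix).1.
  by move=> x; exact: continuous_bar_I1.
have w2 : forall x, I x -> w.2 x = E.2 x.
  apply: ae_eq_continuous_I1; last exact: ae_eq_sym.
    by move=> x Ix; exact: (cw x Ix).2.
  by move=> x; exact: continuous_bar_I1.
have [DE1 A1] := domA_eq w1 D1; have [DE2 A2] := domA_eq w2 D2.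
split => //; have [z1 z2] := zw; split.
- apply: filterS z1 => x h Ix; have := h Ix.
  rewrite (_ : (- z).1 x = - (G E).1 x)// (_ : (opAA _ _ w).1 x = kappa_a * opA w.1 x)//.
  rewrite (_ : (_ + _).1 x = kappa_a * opA E.1 x + (G E).1 x)// -A1// => <-.
  by rewrite addNr.
- apply: filterS z2 => x h Ix; have := h Ix.
  rewrite (_ : (- z).2 x = - (G E).2 x)// (_ : (opAA _ _ w).2 x = kappa_s * opA w.2 x)//.
  rewrite (_ : (_ + _).2 x = kappa_s * opA E.2 x + (G E).2 x)// -A2// => <-.
  by rewrite addNr.
Qed.

End stationary_states.

(** * The warmest stationary state *)

Theorem theorem5p2 (R : realType)
    (gamma_a gamma_s kappa_a kappa_s sigma_B lambda eps_a r0 theta0 : R)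
    (beta_s q : R -> R)
    (gamma_a_gt0 : 0 < gamma_a) (gamma_s_gt0 : 0 < gamma_s)
    (kappa_a_gt0 : 0 < kappa_a) (kappa_s_gt0 : 0 < kappa_s)
    (sigma_B_gt0 : 0 < sigma_B) (lambda_ge0 : 0 <= lambda)
    (eps_a_gt0 : 0 < eps_a) (eps_a_lt2 : eps_a < 2) (r0_gt0 : 0 < r0)
    (beta_W1oo : W1 +oo%E setT beta_s)
    (beta_nondecreasing : {homo beta_s : x y / x <= y})
    (beta_gt0 : forall y, 0 < beta_s y)
    (theta0_gt0 : 0 < theta0) (theta0_lt1 : theta0 < 1)
    (q_hoelder : hoelder_I theta0 q)
    (q_Loo : Lp +oo%E (@I1 R) q)
    (q_ge0 : forall x, x \in @I1 R -> 0 <= q x)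
    (S : R -> fun2 R -> fun2 R)
    (S_generated :
      semigroup_generated_by (@domAA R) (opAA kappa_a kappa_s) S)
    (Emax : R * R)
    (Emax_warmest :
      warmest_ode_equilibrium lambda eps_a sigma_B beta_s
        (r0 * sup (q @` @I1 R)) Emax)
    (Tmax : R -> fun2 R)
    (Tmax_solution :
      mild_solution S (G0 gamma_a gamma_s lambda eps_a sigma_B r0 q beta_s)
        (cst Emax.1, cst Emax.2) Tmax)
    (Tinf : fun2 R)
    (Tmax_cvg : cvg_uniform_bar Tmax Tinf) :
  warmest_stationary kappa_a kappa_s
    (G0 gamma_a gamma_s lambda eps_a sigma_B r0 q beta_s) Tinf.
Proof.
have [Lb Lb_ge0 beta_lipschitz] := W1_oo_lipschitz beta_W1oo.
have [B beta_le] := W1_oo_nondecreasing_bounded beta_W1oo beta_nondecreasing.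
have [Mq qM] := hoelder_bounded theta0_gt0 q_hoelder q_Loo.
have q_measurable := Lp_oo_measurable (@measurable_I1 R) q_Loo.
have q_bounds x : I1 x -> 0 <= q x <= sup (q @` @I1 R).
  move=> Ix; apply/andP; split; first exact/q_ge0/mem_set.
  apply: ub_le_sup; last by exists x.
  by exists Mq => _ [y Iy <-]; exact: qM.
have T0H : inHH ((cst Emax.1, cst Emax.2) : fun2 R) by split; exact: L2_cst.
have lim := limit_stationary gamma_a_gt0 gamma_s_gt0 sigma_B_gt0 lambda_ge0 eps_a_gt0 eps_a_lt2
  r0_gt0 Lb_ge0 beta_lipschitz q_measurable q_bounds S_generated T0H Tmax_solution Tmax_cvg.
split=> // F statF x /set_mem Jx.
have [cF DF _] := statF.
have [_ GFH] := continuous2_bar_reaction gamma_a_gt0 gamma_s_gt0 sigma_B_gt0 lambda_ge0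
  eps_a_gt0 eps_a_lt2 r0_gt0 Lb_ge0 beta_lipschitz q_measurable q_bounds cF.
have FE := stationary_le_warmest gamma_a_gt0 gamma_s_gt0 sigma_B_gt0 lambda_ge0 eps_a_gt0
  eps_a_lt2 r0_gt0 Lb_ge0 beta_lipschitz beta_gt0 beta_le q_bounds
  kappa_a_gt0 kappa_s_gt0 statF Emax_warmest.
have FT t : 0 <= t -> continuous2_bar (Tmax t) ->
    F.1 x <= (Tmax t).1 x /\ F.2 x <= (Tmax t).2 x.
  move=> t0 [cT1 cT2]; have [cF1 cF2] := cF.
  have ae := stationary_le_mild gamma_a_gt0 gamma_s_gt0 sigma_B_gt0 lambda_ge0 eps_a_gt0
    eps_a_lt2 r0_gt0 Lb_ge0 beta_lipschitz beta_nondecreasing q_measurable q_bounds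
    kappa_a_gt0 kappa_s_gt0 S_generated statF T0H Tmax_solution GFH
    (fun z Iz => FE z (I1_I1bar Iz)) t0.
  have le (f g : R -> R) : {within @I1bar R, continuous f} -> {within @I1bar R, continuous g} ->
      {ae @lebesgue_measure R, forall z, I1 z -> f z <= g z} -> f x <= g x.
    move=> cf cg fg; rewrite -subr_le0.
    apply: (@ae_le_bar _ (fun z => f z - g z)) => //.
      by move=> z; apply: continuousB; [exact: cf|exact: cg].
    by apply: filterS fg => z h /h; rewrite subr_le0.
  by split; apply: le => //; apply: filterS ae => z h /h[].
split; apply/ler_addgt0Pr => e e0; have [t t0 Ht] := cvg_uniform_bar_near Tmax_cvg e0.
- have [cT /(_ x Jx)[h _]] := Ht t (lexx t); have [h' _] := FT t t0 cT.
  by move: h; rewrite ltr_norml => /andP[h _]; lra.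
- have [cT /(_ x Jx)[_ h]] := Ht t (lexx t); have [_ h'] := FT t t0 cT.
  by move: h; rewrite ltr_norml => /andP[h _]; lra.
Qed.
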